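(* (i) Let $\theta_1,\dots,\theta_r$ be real numbers, with the random variable $Z_\theta$ as defined in the context, and let $f_1,\dots,f_D\in\mathbb{C}(X_1,\dots,X_r)$ be pairwise distinct, real-valued and without poles on $\mathbb{T}^r$. Let $G=(G_1,\dots,G_D):t\mapsto(F_1(t),\dots,F_D(t))+o(1)\in\mathbb{R}^D$ as $t\to+\infty$, where $F_j(t)=f_j(e^{i\theta_1t},\dots,e^{i\theta_rt})$ for $1\le j\le D$. Then $$\mathbb{P}(f_1(Z_\theta)>\dots>f_D(Z_\theta))\le\underline{\delta}(G_1>\dots>G_D)\le\overline{\delta}(G_1>\dots>G_D)\le\mathbb{P}(f_1(Z_\theta)\ge\dots\ge f_D(Z_\theta)).$$ Moreover, if for every $1\le j\le D-1$ there exists $y\in\mathbb{R}$ such that $F_j(y)\ne F_{j+1}(y)$, then $\delta(G_1>\dots>G_D)$ exists and $$\delta(G_1>\dots>G_D)=\mathbb{P}(f_1(Z_\theta)>\dots>f_D(Z_\theta)).$$ (ii) Let $(\theta_n)_{n\ge1}$ be a sequence of pairwise distinct positive real numbers and $\Theta=\{\theta_n:n\ge1\}$. Let $F_1,\dots,F_D:\mathbb{R}^+\to\mathbb{R}$ be $B^1$-almost periodic functions such that for $1\le j\le D$, $F_j\sim c_j+\sum_{\theta\in\Theta}\left(a_{\theta,j}e^{i\theta t}+\overline{a_{\theta,j}}e^{-i\theta t}\right)$, where $c_j\in\mathbb{R}$ and $a_{\theta,j}\in\mathbb{C}$, and let $G=(G_1,\dots,G_D):t\mapsto(F_1(t),\dots,F_D(t))+o(1)\in\mathbb{R}^D$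 as $t\to+\infty$. Let $(S_1,\dots,S_D)$ be a random vector distributed according to the limiting distribution of $(F_1,\dots,F_D)$. Then $$\mathbb{P}(S_1>\dots>S_D)\le\underline{\delta}(G_1>\dots>G_D)\le\overline{\delta}(G_1>\dots>G_D)\le\mathbb{P}(S_1\ge\dots\ge S_D).$$ Moreover, if $\mathrm{Span}_{\mathbb{Q}}\Theta=\mathrm{Span}_{\mathbb{Q}}T\oplus\mathrm{Span}_{\mathbb{Q}}(\Theta\setminus T)$ for some non-empty finite subset $T$ of $\Theta$, and if for every $1\le j\le D-1$ there exists $\theta\in T$ such that $a_{\theta,j}\ne a_{\theta,j+1}$, then $\delta(G_1>\dots>G_D)$ exists and $$\delta(G_1>\dots>G_D)=\mathbb{P}(S_1>\dots>S_D).$$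
   Context: $\mathbb{T}=\{z\in\mathbb{C}:|z|=1\}$. All functions of a real variable are Lebesgue measurable. A rational function has no pole on $\mathbb{T}^r$ if it can be written $P/Q$ with polynomials $P,Q$ such that $Q$ does not vanish on $\mathbb{T}^r$; it is real-valued on $\mathbb{T}^r$ if it takes real values there. $\underline{\delta}(G_1>\dots>G_D)$ and $\overline{\delta}(G_1>\dots>G_D)$ are the $\liminf$ and $\limsup$ as $X\to+\infty$ of $\frac1X\int_0^X\mathbf{1}_{x_1>\dots>x_D}(G_1(y),\dots,G_D(y))\,\mathrm{d}y$, where $\mathbf{1}_{x_1>\dots>x_D}$ is the indicator of $\{x\in\mathbb{R}^D:x_1>\dots>x_D\}$; $\delta(G_1>\dots>G_D)$ is the limit when it exists. Random variable $Z_\theta$ in (i): let $m=\dim_{\mathbb{Q}}\mathrm{Span}_{\mathbb{Q}}(\theta_1,\dots,\theta_r)$. After reindexing the $\theta_i$ (and correspondingly the variables $X_i$), it is assumed that $\{\theta_1,\dots,\theta_m\}$ is a basis of this space, and one writes $\theta_j=\sum_{k=1}^m b_{k,j}\theta_k$ for $m+1\le j\le r$, with $b_{k,j}\in\mathbb{Q}$. Let $d\ge1$ be the least common multiple of the denominators of all the $b_{k,j}$ ($d=1$ if $m=r$), and $h_{k,j}=d\,b_{k,j}\in\mathbb{Z}$. Then $Z_\theta=\left(Z_1^d,\dots,Z_m^d,\prod_{k=1}^mZ_k^{h_{k,m+1}},\dots,\prod_{k=1}^mZ_k^{h_{k,r}}\right)$ where $Z_1,\dots,Z_m$ are independent uniform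 random variables on $\mathbb{T}$. For (ii): the $B^1$ semi-norm of a locally integrable function $f$ is $\|f\|_{B^1}=\limsup_{X\to+\infty}\frac1X\int_0^X|f(y)|\,\mathrm{d}y$. A (locally integrable) function $F:\mathbb{R}^+\to\mathbb{R}$ is $B^1$-almost periodic if there is a sequence $(P_N)_{N\ge1}$ of trigonometric polynomials $P_N(t)=\sum_{n=1}^{D_N}r_{n,N}e^{i\lambda_{n,N}t}$ ($r_{n,N}\in\mathbb{C}$, $\lambda_{n,N}\in\mathbb{R}$) with $\|F-P_N\|_{B^1}\to0$. The notation $F\sim c+\sum_{\theta\in\Theta}(a_\theta e^{i\theta t}+\overline{a_\theta}e^{-i\theta t})$ means that $\|F-P_N\|_{B^1}\to0$ as $N\to+\infty$, where $P_N(t)=c+\sum_{n\le N}(a_{\theta_n}e^{i\theta_nt}+\overline{a_{\theta_n}}e^{-i\theta_nt})$. A function $E:\mathbb{R}^+\to\mathbb{R}^D$ admits the limiting distribution $\mu$ if $\mu$ is a Borel probability measure on $\mathbb{R}^D$ such that $\frac1X\int_0^Xg(E(y))\,\mathrm{d}y\to\int_{\mathbb{R}^D}g\,\mathrm{d}\mu$ as $X\to+\infty$ for every bounded continuous $g:\mathbb{R}^D\to\mathbb{R}$; vectors of $B^1$-almost periodic functions are known to admit limiting distributions. *)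

(* Defs.v *)
(* mpoly is imported without its notations, which clash with those of
   all_analysis. *)
From HB Require Import structures.
From mathcomp Require Import all_boot all_order all_algebra fraction.
From mathcomp Require Import complex.
From mathcomp Require Import all_classical all_reals all_analysis.
From mathcomp.multinomials Require Import -(notations) mpoly.

Set Implicit Arguments.
Unset Strict Implicit.
Unset Printing Implicit Defensive.

Import Order.TTheory GRing.Theory Num.Theory.
Import numFieldNormedType.Exports.

Local Open Scope classical_set_scope.
Local Open Scope ring_scope.
Local Open Scope complex_scope.

(* R with the sigma-algebra of all Lebesgue measurable sets (not only the Borel
   sets): the domain of completed_lebesgue_measure. *)
Definition lebesgueType (R : realType) : measurableType _ :=
  caratheodory_type ((wlength (idfun : R -> R))^*)%mu.

Definition borelType (T : ptopologicalType) : measurableType _ :=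
  g_sigma_algebraType (@open T).

(* R[i]^o carries the topology of the modulus. *)
Definition borelC (R : realType) := borelType R[i]^o.
Definition borelRn (R : realType) (D : nat) := borelType 'rV[R]_D.

Section RealFunctions.
Context {R : realType}.
Implicit Types (X t : R).

(* Functions on R^+ are represented by functions on R; only their restriction
   to [0, +oo[ matters below. *)
Definition lebesgue_measurable (f : R -> R) : Prop :=
  measurable_fun (`[0, +oo[ : set (lebesgueType R)) (f : lebesgueType R -> R).

Definition loc_integrable (f : R -> R) : Prop :=
  forall X, (@completed_lebesgue_measure R).-integrable `[0, X] (EFin \o f).

Definition average (f : R -> \bar R) (X : R) : \bar R :=
  ((X^-1)%:E * \int[@completed_lebesgue_measure R]_(y in `[0%R, X]) f y)%E.

Definition decreasing_vec (D : nat) : set ('I_D -> R) :=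
  [set x | forall i j : 'I_D, j = i.+1 :> nat -> x i > x j].

Definition nonincreasing_vec (D : nat) : set ('I_D -> R) :=
  [set x | forall i j : 'I_D, j = i.+1 :> nat -> x i >= x j].

Definition ordering_freq (D : nat) (G : 'I_D -> R -> R) : R -> \bar R :=
  average (fun y => (\1_(@decreasing_vec D) (G ^~ y))%:E).

Definition lower_density (D : nat) (G : 'I_D -> R -> R) : \bar R :=
  limf_einf (ordering_freq G) (pinfty_nbhs R).

Definition upper_density (D : nat) (G : 'I_D -> R -> R) : \bar R :=
  limf_esup (ordering_freq G) (pinfty_nbhs R).

(* The density exists and equals l. *)
Definition has_density (D : nat) (G : 'I_D -> R -> R) (l : \bar R) : Prop :=
  ordering_freq G X @[X --> +oo] --> l.

Definition equal_up_to_o1 (D : nat) (G F : 'I_D -> R -> R) : Prop :=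
  forall j, G j t - F j t @[t --> +oo] --> 0.

Definition Qspan (A : set R) : set R :=
  [set x | exists n (c : 'I_n -> rat) (v : 'I_n -> R),
    (forall k, A (v k)) /\ x = \sum_(k < n) ratr (c k) * v k].

Definition Qindependent (n : nat) (v : 'I_n -> R) : Prop :=
  forall c : 'I_n -> rat,
    \sum_(k < n) ratr (c k) * v k = 0 -> forall k, c k = 0.

Definition is_direct_sum (V A B : set R) : Prop :=
  V = [set a + b | a in A & b in B] /\ A `&` B = [set 0].

End RealFunctions.

Section RationalFunctions.
Context {R : realType}.

Definition cexpi (t : R) : R[i] := cos t +i* sin t.

Definition torus (r : nat) : set ('I_r -> R[i]) :=
  [set z | forall i, `|z i| = 1].

Definition ratfun (r : nat) := {fraction (mpoly r R[i])}.

Definition no_pole_on_torus (r : nat) (f : ratfun r) : Prop :=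
  exists P Q : mpoly r R[i],
    f = tofrac P / tofrac Q /\ forall z, torus z -> meval z Q != 0.

(* The value does not depend on the representation P / Q with Q(z) <> 0; it is
   set to 0 where there is none. *)
Definition ratfun_eval (r : nat) (f : ratfun r) (z : 'I_r -> R[i]) : R[i] :=
  xget 0 [set w | exists P Q : mpoly r R[i],
    [/\ f = tofrac P / tofrac Q, meval z Q != 0 & w = meval z P / meval z Q]].

Definition real_valued_on_torus (r : nat) (f : ratfun r) : Prop :=
  forall z, torus z -> complex.Im (ratfun_eval f z) = 0.

(* Meant for f real-valued on the torus and z on the torus. *)
Definition ratfun_real (r : nat) (f : ratfun r) (z : 'I_r -> R[i]) : R :=
  complex.Re (ratfun_eval f z).

End RationalFunctions.

Section Ztheta.
Context {R : realType}.

(* Instead of reindexing theta, e lists the positions of the elements of a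
   Q-basis of Span_Q(theta); b gives the coordinates of the others. *)
Definition Qbasis_coords (r m : nat) (theta : 'I_r -> R)
    (e : 'I_m -> 'I_r) (b : 'I_m -> 'I_r -> rat) : Prop :=
  Qindependent (theta \o e) /\
  forall j, j \notin codom e ->
    theta j = \sum_(k < m) ratr (b k j) * theta (e k).

Definition common_denom (r m : nat)
    (e : 'I_m -> 'I_r) (b : 'I_m -> 'I_r -> rat) : nat :=
  \big[lcmn/1%N]_(k < m) \big[lcmn/1%N]_(j < r | j \notin codom e)
    `|denq (b k j)|%N.

(* numq of the integer d * b_{k,j} is that integer itself. *)
Definition hcoef (r m : nat) (e : 'I_m -> 'I_r) (b : 'I_m -> 'I_r -> rat)
    (k : 'I_m) (j : 'I_r) : int :=
  numq ((common_denom e b)%:R * b k j).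

Definition Ztheta (r m : nat) (e : 'I_m -> 'I_r) (b : 'I_m -> 'I_r -> rat)
    (z : 'I_m -> R[i]) (j : 'I_r) : R[i] :=
  if [pick k | e k == j] is Some k then z k ^+ common_denom e b
  else \prod_(k < m) z k ^ hcoef e b k j.

Lemma two_pi_gt0 : (0 : R) < pi *+ 2.
Proof. by rewrite pmulrn_lgt0 // pi_gt0. Qed.

Definition uniform_on_circle d (Omega : measurableType d)
    (P : probability Omega R) (Z : {RV P >-> borelC R}) : Prop :=
  (forall w, `|Z w : R[i]| = 1) /\
  forall A : set (borelC R), measurable A ->
    distribution P Z A = uniform_prob two_pi_gt0 (cexpi @^-1` A).

Definition independent_RVs d (Omega : measurableType d)
    (P : probability Omega R) d' (T : measurableType d') (m : nat)
    (Z : 'I_m -> {RV P >-> T}) : Prop :=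
  forall A : 'I_m -> set T, (forall k, measurable (A k)) ->
    P (\bigcap_k (Z k @^-1` A k)) = (\prod_(k < m) P (Z k @^-1` A k))%E.

End Ztheta.

Section AlmostPeriodic.
Context {R : realType}.

Definition B1norm (f : R -> R[i]) : \bar R :=
  limf_esup (average (fun y => (Normc.normc (f y))%:E)) (pinfty_nbhs R).

Definition trig_poly (p : R -> R[i]) : Prop :=
  exists n (c : 'I_n -> R[i]) (lambda : 'I_n -> R),
    forall t, p t = \sum_(k < n) c k * cexpi (lambda k * t).

Definition B1_almost_periodic (F : R -> R) : Prop :=
  loc_integrable F /\
  exists p : nat -> R -> R[i], (forall N, trig_poly (p N)) /\
    B1norm (fun t => (F t)%:C - p N t) @[N --> \oo] --> 0%E.

(* F ~ c + sum over theta_0, theta_1, ... ; N is the number of frequencies of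
   the partial sum. *)
Definition B1_expansion (F : R -> R) (theta : nat -> R) (c : R)
    (a : R -> R[i]) : Prop :=
  B1norm (fun t => (F t)%:C - (c%:C + \sum_(n < N)
      (a (theta n) * cexpi (theta n * t)
       + (a (theta n))^* * cexpi (- (theta n * t)))))
    @[N --> \oo] --> 0%E.

Definition limiting_distribution (D : nat) (E : R -> 'rV[R]_D)
    (mu : probability (borelRn R D) R) : Prop :=
  forall g : 'rV[R]_D -> R, continuous g ->
    (exists M : R, forall x, `|g x| <= M) ->
    average (fun y => (g (E y))%:E) X @[X --> +oo]
      --> (\int[mu]_x (g x)%:E)%E.

End AlmostPeriodic.

(* Main.v *)
Require Import Defs.
From HB Require Import structures.
From mathcomp Require Import all_boot all_order all_algebra fraction.
From mathcomp Require Import complex.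
From mathcomp Require Import all_classical all_reals all_analysis.
From mathcomp.multinomials Require Import -(notations) mpoly.
From mathcomp Require Import measurable_realfun ring lra.
Import Order.TTheory GRing.Theory Num.Theory.
Import numFieldNormedType.Exports.
Local Open Scope classical_set_scope.
Local Open Scope ring_scope.
Set Implicit Arguments.
Unset Strict Implicit.
Unset Printing Implicit Defensive.

(** Both parts reduce to one real quantity.  The ordering of $(G_1,\dots,G_D)$ is
    decided by the sign of the gap, the smallest of the differences
    $G_j - G_{j+1}$, and the gap of $G$ is close to the gap of $F$ at large
    times.  If the time averages of all ramp functions of the gap of $F$ converge
    to the expectations of the same ramps of the gap of the random vector, then
    squeezing the indicator of the positive reals between ramps gives the two
    inequalities, and the density exists as soon as the random gap is almost
    surely nonzero ([ordering_densities]).  So two facts are needed.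

    Convergence.  In the almost periodic case it is the definition of the limiting
    distribution, applied to a continuous function of the gap.  In the rational
    case it is the Kronecker-Weyl theorem ([kronecker_weyl]), proved for uniform
    limits of trigonometric polynomials in the angles: time averages and
    expectations of cosines are compared one by one, and independence is only used
    on finitely many products of arcs.  Uniform limits of trigonometric
    polynomials form a uniformly closed algebra; such an algebra is stable under
    absolute values, minima and inverses of functions bounded away from 0
    ([ua_abs], [ua_inv]), and therefore contains the ramps of the gap of rational
    functions without poles on the torus ([ratfun_real_utrig]).

    Absence of ties.  Let $V$ be the numerator of $f_j - f_{j+1}$, or a partial sum
    of the expansion of $F_j - F_{j+1}$.  Choose integers $\ell_k$ that are
    orthogonal to all integer relations between the frequencies, and multiply the
    $k$-th phase by $w^{\ell_k}$, $|w| = 1$.  Time averages are invariant under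
    this twist ([time_avg_phase_shift]).  For a fixed time the twisted value is a
    Laurent polynomial in $w$, of bounded degree and with one coefficient of
    constant nonzero modulus once the $\ell_k$ separate enough frequencies
    ([integer_functional]).  Hence it is small for a bounded number of the $K$-th
    roots of unity $w$ only ([laurent_small_values]), and averaging over $w$ shows
    that $V$ is small with frequency $O(1/K)$, for every $K$
    ([twisted_average_small]).  In the almost periodic case the twist acts on the
    frequencies in $T$ only, which is licit because their span is in direct sum
    with the span of the others, and the bound is uniform in the partial sum
    ([expansion_average_small]). *)

(** * Uniformly closed algebras of bounded functions *)

Section UniformAlgebra.
Context {R : realType} {X : Type}.
Implicit Types (S : set (X -> R)) (f g p : X -> R).

Definition unif_closure S : set (X -> R) :=
  [set f | forall eta : R, 0 < eta ->
    exists2 p, S p & forall x, `|f x - p x| <= eta].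

Definition bounded_algebra S :=
  [/\ forall c : R, S (cst c),
      forall f g, S f -> S g -> S (fun x => f x + g x),
      forall f g, S f -> S g -> S (fun x => f x * g x)
    & forall f, S f -> exists2 M : R, 0 < M & forall x, `|f x| <= M].

Definition uniform_algebra S := bounded_algebra S /\ unif_closure S `<=` S.

Lemma sub_unif_closure S : S `<=` unif_closure S.
Proof.
by move=> f Sf eta eta0; exists f => // x; rewrite subrr normr0 ltW.
Qed.

Lemma unif_closure_idem S : unif_closure (unif_closure S) `<=` unif_closure S.
Proof.
move=> f ccf eta eta0; have eta20 : 0 < eta / 2 by rewrite divr_gt0.
have [p cp fp] := ccf _ eta20; have [q Sq pq] := cp _ eta20.
exists q => // x; rewrite (splitr eta) -(subrKA (p x)).
by rewrite (le_trans (ler_normD _ _))// lerD.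
Qed.

Lemma unif_closure_algebra S :
  bounded_algebra S -> uniform_algebra (unif_closure S).
Proof.
move=> [Scst Sadd Smul Sbnd]; split; last exact: unif_closure_idem.
have cbnd f : unif_closure S f ->
    exists2 M : R, 0 < M & forall x, `|f x| <= M.
  move=> /(_ 1 ltr01) [p Sp fp]; have [M M0 pM] := Sbnd _ Sp.
  exists (1 + M) => [|x]; first by rewrite addr_gt0.
  by rewrite -(subrK (p x) (f x)) (le_trans (ler_normD _ _))// lerD.
split=> //.
- by move=> c; apply: sub_unif_closure.
- move=> f g cf cg eta eta0; have eta20 : 0 < eta / 2 by rewrite divr_gt0.
  have [p Sp fp] := cf _ eta20; have [q Sq gq] := cg _ eta20.
  exists (fun x => p x + q x); first exact: Sadd.
  move=> x; rewrite (splitr eta) opprD addrACA.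
  by rewrite (le_trans (ler_normD _ _))// lerD.
- move=> f g cf cg eta eta0.
  have [M M0 fM] := cbnd _ cf.
  have e0 : 0 < eta / 2 / M by rewrite !divr_gt0.
  have [q Sq gq] := cg _ e0; have [K K0 qK] := Sbnd _ Sq.
  have e1 : 0 < eta / 2 / K by rewrite !divr_gt0.
  have [p Sp fp] := cf _ e1.
  exists (fun x => p x * q x); first exact: Smul.
  move=> x.
  have -> : f x * g x - p x * q x
    = f x * (g x - q x) + (f x - p x) * q x by ring.
  rewrite (splitr eta) (le_trans (ler_normD _ _))// !normrM lerD//.
    by rewrite -(mulfVK (lt0r_neq0 M0) (eta / 2)) mulrC ler_pM.
  by rewrite -(mulfVK (lt0r_neq0 K0) (eta / 2)) ler_pM.
Qed.

Section Closed.
Variables (S : set (X -> R)) (US : uniform_algebra S).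

Lemma ua_cst (c : R) : S (fun=> c).
Proof. by case: US => -[h _ _ _] _; exact: h. Qed.

Lemma ua_add f g : S f -> S g -> S (fun x => f x + g x).
Proof. by case: US => -[_ h _ _] _; exact: h. Qed.

Lemma ua_mul f g : S f -> S g -> S (fun x => f x * g x).
Proof. by case: US => -[_ _ h _] _; exact: h. Qed.

Lemma ua_bounded f : S f -> exists2 M : R, 0 < M & forall x, `|f x| <= M.
Proof. by case: US => -[_ _ _ h] _; exact: h. Qed.

Lemma ua_closed f : unif_closure S f -> S f.
Proof. by case: US => _ h; exact: h. Qed.

Lemma ua_scale (c : R) f : S f -> S (fun x => c * f x).
Proof. by move=> Sf; apply: ua_mul => //; exact: ua_cst. Qed.

Lemma ua_opp f : S f -> S (fun x => - f x).
Proof.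
move=> Sf; rewrite (_ : (fun _ => _) = (fun x => -1 * f x)).
  exact: ua_scale.
by apply/funext => x; rewrite mulN1r.
Qed.

Lemma ua_sub f g : S f -> S g -> S (fun x => f x - g x).
Proof. by move=> Sf Sg; apply: ua_add => //; exact: ua_opp. Qed.

(** Gives the rate $1/(1 + k u)$ at which $(1-u)^k$ decreases, hence bounds
    that are uniform in [u] for the two approximation schemes below. *)
Lemma bernoulli_decay (u : R) (k : nat) :
  0 <= u <= 1 -> (1 + k%:R * u) * (1 - u) ^+ k <= 1.
Proof.
move=> /andP[u0 u1]; elim: k => [|k IH]; first by rewrite mul0r addr0 expr0 mulr1.
apply: le_trans IH; rewrite exprS mulrA ler_wpM2r ?exprn_ge0 ?subr_ge0//.
rewrite -natr1; have : 0 <= k%:R :> R by [].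
by move: (k%:R : R) => c c0; nra.
Qed.

Lemma archi_inv (eta : R) : 0 < eta -> exists k : nat, 1 <= k.+1%:R * eta.
Proof.
move=> eta0; have h := Num.Theory.archi_boundP (ltW (divr_gt0 ltr01 eta0)).
exists (Num.bound (1 / eta)); rewrite -ler_pdivrMr//.
by rewrite (le_trans (ltW h))// ler_nat.
Qed.

(** Absolute value is a uniform limit of polynomials on a bounded interval:
    the iteration $p \mapsto p + (x^2 - p^2)/2$ converges to $|x|$ from below,
    its error being multiplied by $1 - (|x|+p)/2$ at each step.  Maxima and
    minima follow. *)
Lemma ua_abs f : S f -> S (fun x => `|f x|).
Proof.
move=> Sf; have [M M0 fM] := ua_bounded Sf.
pose g x := M^-1 * f x.
have Sg : S g by exact: ua_scale.
have g1 x : `|g x| <= 1.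
  by rewrite /g normrM (@ger0_norm _ M^-1) ?invr_ge0 ?(ltW M0)// mulrC ler_pdivrMr// mul1r.
suff Sabs : S (fun x => `|g x|).
  rewrite (_ : (fun _ => _) = (fun x => M * `|g x|)); first exact: ua_scale.
  apply/funext => x; rewrite /g normrM (@ger0_norm _ M^-1) ?invr_ge0 ?(ltW M0)//.
  by rewrite mulVKf// gt_eqF.
pose p := fix p k x := if k is j.+1 then
  p j x + 2^-1 * (g x * g x - p j x * p j x) else 0.
have Sp k : S (p k).
  elim: k => [|k IH]; first exact: ua_cst.
  by apply: ua_add => //; apply: ua_scale; apply: ua_sub; exact: ua_mul.
have pP k x : 0 <= p k x /\
    0 <= `|g x| - p k x <= `|g x| * (1 - 2^-1 * `|g x|) ^+ k.
  elim: k => [|k [p0 /andP[gp0 gpk]]].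
    by rewrite subr0 expr0 mulr1 normr_ge0 lexx.
  have gg : g x * g x = `|g x| * `|g x| by rewrite -normrM ger0_norm// sqr_ge0.
  move: (g1 x) (normr_ge0 (g x)); rewrite /= gg.
  move: p0 gp0 gpk; set a := `|g x|; set b := p k x.
  rewrite exprSr mulrA; set e := a * _ ^+ k => b0 ab0 abe a1 a0.
  have eq1 : a - (b + 2^-1 * (a * a - b * b))
    = (a - b) * (1 - 2^-1 * (a + b)) by field.
  split; first nra.
  rewrite eq1; apply/andP; split; first by apply: mulr_ge0; lra.
  apply: (@le_trans _ _ ((a - b) * (1 - 2^-1 * a))).
    by apply: ler_wpM2l => //; lra.
  by apply: ler_wpM2r => //; lra.
apply: ua_closed => eta eta0.
have eta20 : 0 < eta / 2 by rewrite divr_gt0.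
have [k hk] := archi_inv eta20.
exists (p k.+1) => // x; have [_ /andP[h1 h2]] := pP k.+1 x.
rewrite ger0_norm//; apply: le_trans h2 _.
have a0 := normr_ge0 (g x); have a1 := g1 x; move: a0 a1; set a := `|g x| => a0 a1.
have u01 : 0 <= 2^-1 * a <= 1 by apply/andP; split; lra.
have := bernoulli_decay k.+1 u01.
have : 0 <= (1 - 2^-1 * a) ^+ k.+1 by apply: exprn_ge0; lra.
move: ((1 - 2^-1 * a) ^+ k.+1) (k.+1%:R : R) hk => v c hk v0 hv.
have c0 : 0 < c by rewrite -(pmulr_lgt0 _ eta20) (lt_le_trans ltr01).
suff : c * (a * v) <= c * eta by rewrite ler_pM2l.
have := mulr_ge0 a0 v0.
by nra.
Qed.

Lemma ua_max f g : S f -> S g -> S (fun x => Num.max (f x) (g x)).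
Proof.
move=> Sf Sg; under eq_fun do rewrite maxr_absE.
under eq_fun do rewrite mulrC; apply: ua_scale.
by apply: ua_add; [exact: ua_add|apply: ua_abs; exact: ua_sub].
Qed.

Lemma ua_min f g : S f -> S g -> S (fun x => Num.min (f x) (g x)).
Proof.
move=> Sf Sg; under eq_fun do rewrite minr_absE.
under eq_fun do rewrite mulrC; apply: ua_scale.
by apply: ua_sub; [exact: ua_add|apply: ua_abs; exact: ua_sub].
Qed.

Lemma ua_bigmin (I : Type) (r : seq I) (P : pred I) (c : R) (F : I -> X -> R) :
  (forall i, P i -> S (F i)) ->
  S (fun x => \big[Num.min/c]_(i <- r | P i) F i x).
Proof.
move=> SF; elim: r => [|i r IH].
  by rewrite (_ : (fun _ => _) = fun=> c); [exact: ua_cst|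
    apply/funext => x; rewrite big_nil].
have [Pi|nPi] := boolP (P i); last first.
  by under eq_fun do rewrite big_cons (negbTE nPi).
under eq_fun do rewrite big_cons Pi.
by apply: ua_min => //; exact: SF.
Qed.

(** The inverse of a function with values in $[a, M]$, $a > 0$, is the uniform
    limit of the geometric sums $M^{-1}\sum_{i<k} (1 - f/M)^i$. *)
Lemma ua_inv (a : R) f : 0 < a -> (forall x, a <= f x) -> S f ->
  S (fun x => (f x)^-1).
Proof.
move=> a0 af Sf; have [M M0 fM] := ua_bounded Sf.
pose p := fix p k x := if k is j.+1 then
  M^-1 + (1 - M^-1 * f x) * p j x else 0.
have Sp k : S (p k).
  elim: k => [|k IH]; first exact: ua_cst.
  apply: ua_add; first exact: ua_cst.
  apply: ua_mul => //; apply: ua_sub; first exact: ua_cst.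
  exact: ua_scale.
have f0 x : 0 < f x by exact: lt_le_trans (af x).
have fM1 x : M^-1 * f x <= 1.
  by rewrite mulrC ler_pdivrMr// mul1r (le_trans (ler_norm _)).
have aM x : M^-1 * a <= M^-1 * f x by rewrite ler_wpM2l// invr_ge0 ltW.
have pE k x : (f x)^-1 - p k x = (1 - M^-1 * f x) ^+ k * (f x)^-1.
  elim: k => [|k IH] /=; first by rewrite subr0 expr0 mul1r.
  rewrite exprS -mulrA -IH.
  by field; rewrite !gt_eqF.
apply: ua_closed => eta eta0.
have e0 : 0 < eta * a * (M^-1 * a).
  by rewrite !mulr_gt0// invr_gt0.
have [k hk] := archi_inv e0.
exists (p k.+1) => // x; rewrite pE.
have u0 : 0 < M^-1 * a by rewrite mulr_gt0// invr_gt0.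
have u01 : 0 <= M^-1 * f x <= 1 by rewrite fM1 andbT (le_trans (ltW u0)).
rewrite ger0_norm; last first.
  apply: mulr_ge0; first by rewrite exprn_ge0// subr_ge0.
  by rewrite invr_ge0 ltW.
rewrite ler_pdivrMr//.
have v0 : 0 <= (1 - M^-1 * f x) ^+ k.+1 by rewrite exprn_ge0// subr_ge0.
have hb := bernoulli_decay k.+1 u01.
have hu := aM x; have ha := af x.
move: u0 u01 v0 hb hk hu ha.
move: (M^-1 * f x) => u; move: (M^-1 * a) => u'; move: (f x) => y.
move: ((1 - u) ^+ k.+1) => v u'0 /andP[_ _] v0 hb hk hu ha.
have c0 : 0 < k.+1%:R :> R by rewrite ltr0n.
move: (k.+1%:R : R) hb hk c0 => c hb hk c0.
have h1 : c * u' * v <= 1.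
  apply: (le_trans _ hb); apply: ler_wpM2r => //.
  have : c * u' <= c * u by rewrite ler_pM2l.
  lra.
have cu0 : 0 < c * u' by rewrite mulr_gt0.
suff : c * u' * v <= c * u' * (eta * y) by rewrite ler_pM2l.
apply: le_trans h1 _; apply: le_trans hk _.
rewrite -!mulrA ler_pM2l// [leRHS]mulrCA ler_pM2l// mulrC ler_pM2l//.
Qed.

End Closed.
End UniformAlgebra.

(** * Trigonometric polynomials in several angles *)

Section TrigPolynomials.
Context {R : realType}.

(** Points of the torus are represented by their angles, so that a character is
    $x \mapsto \cos(h \cdot x + \phi)$ with an integer vector [h]; the phase
    $\phi$ makes one real form cover both cosines and sines. *)
Definition dot (n : nat) (h : 'I_n -> int) (x : 'I_n -> R) : R :=
  \sum_(k < n) (h k)%:~R * x k.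

Definition cosmono (n : nat) (q : R * R * ('I_n -> int)) (x : 'I_n -> R) : R :=
  q.1.1 * cos (dot q.2 x + q.1.2).

Definition trigpoly (n : nat) (s : seq (R * R * ('I_n -> int)))
  (x : 'I_n -> R) : R := \sum_(q <- s) cosmono q x.

Definition trigpolys (n : nat) : set (('I_n -> R) -> R) :=
  [set p | exists s, p = trigpoly s].

(** The continuous functions on the torus, described by approximation rather
    than by continuity: this gives at once their means along lines and under
    random angles. *)
Definition utrig (n : nat) : set (('I_n -> R) -> R) :=
  unif_closure (@trigpolys n).

Variable n : nat.
Implicit Types (h : 'I_n -> int) (x : 'I_n -> R).

Lemma dotDl h h' x : dot (fun k => h k + h' k) x = dot h x + dot h' x.
Proof. by rewrite -big_split; apply: eq_bigr => k _; rewrite intrD mulrDl. Qed.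

Lemma dotNl h x : dot (fun k => - h k) x = - dot h x.
Proof. by rewrite -sumrN; apply: eq_bigr => k _; rewrite mulrNz mulNr. Qed.

Lemma dot0l x : dot (fun=> 0) x = 0.
Proof. by apply: big1 => k _; rewrite mul0r. Qed.

Lemma dotDr h x y : dot h (fun k => x k + y k) = dot h x + dot h y.
Proof. by rewrite -big_split; apply: eq_bigr => k _; rewrite mulrDr. Qed.

Lemma dotZr h x (c : R) : dot h (fun k => x k * c) = dot h x * c.
Proof. by rewrite mulr_suml; apply: eq_bigr => k _; rewrite mulrA. Qed.

Lemma trigpolys_add (f g : ('I_n -> R) -> R) : trigpolys f -> trigpolys g ->
  trigpolys (fun x => f x + g x).
Proof.
move=> [s ->] [t ->]; exists (s ++ t); apply/funext => x.
by rewrite /trigpoly big_cat.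
Qed.

Lemma trigpolys_cosmono q : trigpolys (@cosmono n q).
Proof. by exists [:: q]; apply/funext => x; rewrite /trigpoly big_seq1. Qed.

(** Product-to-sum: trigonometric polynomials form an algebra. *)
Lemma cosmonoM (q r : R * R * ('I_n -> int)) x :
  cosmono q x * cosmono r x =
  cosmono (q.1.1 * r.1.1 / 2, q.1.2 + r.1.2, fun k => q.2 k + r.2 k) x +
  cosmono (q.1.1 * r.1.1 / 2, q.1.2 - r.1.2, fun k => q.2 k + - r.2 k) x.
Proof.
rewrite /cosmono/= !dotDl dotNl.
set u := dot q.2 x; set v := dot r.2 x.
rewrite (_ : u + v + _ = (u + q.1.2) + (v + r.1.2)); last by ring.
rewrite (_ : u - v + _ = (u + q.1.2) - (v + r.1.2)); last by ring.
rewrite (cosD (u + _)) (cosB (u + _)); set c := cos _; set s := sin _; set c' := cos _; set s' := sin _.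
by field.
Qed.

Lemma trigpolys_algebra : bounded_algebra (@trigpolys n).
Proof.
split.
- move=> c; exists [:: (c, 0, fun=> 0)]; apply/funext => x.
  by rewrite /trigpoly big_seq1 /cosmono/= dot0l addr0 cos0 mulr1.
- exact: trigpolys_add.
- move=> f g [s ->] [t ->].
  have h0 : @trigpolys n (fun=> 0).
    by exists [::]; apply/funext => x; rewrite /trigpoly big_nil.
  have hsum (I : Type) (r : seq I) (F : I -> ('I_n -> R) -> R) :
      (forall i, trigpolys (F i)) -> trigpolys (fun x => \sum_(i <- r) F i x).
    move=> tF; elim: r => [|i r IH].
      by under eq_fun do rewrite big_nil.
    by under eq_fun do rewrite big_cons; exact: trigpolys_add.
  rewrite (_ : (fun _ => _) =
     (fun x => \sum_(q <- s) \sum_(r <- t) cosmono q x * cosmono r x)).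
    apply: (hsum) => q; apply: (hsum) => r.
    under eq_fun do rewrite cosmonoM.
    by apply: trigpolys_add; exact: trigpolys_cosmono.
  apply/funext => x; rewrite /trigpoly mulr_suml; apply: eq_bigr => q _.
  by rewrite mulr_sumr.
- move=> f [s ->]; exists (1 + \sum_(q <- s) `|q.1.1|).
    by rewrite ltr_pwDl// sumr_ge0.
  move=> x; rewrite (le_trans (ler_norm_sum _ _ _))//.
  rewrite -[leLHS]add0r lerD//; apply: ler_sum => q _.
  rewrite normrM -[leRHS]mulr1 ler_wpM2l//.
  by rewrite ler_norml cos_geN1 cos_le1.
Qed.

Lemma utrig_algebra : uniform_algebra (@utrig n).
Proof. exact: unif_closure_algebra trigpolys_algebra. Qed.

Lemma utrig_cos h (phi : R) : utrig (fun x => cos (dot h x + phi)).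
Proof.
apply: sub_unif_closure; have := trigpolys_cosmono (1, phi, h).
by rewrite /cosmono /=; under eq_fun do rewrite mul1r.
Qed.

Lemma utrig_measurable d (Y : measurableType d) (x : Y -> 'I_n -> R)
    (Phi : ('I_n -> R) -> R) :
  (forall k, measurable_fun setT (fun y => x y k)) -> utrig Phi ->
  measurable_fun setT (fun y => Phi (x y)).
Proof.
move=> mx uPhi.
have mp p : trigpolys p -> measurable_fun setT (fun y => p (x y)).
  move=> [s ->]; apply: measurable_sum => q; rewrite /cosmono.
  apply: measurable_funM => //.
  apply: (@measurableT_comp _ _ _ _ _ _ (@cos R)) => //.
    by apply: continuous_measurable_fun; exact: continuous_cos.
  apply: measurable_funD => //; apply: measurable_sum => k.
  exact: measurable_funM.
have pick (m : nat) : {p | trigpolys p & forall z, `|Phi z - p z| <= m.+1%:R^-1}.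
  by apply: cid2; apply: uPhi; rewrite invr_gt0.
apply: (@measurable_fun_cvg _ _ _ _ (fun m y => (s2val (pick m)) (x y))).
  by move=> m; apply: mp; exact: s2valP.
move=> y _; apply/cvgrPdist_le => e e0.
near=> m; apply: le_trans (s2valP' (pick m) (x y)) _; apply: ltW.
by near: m; apply: (near_infty_natSinv_lt (PosNum e0)).
Unshelve. all: by end_near. Qed.

End TrigPolynomials.

(** * Time averages *)

Section TimeAverage.
Context {R : realType}.
Notation cmu := (@completed_lebesgue_measure R).

Lemma borel_lebesgue_measurable (A : set R) :
  measurable A -> measurable (A : set (lebesgueType R)).
Proof. by move=> mA; apply: sub_caratheodory. Qed.

Lemma measurable_lebesgue_id :
  measurable_fun setT (fun t : lebesgueType R => t : R).
Proof. by move=> _ A mA; rewrite setTI; exact: borel_lebesgue_measurable. Qed.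

Lemma lebesgue_measurable_itv (a b : R) :
  measurable (`[a, b] : set (lebesgueType R)).
Proof. exact: borel_lebesgue_measurable. Qed.

Lemma completed_lebesgue_itv (X : R) : 0 <= X -> cmu `[0, X] = X%:E.
Proof.
move=> X0; rewrite (_ : cmu _ = @lebesgue_measure R `[0, X])//.
by rewrite lebesgue_measure_itv/= lte_fin; case: ltgtP X0 => // [X0|<-] _;
  rewrite ?oppr0 ?adde0 -?EFinB ?subr0.
Qed.

(** The fundamental theorem of calculus is about Borel functions and the
    Lebesgue measure on Borel sets; the identity map transports it to the
    completed measure. *)
Lemma integral_completed_lebesgue (D : set R) (f : R -> R) :
  measurable D -> continuous f -> lebesgue_measure.-integrable D (EFin \o f) ->
  (\int[cmu]_(x in D) (f x)%:E = \int[@lebesgue_measure R]_(x in D) (f x)%:E)%E.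
Proof.
move=> mD cf intf.
have mf : measurable_fun setT f by exact: continuous_measurable_fun.
have mD' : measurable (D : set (lebesgueType R)) by exact: borel_lebesgue_measurable.
have mid : measurable_fun setT (fun t : lebesgueType R => t : measurableTypeR R).
  exact: measurable_lebesgue_id.
pose push := pushforward cmu (fun t : lebesgueType R => t : measurableTypeR R).
have pushI (g : R -> \bar R) :
    (\int[push]_(x in D) g x = \int[@lebesgue_measure R]_(x in D) g x)%E.
  exact: eq_measure_integral.
transitivity (\int[push]_(x in D) (EFin \o f) x)%E => //.
apply/esym; apply: (@integral_pushforward _ _ _ _ _ _ mid cmu D (EFin \o f)) => //.
  exact/measurable_EFinP.
apply/integrableP; split.
  apply/measurable_EFinP; apply: measurable_funTS.
  exact: measurableT_comp mf mid.
move/integrableP : intf => [_]; apply: le_lt_trans.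
rewrite -pushI ge0_integral_pushforward//.
by apply: measurableT_comp => //; apply/measurable_EFinP; exact: measurable_funTS.
Qed.

Definition time_avg (f : R -> R) (X : R) : R :=
  X^-1 * \int[cmu]_(y in `[0, X]) f y.

Lemma bounded_measurable_integrable (f : R -> R) (X M : R) : 0 <= X ->
  measurable_fun (`[0, X] : set (lebesgueType R)) f ->
  (forall t, `|f t| <= M) -> cmu.-integrable `[0, X] (EFin \o f).
Proof.
move=> X0 mf fM; apply: measurable_bounded_integrable => //.
- exact: lebesgue_measurable_itv.
- by rewrite /= completed_lebesgue_itv// ltry.
- exists M; split; first exact: num_real.
  by move=> x Mx t _; exact: le_trans (fM t) (ltW Mx).
Qed.

(** The primitive $\sin(w t + \phi)/w$ is bounded. *)
Lemma time_avg_cos (w phi : R) :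
  w != 0 -> time_avg (fun t => cos (w * t + phi)) X @[X --> +oo] --> (0 : R).
Proof.
move=> w0.
pose f t := cos (w * t + phi).
pose F t := w^-1 * sin (w * t + phi).
have dF (t : R) : is_derive t 1 F (f t).
  have dl : is_derive t 1 (fun t : R => w *: t + cst phi t) w.
    by apply: is_derive_eq; rewrite addr0 /GRing.scale/= mulr1.
  have dc := @is_derive1_comp _ _ _ _ _ _ (is_derive_sin _) dl.
  rewrite (_ : F = w^-1 \*: (sin \o (fun t : R => w *: t + cst phi t)))//.
  apply: (@is_derive_eq _ _ _ _ _ _ _ _ (is_deriveZ w^-1 dc)).
  by rewrite /f /GRing.scale/=; field.
have cf : continuous f.
  move=> t; apply: continuous_comp; last exact: continuous_cos.
  apply: continuousD; last exact: cvg_cst.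
  by apply: continuousM; [exact: cvg_cst|exact: cvg_id].
have cF : continuous F.
  move=> t; apply/differentiable_continuous/derivable1_diffP.
  exact: ex_derive.
have intE X : 0 < X -> \int[cmu]_(y in `[0, X]) f y = F X - F 0.
  move=> X0; rewrite /Rintegral integral_completed_lebesgue//; last first.
    apply: continuous_compact_integrable; first exact: segment_compact.
    exact: continuous_subspaceT.
  rewrite (@continuous_FTC2 _ _ F)//.
  - exact: continuous_subspaceT.
  - split; first by move=> t _; exact: ex_derive.
    + exact/cvg_at_right_filter/cF.
    + exact/cvg_at_left_filter/cF.
  - by move=> t _; rewrite derive1E derive_val.
have w0' : 0 < `|w| by rewrite normr_gt0.
apply/cvgr0Pnorm_le => eps eps0.
near=> X.
have X0 : 0 < X by near: X; exact: nbhs_pinfty_gt.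
rewrite /time_avg intE// normrM normfV (gtr0_norm X0) ler_pdivrMl//.
rewrite /F -mulrBr normrM normfV ler_pdivrMl//.
apply: (@le_trans _ _ 2).
  rewrite (le_trans (ler_normB _ _))// -[leRHS]/(1 + 1) lerD//.
    by rewrite ler_norml sin_geN1 sin_le1.
  by rewrite ler_norml sin_geN1 sin_le1.
rewrite mulrCA -ler_pdivrMr; last by rewrite mulr_gt0.
by near: X; apply: nbhs_pinfty_ge; exact: num_real.
Unshelve. all: by end_near. Qed.

End TimeAverage.

Section TimeAverageTheory.
Context {R : realType}.
Implicit Types (f g : R -> R) (X : R).
Notation cmu := (@completed_lebesgue_measure R).

Lemma loc_integrableD f g : loc_integrable f -> loc_integrable g ->
  loc_integrable (fun t => f t + g t).
Proof.
move=> lf lg X; rewrite (_ : EFin \o _ = (EFin \o f) \+ (EFin \o g))%E//.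
by apply: integrableD => //; exact: lebesgue_measurable_itv.
Qed.

Lemma loc_integrableZ f (c : R) : loc_integrable f ->
  loc_integrable (fun t => c * f t).
Proof.
move=> lf X; rewrite (_ : EFin \o _ = (fun t => c%:E * (EFin \o f) t)%E)//.
by apply: integrableZl => //; exact: lebesgue_measurable_itv.
Qed.

Lemma loc_integrableB f g : loc_integrable f -> loc_integrable g ->
  loc_integrable (fun t => f t - g t).
Proof.
move=> lf lg; apply: loc_integrableD => //.
by under eq_fun do rewrite -mulN1r; exact: loc_integrableZ.
Qed.

Lemma loc_integrable_bounded f (M : R) :
  (forall X, measurable_fun (`[0, X] : set (lebesgueType R)) f) ->
  (forall t, `|f t| <= M) -> loc_integrable f.
Proof.
move=> mf fM X; have [X0|X0] := leP 0 X.
  exact: bounded_measurable_integrable fM.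
by rewrite set_itv_ge -?ltNge//; exact: integrable_set0.
Qed.

Lemma loc_integrable_measurable f X : loc_integrable f ->
  measurable_fun (`[0, X] : set (lebesgueType R)) f.
Proof. by move=> /(_ X) /measurable_int /measurable_EFinP. Qed.

Lemma measurable_lebesgue_affine (w phi : R) :
  measurable_fun setT (fun t : lebesgueType R => w * t + phi).
Proof.
exact: (measurable_funD (measurable_funM (measurable_cst w) measurable_lebesgue_id)
  (measurable_cst phi)).
Qed.

Lemma loc_integrable_cos (w phi : R) :
  loc_integrable (fun t => cos (w * t + phi)).
Proof.
have mcos := continuous_measurable_fun (@continuous_cos R).
have m X := measurable_funTS (D := (`[0, X] : set (lebesgueType R)))
  (measurableT_comp mcos (measurable_lebesgue_affine w phi)).
apply: (loc_integrable_bounded (M := 1) m) => t.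
by rewrite ler_norml cos_geN1 cos_le1.
Qed.

Lemma loc_integrable_norm f : loc_integrable f ->
  loc_integrable (fun t => `|f t|).
Proof. by move=> lf X; exact: (integrable_norm (lf X)). Qed.

Lemma loc_integrable_cst (c : R) : loc_integrable (fun=> c).
Proof. by apply: (@loc_integrable_bounded _ `|c|) => // X. Qed.

Lemma loc_integrable_sum (I : Type) (r : seq I) (F : I -> R -> R) :
  (forall i, loc_integrable (F i)) ->
  loc_integrable (fun t => \sum_(i <- r) F i t).
Proof.
move=> lF; elim: r => [|i r IH].
  by under eq_fun do rewrite big_nil; exact: loc_integrable_cst.
by under eq_fun do rewrite big_cons; exact: loc_integrableD.
Qed.

Lemma average_time_avg f X : loc_integrable f ->
  average (EFin \o f) X = (time_avg f X)%:E.
Proof.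
move=> lf; rewrite /average /time_avg EFinM /Rintegral fineK//.
by apply: integrable_fin_num => //; exact: lebesgue_measurable_itv.
Qed.

Lemma time_avgD f g X : loc_integrable f -> loc_integrable g ->
  time_avg (fun t => f t + g t) X = time_avg f X + time_avg g X.
Proof.
move=> lf lg; rewrite /time_avg -mulrDr RintegralD//.
exact: lebesgue_measurable_itv.
Qed.

Lemma time_avgZ f (c : R) X : loc_integrable f ->
  time_avg (fun t => c * f t) X = c * time_avg f X.
Proof.
move=> lf; rewrite /time_avg mulrCA RintegralZl//.
exact: lebesgue_measurable_itv.
Qed.

Lemma time_avgB f g X : loc_integrable f -> loc_integrable g ->
  time_avg (fun t => f t - g t) X = time_avg f X - time_avg g X.
Proof.
move=> lf lg; rewrite /time_avg -mulrBr RintegralB//.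
exact: lebesgue_measurable_itv.
Qed.

Lemma time_avg_cst (c : R) X : 0 < X -> time_avg (fun=> c) X = c.
Proof.
move=> X0; rewrite /time_avg Rintegral_cst; last exact: lebesgue_measurable_itv.
rewrite [fine _](_ : _ = fine X%:E); last first.
  by congr fine; apply: completed_lebesgue_itv; exact: ltW.
by rewrite mulrCA mulVf ?mulr1// gt_eqF.
Qed.

Lemma le_time_avg f g X : 0 < X -> loc_integrable f -> loc_integrable g ->
  (forall t, 0 <= t -> f t <= g t) -> time_avg f X <= time_avg g X.
Proof.
move=> X0 lf lg fg; rewrite /time_avg ler_wpM2l ?invr_ge0 ?(ltW X0)//.
apply: le_Rintegral => //; first exact: lebesgue_measurable_itv.
by move=> t; rewrite /= in_itv/= => /andP[t0 _]; exact: fg.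
Qed.

Lemma time_avg_norm f X : 0 < X -> loc_integrable f ->
  `|time_avg f X| <= time_avg (fun t => `|f t|) X.
Proof.
move=> X0 lf; rewrite /time_avg normrM ger0_norm ?invr_ge0 ?(ltW X0)//.
rewrite ler_wpM2l ?invr_ge0 ?(ltW X0)//.
apply: le_normr_Rintegral => //; exact: lebesgue_measurable_itv.
Qed.

Lemma time_avg_dist f g (eta : R) X : 0 < X ->
  loc_integrable f -> loc_integrable g ->
  (forall t, `|f t - g t| <= eta) -> `|time_avg f X - time_avg g X| <= eta.
Proof.
move=> X0 lf lg fg; rewrite -time_avgB//.
apply: le_trans (time_avg_norm X0 (loc_integrableB lf lg)) _.
rewrite -[leRHS](time_avg_cst _ X0); apply: le_time_avg => //.
  exact/loc_integrable_norm/loc_integrableB.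
exact: loc_integrable_cst.
Qed.

Lemma time_avg_sum (I : Type) (r : seq I) (F : I -> R -> R) X :
  (forall i, loc_integrable (F i)) ->
  time_avg (fun t => \sum_(i <- r) F i t) X = \sum_(i <- r) time_avg (F i) X.
Proof.
move=> lF; elim: r => [|i r IH].
  rewrite big_nil; under [fun=> _]eq_fun do rewrite big_nil.
  by rewrite /time_avg Rintegral_cst ?mul0r ?mulr0//; exact: lebesgue_measurable_itv.
rewrite big_cons -IH -time_avgD//; last exact: loc_integrable_sum.
by congr time_avg; apply/funext => t; rewrite big_cons.
Qed.

End TimeAverageTheory.

Section LinearFlow.
Context {R : realType} {n : nat}.
Implicit Types (lam beta : 'I_n -> R) (f g Phi : ('I_n -> R) -> R).

Lemma utrig_flow_loc_integrable lam beta Phi : utrig Phi ->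
  loc_integrable (fun t => Phi (fun k => lam k * t + beta k)).
Proof.
move=> uPhi; have [M _ PhiM] := ua_bounded (utrig_algebra n) uPhi.
have mx k := measurable_lebesgue_affine (lam k) (beta k).
have mPhi X := measurable_funTS (D := (`[0, X] : set (lebesgueType R))) (utrig_measurable mx uPhi).
exact: (loc_integrable_bounded mPhi (fun t => PhiM _)).
Qed.

Lemma utrig_line_loc_integrable lam Phi : utrig Phi ->
  loc_integrable (fun t => Phi (fun k => lam k * t)).
Proof.
move=> /(utrig_flow_loc_integrable lam (fun=> 0)).
congr loc_integrable; apply/funext => t.
by congr Phi; apply/funext => k; rewrite addr0.
Qed.

(** Three-epsilon argument, which reduces every comparison of means in this
    development to single cosines. *)
Lemma utrig_functional_cvg (L : R -> (('I_n -> R) -> R) -> R)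
    (L0 : (('I_n -> R) -> R) -> R) (C : R) :
  0 < C ->
  (forall X f g eta, 0 < X -> utrig f -> utrig g ->
    (forall x, `|f x - g x| <= eta) -> `|L X f - L X g| <= C * eta) ->
  (forall f g eta, utrig f -> utrig g ->
    (forall x, `|f x - g x| <= eta) -> `|L0 f - L0 g| <= C * eta) ->
  (forall X f g, utrig f -> utrig g ->
    L X (fun x => f x + g x) = L X f + L X g) ->
  (forall f g, utrig f -> utrig g ->
    L0 (fun x => f x + g x) = L0 f + L0 g) ->
  (forall q, L X (@cosmono R n q) @[X --> +oo] --> L0 (@cosmono R n q)) ->
  forall Phi, utrig Phi -> L X Phi @[X --> +oo] --> L0 Phi.
Proof.
move=> C0 Llip L0lip LD L0D Lcos Phi uPhi.
have u0 : @utrig R n (fun=> 0) by exact: (ua_cst (utrig_algebra n)).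
have additive0 (l : (('I_n -> R) -> R) -> R) :
    (forall f g, utrig f -> utrig g -> l (fun x => f x + g x) = l f + l g) ->
    l (fun=> 0) = 0.
  move=> lD; have := lD _ _ u0 u0; under eq_fun do rewrite addr0.
  by move/eqP; rewrite -subr_eq subrr => /eqP.
have ucos q : utrig (@cosmono R n q).
  by apply: sub_unif_closure; exact: trigpolys_cosmono.
have Ltrig s : L X (@trigpoly R n s) @[X --> +oo] --> L0 (@trigpoly R n s).
  elim: s => [|q s IH].
    rewrite (_ : trigpoly [::] = fun=> 0); last first.
      by apply/funext => x; rewrite /trigpoly big_nil.
    rewrite additive0//.
    rewrite (_ : (fun X => _) = fun=> 0); first exact: cvg_cst.
    by apply/funext => X; apply: additive0 => f g; exact: LD.
  have us : utrig (@trigpoly R n s).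
    by apply: sub_unif_closure; exists s.
  rewrite (_ : trigpoly (q :: s) = fun x => cosmono q x + trigpoly s x).
    rewrite L0D//.
    rewrite (_ : (fun X => _) = fun X => L X (cosmono q) + L X (trigpoly s)).
      exact: cvgD.
    by apply/funext => X; exact: LD.
  by apply/funext => x; rewrite /trigpoly big_cons.
apply/cvgrPdist_le => eps eps0.
have e0 : 0 < eps / 3 / C by rewrite !divr_gt0.
have [p [s ps] Php] := uPhi _ e0.
have up : utrig p by apply: sub_unif_closure; exists s.
have hC : C * (eps / 3 / C) = eps / 3 by rewrite mulrC divfK// gt_eqF.
have e3 : 0 < eps / 3 by rewrite divr_gt0.
move/cvgrPdist_le : (Ltrig s) => /(_ _ e3); rewrite -ps => Lp.
near=> X.
have X0 : 0 < X by near: X; exact: nbhs_pinfty_gt.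
rewrite (_ : L0 Phi - L X Phi = (L0 Phi - L0 p) + (L0 p - L X p)
  + (L X p - L X Phi)); last by ring.
rewrite (_ : eps = eps / 3 + eps / 3 + eps / 3); last by field.
apply: le_trans (ler_normD _ _) _; apply: lerD.
  apply: le_trans (ler_normD _ _) _; apply: lerD.
    by rewrite -hC; exact: L0lip.
  by near: X.
rewrite -hC; apply: Llip => // x; rewrite distrC; exact: Php.
Unshelve. all: by end_near. Qed.

Lemma time_avg_cosmono lam beta (q : R * R * ('I_n -> int)) :
  dot q.2 lam != 0 ->
  time_avg (fun t => cosmono q (fun k => lam k * t + beta k)) X
    @[X --> +oo] --> (0 : R).
Proof.
move=> q0; rewrite /cosmono.
have E t : cos (dot q.2 (fun k => lam k * t + beta k) + q.1.2)
    = cos (dot q.2 lam * t + (dot q.2 beta + q.1.2)).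
  by rewrite dotDr dotZr addrA.
rewrite -[0](mulr0 q.1.1).
under eq_fun => X.
  under [fun t : R => _]eq_fun do rewrite E.
  rewrite time_avgZ; last exact: loc_integrable_cos.
  over.
by apply: cvgMr; exact: time_avg_cos.
Qed.

(** The time average of a trigonometric polynomial along the line of direction
    [lam] is the sum of the terms whose frequency vector is orthogonal to [lam];
    a shift of the phases which is orthogonal to all these vectors leaves these
    terms unchanged. *)
Lemma time_avg_phase_shift lam beta Phi :
  (forall h : 'I_n -> int, dot h lam = 0 -> dot h beta = 0) -> utrig Phi ->
  time_avg (fun t => Phi (fun k => lam k * t + beta k)
                     - Phi (fun k => lam k * t)) X @[X --> +oo] --> (0 : R).
Proof.
move=> lb uPhi.
have lint f b : utrig f -> loc_integrable (fun t => f (fun k => lam k * t + b k)).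
  exact: utrig_flow_loc_integrable.
have lint0 f : utrig f -> loc_integrable (fun t => f (fun k => lam k * t)).
  exact: utrig_line_loc_integrable.
pose L X f := time_avg (fun t => f (fun k => lam k * t + beta k)
  - f (fun k => lam k * t)) X.
apply: (@utrig_functional_cvg L (fun=> 0) 2) => //.
- move=> X f g eta X0 uf ug fg; rewrite /L !time_avgB//; try by auto.
  set a := time_avg _ _; set b := time_avg _ _.
  set a' := time_avg _ _; set b' := time_avg _ _.
  rewrite (_ : a - b - (a' - b') = (a - a') - (b - b')); last by ring.
  rewrite mulr_natl mulr2n; apply: le_trans (ler_normB _ _) _.
  by apply: lerD; apply: time_avg_dist; auto.
- move=> f g eta uf ug fg; rewrite subrr normr0.
  have := le_trans (normr_ge0 _) (fg (fun=> 0)); lra.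
- move=> X f g uf ug; rewrite /L -time_avgD; try by apply: loc_integrableB; auto.
  by congr time_avg; apply/funext => t; ring.
- by move=> f g _ _; rewrite addr0.
move=> q; rewrite /L.
have [q0|q0] := eqVneq (dot q.2 lam) 0.
  under eq_fun => X.
    under [fun t : R => _]eq_fun => t.
      rewrite /cosmono dotDr lb// addr0 subrr.
      over.
    over.
  apply: cvg_near_cst; near=> X.
  by rewrite time_avg_cst//; near: X; exact: nbhs_pinfty_gt.
rewrite -[0](subr0 0).
have ucos : utrig (@cosmono R n q).
  by apply: sub_unif_closure; exact: trigpolys_cosmono.
rewrite (_ : (fun X => _) = fun X =>
    time_avg (fun t => cosmono q (fun k => lam k * t + beta k)) X
    - time_avg (fun t => cosmono q (fun k => lam k * t)) X); last first.
  by apply/funext => X; rewrite time_avgB; auto.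
apply: cvgB; first exact: time_avg_cosmono.
have := @time_avg_cosmono lam (fun=> 0) q q0.
rewrite (_ : (fun t => cosmono q _) = (fun t => cosmono q (fun k => lam k * t)))//.
by apply/funext => t; congr cosmono; apply/funext => k; rewrite addr0.
Unshelve. all: by end_near. Qed.

End LinearFlow.

(** * The circle and the argument *)

Section Circle.
Context {R : realType}.
Implicit Types (t x y : R).
Local Open Scope complex_scope.

Lemma cexpiD x y : cexpi (x + y) = cexpi x * cexpi y.
Proof.
by rewrite /cexpi sinD cosD; apply/eqP; rewrite eq_complex/= !eqxx/= addrC eqxx.
Qed.

Lemma cexpi0 : cexpi (0 : R) = 1.
Proof. by rewrite /cexpi cos0 sin0. Qed.

Lemma cexpiN x : cexpi (- x) = (cexpi x)^*.
Proof. by rewrite /cexpi cosN sinN. Qed.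

Lemma normc_cexpi x : Normc.normc (cexpi x) = 1.
Proof. by rewrite /= cos2Dsin2 sqrtr1. Qed.

Lemma normE_normc (z : R[i]) : `|z| = (Normc.normc z)%:C.
Proof. by case: z. Qed.

Lemma norm_cexpi x : `|cexpi x| = 1.
Proof. by rewrite normE_normc normc_cexpi. Qed.

Lemma cexpi_neq0 x : cexpi x != 0.
Proof. by rewrite -normr_eq0 norm_cexpi oner_eq0. Qed.

Lemma cexpi_sum (I : Type) (r : seq I) (P : pred I) (F : I -> R) :
  cexpi (\sum_(i <- r | P i) F i) = \prod_(i <- r | P i) cexpi (F i).
Proof. exact: (big_morph _ cexpiD cexpi0). Qed.

Lemma cexpiMn x (n : nat) : cexpi (n%:R * x) = cexpi x ^+ n.
Proof.
elim: n => [|n IH]; first by rewrite mul0r cexpi0 expr0.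
by rewrite -natr1 mulrDl mul1r cexpiD IH exprSr.
Qed.

Lemma cexpiV x : cexpi (- x) = (cexpi x)^-1.
Proof.
apply: (mulIf (cexpi_neq0 x)); rewrite -cexpiD addNr cexpi0 mulVf//.
exact: cexpi_neq0.
Qed.

Lemma cexpiMz x (h : int) : cexpi (h%:~R * x) = cexpi x ^ h.
Proof.
case: h => n; first exact: cexpiMn.
by rewrite NegzE mulrNz mulNr cexpiV -exprnN; congr (_^-1); exact: cexpiMn.
Qed.

Lemma cosD2piz x (k : int) : cos (x + (pi *+ 2) * k%:~R) = cos x.
Proof.
have posE y (n : nat) : cos (y + (pi *+ 2) * n%:R) = cos y.
  by rewrite mulr_natr periodicn//; exact: cosD2pi.
case: k => n; first exact: posE.
by rewrite -[RHS](posE _ n.+1) NegzE mulrNz -(posE (x + _) n.+1) mulrN subrK posE.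
Qed.

Definition clamp11 x : R := Num.max (-1) (Num.min 1 x).

(** The argument in $[0, 2\pi)$ of a complex number of modulus 1; clamping makes
    it a measurable function of the whole plane. *)
Definition angle (z : R[i]) : R :=
  if 0 <= complex.Im z then acos (clamp11 (complex.Re z))
  else pi *+ 2 - acos (clamp11 (complex.Re z)).

Lemma clamp11_bounds x : -1 <= clamp11 x <= 1.
Proof.
rewrite /clamp11 le_max lexx/= ge_max ge_min lexx/= andbT.
by rewrite (@le_trans _ _ 0)// lerN10.
Qed.

Lemma clamp11_id x : -1 <= x <= 1 -> clamp11 x = x.
Proof. by move=> /andP[x1 x2]; rewrite /clamp11 min_r// max_r. Qed.

Lemma acos_clamp_nonincreasing : nonincreasing_fun (fun x => acos (clamp11 x)).
Proof.
move=> x y xy; rewrite leNgt; apply/negP => axy.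
have bx := clamp11_bounds x; have by_ := clamp11_bounds y.
have inpi z : -1 <= z <= 1 -> acos z \in `[0, (pi : R)].
  by move=> bz; rewrite in_itv/= acos_ge0//= acos_lepi.
move: axy; rewrite -ltr_cos ?inpi// !acosK ?in_itv//=.
apply/negP; rewrite -leNgt /clamp11.
by rewrite ge_max !le_max lexx/= le_min !ge_min lexx xy !orbT.
Qed.

Lemma measurable_acos_clamp :
  measurable_fun setT (fun x : R => acos (clamp11 x)).
Proof. by apply: nonincreasing_measurable => //; exact: acos_clamp_nonincreasing. Qed.

Lemma Re2_Im2_circle (z : R[i]) :
  `|z| = 1 -> complex.Re z ^+ 2 + complex.Im z ^+ 2 = 1.
Proof.
by move=> z1; have := add_Re2_Im2 z; rewrite z1 expr1n => -[].
Qed.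

Lemma Re_circle (z : R[i]) : `|z| = 1 -> -1 <= complex.Re z <= 1.
Proof.
move=> /Re2_Im2_circle; case: z => a b /= ab.
have b0 := sqr_ge0 b; rewrite -ler_norml.
rewrite -(@ler_pXn2r _ 2)// ?nnegrE// ?real_normK ?num_real// expr1n; lra.
Qed.

Lemma angle_circle (z : R[i]) :
  `|z| = 1 -> cexpi (angle z) = z /\ 0 <= angle z < pi *+ 2.
Proof.
move=> z1; have Rz := Re_circle z1; have := Re2_Im2_circle z1.
rewrite /angle clamp11_id//; case: z {z1} Rz => a b /= ab1 ab.
have a0 := acos_ge0 ab1; have api := acos_lepi ab1.
have ca : cos (acos a) = a by rewrite acosK.
have sa : sin (acos a) = `|b|.
  by rewrite sin_acos// (_ : 1 - a ^+ 2 = b ^+ 2) ?sqrtr_sqr//; rewrite -ab addrC addKr.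
have pi0 := pi_gt0 R.
case: ifPn => [b0|]; last rewrite -ltNge => b0.
  split; first by rewrite /cexpi ca sa ger0_norm.
  by rewrite a0/= (le_lt_trans api)// mulr2n ltrDl.
split.
  rewrite addrC /cexpi cosD2pi sinD2pi cosN sinN ca sa.
  by rewrite ltr0_norm// opprK.
rewrite subr_ge0 (le_trans api) ?mulr2n ?lerDl ?pi_ge0//=.
rewrite ltrBlDr ltrDl lt_neqAle a0 andbT eq_sym; apply/eqP => a00.
by move: sa; rewrite a00 sin0 => /esym/eqP; rewrite normr_eq0 lt_eqF.
Qed.

Lemma cexpi_inj x y : 0 <= x < pi *+ 2 -> 0 <= y < pi *+ 2 ->
  cexpi x = cexpi y -> x = y.
Proof.
wlog xy : x y / x <= y => [hw hx hy e|].
  have [xy|yx] := leP x y; first exact: hw.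
  by apply/esym/hw => //; exact: ltW.
move=> /andP[x0 x2] /andP[y0 y2] [ec es].
have c1 : cos (y - x) = 1.
  by rewrite cosB ec es -!expr2 cos2Dsin2.
have : sin ((y - x) / 2) = 0.
  have := cosD ((y - x) / 2) ((y - x) / 2); rewrite -splitr c1.
  have := cos2Dsin2 ((y - x) / 2).
  set c := cos _; set s := sin _; rewrite -!expr2 => h1 h2.
  by apply/eqP; rewrite -sqrf_eq0; apply/eqP; lra.
move=> s0; apply/eqP; rewrite eq_le xy/= leNgt; apply/negP => xLy.
have : 0 < sin ((y - x) / 2).
  apply: sin_gt0_pi; rewrite divr_gt0 ?subr_gt0//=.
  by rewrite ltr_pdivrMr// mulr_natr; lra.
by rewrite s0 ltxx.
Qed.

Lemma angle_cexpi x : 0 <= x < pi *+ 2 -> angle (cexpi x) = x.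
Proof.
move=> x2; have [e b] := angle_circle (norm_cexpi x).
exact: cexpi_inj.
Qed.

(** The Borel sets of the reals are generated by the open intervals. *)
Lemma continuous_borel_measurable (T : ptopologicalType) (f : T -> R) :
  continuous f -> measurable_fun setT (f : borelType T -> R).
Proof.
move=> /continuousP cf.
apply: (measurability _ (RGenOpens.measurableE R)) => _ [_ [a [b ->] <-]].
rewrite setTI; apply: sub_sigma_algebra; apply: cf; exact: interval_open.
Qed.

Lemma Re_continuous : continuous (@complex.Re R : R[i]^o -> R).
Proof.
move=> z; apply/(@cvgrPdist_lt _ _ _ _ (@nbhs_filter R[i]^o z)) => e e0.
apply/nbhs_ballP; exists e%:C => [|w zw]; first by rewrite /= ltcR.
rewrite -ltcR; apply: (@le_lt_trans _ _ `|z - w|); last exact: zw.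
  by rewrite (_ : complex.Re z - _ = complex.Re (z - w)) ?normc_ge_Re//; case: z w zw => [? ?] [].
Qed.

Lemma Im_continuous : continuous (@complex.Im R : R[i]^o -> R).
Proof.
move=> z; apply/(@cvgrPdist_lt _ _ _ _ (@nbhs_filter R[i]^o z)) => e e0.
apply/nbhs_ballP; exists e%:C => [|w zw]; first by rewrite /= ltcR.
rewrite -ltcR; apply: (@le_lt_trans _ _ `|z - w|); last exact: zw.
  rewrite (_ : complex.Im z - _ = - complex.Re ((z - w) * 'i)); last first.
    by rewrite ReiNIm opprK; case: z w zw => [? ?] [].
  rewrite normrN (le_trans (normc_ge_Re _))// normrM.
  by rewrite [`|'i|](_ : _ = 1) ?mulr1// normE_normc /= expr0n expr1n add0r sqrtr1.
Qed.

Lemma measurable_angle : measurable_fun setT (angle : borelC R -> R).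
Proof.
have mRe : measurable_fun setT (@complex.Re R : borelC R -> R).
  by apply: continuous_borel_measurable; exact: Re_continuous.
have mIm : measurable_fun setT (@complex.Im R : borelC R -> R).
  by apply: continuous_borel_measurable; exact: Im_continuous.
have ma : measurable_fun setT
    (fun z : borelC R => acos (clamp11 (complex.Re (z : R[i])))).
  exact: (measurableT_comp measurable_acos_clamp mRe).
apply: measurable_fun_if => //.
- by apply: measurable_fun_ler.
- exact: measurable_funTS.
- by apply: measurable_funTS; exact: measurable_funB.
Qed.

End Circle.

(** * Expectations of independent uniform angles *)

Section Expectation.
Context {R : realType} d (Omega : measurableType d) (P : probability Omega R).
Implicit Types f g : Omega -> R.

Lemma prob_integrable f (M : R) : measurable_fun setT f ->
  (forall w, `|f w| <= M) -> P.-integrable setT (EFin \o f).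
Proof.
move=> mf fM; apply: measurable_bounded_integrable => //.
  by rewrite (_ : (_ < _)%E) // (le_lt_trans (probability_le1 P measurableT)) ?ltry.
exists M; split; first exact: num_real.
by move=> x Mx t _; exact: le_trans (fM t) (ltW Mx).
Qed.

Lemma Rintegral_prob_cst (c : R) : \int[P]_w c = c.
Proof.
rewrite Rintegral_cst//; have -> : fine (P setT) = 1 by rewrite probability_setT.
by rewrite mulr1.
Qed.

Lemma Rintegral_prob_dist f g (eta : R) :
  P.-integrable setT (EFin \o f) -> P.-integrable setT (EFin \o g) ->
  (forall w, `|f w - g w| <= eta) ->
  `|\int[P]_w f w - \int[P]_w g w| <= eta.
Proof.
move=> lf lg fg; rewrite -RintegralB//.
have lB : P.-integrable setT (EFin \o (fun w => f w - g w)).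
  rewrite (_ : _ \o _ = (EFin \o f) \- (EFin \o g))%E//; exact: integrableB.
apply: le_trans (le_normr_Rintegral _ lB) _ => //.
rewrite -[leRHS]Rintegral_prob_cst; apply: le_Rintegral => //.
- exact: integrable_norm lB.
- by apply: (@prob_integrable _ `|eta|).
Qed.

Lemma Rintegral_prob_simple (I : Type) (r : seq I) (c : I -> R)
    (B : I -> set Omega) : (forall i, measurable (B i)) ->
  \int[P]_w (\sum_(i <- r) c i * \1_(B i) w)
    = \sum_(i <- r) c i * fine (P (B i)).
Proof.
move=> mB.
have int1 i : P.-integrable setT (EFin \o (fun w => c i * \1_(B i) w)).
  apply: (@prob_integrable _ `|c i|) => [|w].
    by apply: measurable_funM => //; exact: measurable_indic.
  rewrite normrM -[leRHS]mulr1 ler_wpM2l// indicE.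
  by case: (_ \in _); rewrite ?normr1 ?normr0.
have intS s : P.-integrable setT (EFin \o (fun w => \sum_(i <- s) c i * \1_(B i) w)).
  apply: (@prob_integrable _ (\sum_(i <- s) `|c i|)) => [|w].
    by apply: measurable_sum => i; apply: measurable_funM => //; exact: measurable_indic.
  rewrite (le_trans (ler_norm_sum _ _ _))//; apply: ler_sum => i _.
  rewrite normrM -[leRHS]mulr1 ler_wpM2l// indicE.
  by case: (_ \in _); rewrite ?normr1 ?normr0.
elim: r => [|i r IH].
  rewrite big_nil -[RHS]Rintegral_prob_cst.
  by apply: eq_Rintegral => w _; rewrite big_nil.
rewrite big_cons -IH; transitivity
  (\int[P]_w (c i * \1_(B i) w + \sum_(j <- r) c j * \1_(B j) w)).
  by apply: eq_Rintegral => w _; rewrite big_cons.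
rewrite RintegralD//; congr (_ + _).
rewrite RintegralZl//; last first.
  apply: (@prob_integrable _ 1) => [|w]; first exact: measurable_indic.
  by rewrite indicE; case: (_ \in _); rewrite ?normr1 ?normr0.
by rewrite /Rintegral integral_indic// setIT.
Qed.

End Expectation.

Section CosLipschitz.
Context {R : realType}.

Lemma cos_lipschitz (x y : R) : `|cos x - cos y| <= `|x - y|.
Proof.
wlog xy : x y / x <= y => [hw|].
  by have [xy|/ltW yx] := leP x y; [exact: hw|rewrite distrC (distrC x); exact: hw].
have [|z _ e] := @MVT_segment R cos (- sin) x y xy.
  exact/continuous_subspaceT/continuous_cos.
rewrite distrC e distrC normrM -[leRHS]mul1r ler_wpM2r// normrN.
by rewrite ler_norml sin_geN1 sin_le1.
Qed.

End CosLipschitz.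

Section UniformAngles.
Context {R : realType} d (Omega : measurableType d) (P : probability Omega R).
Variables (m : nat) (Z : 'I_m -> {RV P >-> borelC R}).
Hypothesis uniZ : forall k, uniform_on_circle (Z k).
Hypothesis indZ : independent_RVs Z.

Definition angles (w : Omega) (k : 'I_m) : R := angle (Z k w).

Lemma cexpi_angles w k : cexpi (angles w k) = Z k w.
Proof. by have [Z1 _] := uniZ k; have [] := angle_circle (Z1 w). Qed.

Lemma measurable_angles k : measurable_fun setT (angles^~ k).
Proof.
exact: (measurableT_comp measurable_angle (measurable_funPT (Z k))).
Qed.

Lemma angles_bounds w k : 0 <= angles w k < pi *+ 2.
Proof. by have [Z1 _] := uniZ k; have [] := angle_circle (Z1 w). Qed.

Lemma uniform_prob_arc (a b : R) : 0 <= a -> a <= b -> b <= pi *+ 2 ->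
  uniform_prob (@two_pi_gt0 R) (cexpi @^-1` (@angle R @^-1` `[a, b[))
  = ((b - a) / (pi *+ 2))%:E.
Proof.
move=> a0 ab b2.
set U := _ @^-1` _.
rewrite /uniform_prob integral_uniform_pdf.
pose S2 : set R := if `[< U (pi *+ 2) >] then [set pi *+ 2] else set0.
have mS2 : measurable S2 by rewrite /S2; case: ifP.
have S20 : lebesgue_measure S2 = 0%E.
  by rewrite /S2; case: ifP => _; rewrite ?lebesgue_measure_set1 ?measure0.
have US : U `&` `[0, pi *+ 2] = `[a, b[%classic `|` S2.
  apply/seteqP; split => x.
  - move=> [Ux /=]; rewrite in_itv/= => /andP[x0]; rewrite le_eqVlt.
    move=> /predU1P[x2|x2].
      by right; rewrite /S2 -x2 asboolT.
    by left; move: Ux; rewrite /U/= angle_cexpi// x0.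
  - move=> [/=|].
      rewrite in_itv/= => /andP[ax xb].
      rewrite in_itv/= (le_trans a0 ax) (le_trans (ltW xb) b2); split => //.
      rewrite /U/= in_itv/= angle_cexpi ?ax//.
      by rewrite (le_trans a0 ax) (lt_le_trans xb).
    rewrite /S2; case: asboolP => // U2 -> /=; split => //.
    by rewrite in_itv/= lexx andbT (ltW (@two_pi_gt0 R)).
rewrite US (eq_integral (fun=> ((pi *+ 2)^-1)%:E)); last first.
  move=> x; rewrite -US inE => -[_ /=]; rewrite in_itv/= /uniform_pdf => ->.
  by rewrite subr0.
rewrite integral_cst//=; last exact: measurableU.
rewrite measureU0// -[X in (_ * X)%E]/(lebesgue_measure `[a, b[%classic).
rewrite lebesgue_measure_itv/= lte_fin.
case: ltgtP ab => // [ab|->] _; first by rewrite -EFinB -EFinM mulrC.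
by rewrite mule0 subrr mul0r.
Qed.

(** The only use of independence: moments of the angles will be computed from the
    probabilities of finitely many such products of arcs, without a product
    measure. *)
Lemma prob_arcs (a b : 'I_m -> R) :
  (forall k, 0 <= a k) -> (forall k, a k <= b k) -> (forall k, b k <= pi *+ 2) ->
  P [set w | forall k, a k <= angles w k < b k]
  = (\prod_(k < m) ((b k - a k) / (pi *+ 2)))%:E.
Proof.
move=> a0 ab b2.
have mA k : measurable (angle @^-1` `[a k, b k[ : set (borelC R)).
  by rewrite -[X in measurable X]setTI; exact: measurable_angle.
rewrite (_ : [set w | _] = \bigcap_k (Z k @^-1` (@angle R @^-1` `[a k, b k[))).
  rewrite indZ// -prodEFin; apply: eq_bigr => k _.
  have [_ /(_ _ (mA k))] := uniZ k.
  by rewrite /distribution /pushforward => ->; exact: uniform_prob_arc.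
apply/seteqP; split => w /= h k; last by have := h k I; rewrite /= in_itv.
by move=> _; rewrite /= in_itv/=; exact: h.
Qed.

(** Discretizing the circle into an even number of equal arcs adapted to a
    nonzero coordinate of [h], half a period of the cosine is a shift of the
    arcs; the discretized mean is therefore equal to its opposite. *)
Lemma discrete_cos_sum (N' M : nat) (h : 'I_m -> int) (k0 : 'I_m) (phi : R) :
  (0 < M)%N -> h k0 != 0 -> N'.+1 = (2 * `|h k0| * M)%N ->
  \sum_(a : {ffun 'I_m -> 'I_N'.+1})
    cos (dot h (fun k => (a k)%:R * (pi *+ 2 / N'.+1%:R)) + phi) = 0.
Proof.
move=> M0 h0 NE; set dlt : R := _ / _; set S := \sum_a _.
have N0 : (N'.+1%:R : R) != 0 by rewrite pnatr_eq0.
have Ndlt : N'.+1%:R * dlt = pi *+ 2 by rewrite mulrC divfK.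
have MN : (M < N'.+1)%N.
  have habs : (0 < `|h k0|)%N by rewrite absz_gt0.
  by rewrite NE -[ltnLHS]mul1n ltn_pmul2r// (leq_trans _ (leq_pmulr 2 habs)).
(* translating the arcs of index [k0] by [M], i.e. by half a period divided by
   [h k0], changes the sign of every term *)
suff SN : S = - S.
  by apply/eqP; rewrite -[_ == 0](mulrn_eq0 S 2) mulr2n {1}SN addNr.
pose e : {ffun 'I_m -> 'I_N'.+1} :=
  [ffun k => if k == k0 then Ordinal MN else 0].
rewrite {1}/S (reindex_inj (addIr e)) /= -sumrN; apply: eq_bigr => a _.
pose q := ((a k0 + M) %/ N'.+1)%N.
have ak0 : (a + e) k0 = ((a k0 + M) %% N'.+1)%N :> nat.
  by rewrite !ffunE eqxx.
have ak k : k != k0 -> (a + e) k = a k.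
  by move=> kk0; rewrite !ffunE (negbTE kk0) addr0.
have eqk0 : ((a + e)%R k0)%:R * dlt = (a k0)%:R * dlt + M%:R * dlt - (pi *+ 2) * q%:R.
  rewrite ak0 -Ndlt; apply/eqP; rewrite -subr_eq opprK.
  rewrite mulrAC -natrM -!mulrDl -!natrD; apply/eqP; congr (_%:R * _).
  by rewrite addnC mulnC -divn_eq.
have hM : `|(h k0)%:~R * (M%:R * dlt)| = pi :> R.
  rewrite normrM (_ : `|(h k0)%:~R : R| = `|h k0|%N%:R); last by rewrite -intr_norm -abszE.
  rewrite ger0_norm; last by rewrite !mulr_ge0 ?invr_ge0// mulrn_wge0// pi_ge0.
  apply: (mulfI (_ : (2 : R) != 0)) => //.
  transitivity ((2 * `|h k0| * M)%N%:R * dlt); first by rewrite !natrM !mulrA.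
  by rewrite -NE Ndlt mulr_natl.
have Sdot : dot h (fun k => ((a + e)%R k)%:R * dlt)
  = dot h (fun k => (a k)%:R * dlt)
    + (h k0)%:~R * (M%:R * dlt) + (pi *+ 2) * (- (h k0) * q%:Z)%:~R.
  rewrite /dot (bigD1 k0)//= [in RHS](bigD1 k0)//= eqk0.
  rewrite (eq_bigr (fun k => (h k)%:~R * ((a k)%:R * dlt))); last first.
    by move=> k kk0; rewrite ak.
  by rewrite intrM mulrNz; ring.
rewrite Sdot addrAC cosD2piz addrAC.
move: hM; have [p0|p0] := leP 0 ((h k0)%:~R * (M%:R * dlt)).
  by rewrite ger0_norm// => ->; rewrite cosDpi.
rewrite ltr0_norm// => /eqP; rewrite eqr_oppLR => /eqP ->.
by rewrite -[in RHS](subrK pi (_ + phi)) cosDpi opprK.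
Qed.

(** The angles are replaced by the left ends of the arcs, of length
    $2\pi/N$, in which they fall; the error is of order $1/N$ because the cosine
    is 1-Lipschitz, and the discretized expectation vanishes by
    [discrete_cos_sum]. *)
Lemma Rintegral_cos_angles (h : 'I_m -> int) (k0 : 'I_m) (phi : R) :
  h k0 != 0 -> \int[P]_w cos (dot h (angles w) + phi) = 0.
Proof.
move=> h0.
have mcos : measurable_fun setT (fun w => cos (dot h (angles w) + phi)).
  exact: (utrig_measurable measurable_angles (utrig_cos h phi)).
have icos : P.-integrable setT (EFin \o (fun w => cos (dot h (angles w) + phi))).
  apply: (@prob_integrable _ _ _ _ _ 1) => // w.
  by rewrite ler_norml cos_geN1 cos_le1.
pose H : R := \sum_k `|(h k)%:~R|.
have H0 : 0 <= H by exact: sumr_ge0.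
(* the number of arcs is $2 |h_{k_0}| (M+1)$, with [M] arbitrary *)
suff bound (M : nat) :
    `|\int[P]_w cos (dot h (angles w) + phi)| <= H * (pi *+ 2) / M.+1%:R.
  apply/eqP; rewrite -normr_le0 leNgt; apply/negP => I0.
  have C0 : 0 < H * (pi *+ 2) + 1.
    by rewrite ltr_wpDl// mulr_ge0// mulrn_wge0// pi_ge0.
  have [M hM] := archi_inv (divr_gt0 I0 C0).
  have := bound M; apply/negP; rewrite -ltNge.
  rewrite ltr_pdivrMr// [ltRHS]mulrC; move: hM; rewrite mulrA ler_pdivlMr// mul1r.
  by apply: lt_le_trans; rewrite ltrDl.
pose N' := (2 * `|h k0| * M.+1).-1.
have habs : (0 < `|h k0|)%N by rewrite absz_gt0.
have NE : N'.+1 = (2 * `|h k0| * M.+1)%N.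
  by rewrite prednK// !muln_gt0 habs.
have := discrete_cos_sum phi (ltn0Sn M) h0 NE.
set dlt : R := _ / _ => S0.
have dlt0 : 0 < dlt by rewrite divr_gt0// two_pi_gt0.
have Ndlt : N'.+1%:R * dlt = pi *+ 2 by rewrite mulrC divfK ?pnatr_eq0.
pose c (a : {ffun 'I_m -> 'I_N'.+1}) :=
  cos (dot h (fun k => (a k)%:R * dlt) + phi).
pose B (a : {ffun 'I_m -> 'I_N'.+1}) : set Omega :=
  [set w | forall k, (a k)%:R * dlt <= angles w k < (a k).+1%:R * dlt].
pose idx w : {ffun 'I_m -> 'I_N'.+1} :=
  [ffun k => inord (Num.truncn (angles w k / dlt))].
have tr w k : (Num.truncn (angles w k / dlt))%:R * dlt <= angles w k
    < (Num.truncn (angles w k / dlt)).+1%:R * dlt.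
  have /andP[w0 _] := angles_bounds w k.
  rewrite -ler_pdivlMr// -ltr_pdivrMr//.
  by apply: truncn_itv; rewrite divr_ge0// ltW.
have trN w k : (Num.truncn (angles w k / dlt) < N'.+1)%N.
  have /andP[_ w2] := angles_bounds w k; have /andP[t1 _] := tr w k.
  rewrite -(ltr_nat R) -(ltr_pM2r dlt0) Ndlt.
  exact: le_lt_trans t1 w2.
have BE w a : B a w <-> idx w = a.
  split=> [Bw|<- k]; last by rewrite ffunE inordK.
  apply/ffunP => k; rewrite ffunE; apply/val_inj => /=; rewrite inordK//.
  have /andP[t1 t2] := tr w k; have /andP[a1 a2] := Bw k.
  apply/eqP; rewrite eqn_leq; apply/andP; split;
    rewrite -ltnS -(ltr_nat R) -(ltr_pM2r dlt0).
    exact: le_lt_trans t1 a2.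
  exact: le_lt_trans a1 t2.
have mB a : measurable (B a).
  rewrite (_ : B a = \bigcap_(k in [set: 'I_m])
      (angles^~ k) @^-1` `[(a k)%:R * dlt, (a k).+1%:R * dlt[); last first.
    apply/seteqP; split => w Bw k; first by move=> _ /=; rewrite in_itv/=; exact: Bw.
    by have := Bw k I; rewrite /= in_itv.
  apply: fin_bigcap_measurable => // k _.
  by rewrite -[X in measurable X]setTI; exact: measurable_angles.
have PB a : P (B a) = ((N'.+1%:R^-1) ^+ m)%:E.
  rewrite prob_arcs => [|k|k|k].
  - congr EFin; rewrite -[in RHS](card_ord m) -prodr_const; apply: eq_bigr => k _.
    rewrite -mulrBl -natr1 addrAC subrr add0r mul1r /dlt mulrAC mulfV ?mul1r//.
    by rewrite gt_eqF// two_pi_gt0.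
  - by rewrite mulr_ge0// ltW.
  - by rewrite ler_pM2r// ler_nat.
  - by rewrite -Ndlt ler_pM2r// ler_nat.
have cE w : c (idx w) = \sum_a c a * \1_(B a) w.
  rewrite (bigD1 (idx w))//= big1 ?addr0 => [|a aw].
    by rewrite indicE mem_set ?mulr1//; exact/BE.
  rewrite indicE memNset ?mulr0// => /BE aw'.
  by rewrite aw' eqxx in aw.
have Ec : \int[P]_w c (idx w) = 0.
  under eq_Rintegral do rewrite cE.
  rewrite Rintegral_prob_simple//.
  under eq_bigr do rewrite PB/=.
  by rewrite -mulr_suml S0 mul0r.
rewrite -[X in `|X|]subr0 -[in X in `|_ - X|]Ec.
apply: Rintegral_prob_dist => //.
  apply: (@prob_integrable _ _ _ _ _ 1) => [|w]; last first.
    by rewrite ler_norml cos_geN1 cos_le1.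
  rewrite (_ : (fun w => _) = (fun w => \sum_a c a * \1_(B a) w)); last first.
    by apply/funext => w; exact: cE.
  by apply: measurable_sum => a; apply: measurable_funM => //; exact: measurable_indic.
move=> w; apply: le_trans (cos_lipschitz _ _) _.
rewrite opprD addrACA subrr addr0 -sumrB.
apply: (@le_trans _ _ (H * dlt)).
  rewrite mulr_suml; apply: le_trans (ler_norm_sum _ _ _) _.
  apply: ler_sum => k _; rewrite -mulrBr normrM ler_wpM2l//.
  have /BE/(_ k)/andP[w1 w2] : idx w = idx w by [].
  rewrite ger0_norm ?subr_ge0// lerBlDr -{1}(mul1r dlt) -mulrDl nat1r.
  exact: ltW.
rewrite /dlt mulrA ler_wpM2l//.
  by rewrite mulr_ge0// mulrn_wge0// pi_ge0.
rewrite lef_pV2 ?posrE// ler_nat NE.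
by rewrite leq_pmull// muln_gt0.
Qed.

End UniformAngles.

(** * Equidistribution *)

Section Equidistribution.
Context {R : realType} d (Omega : measurableType d) (P : probability Omega R).
Variables (m : nat) (Z : 'I_m -> {RV P >-> borelC R}).
Hypothesis uniZ : forall k, uniform_on_circle (Z k).
Hypothesis indZ : independent_RVs Z.

Lemma utrig_prob_integrable (Phi : ('I_m -> R) -> R) : utrig Phi ->
  P.-integrable setT (EFin \o (fun w => Phi (angles Z w))).
Proof.
move=> uPhi; have [M _ PhiM] := ua_bounded (utrig_algebra m) uPhi.
apply: (@prob_integrable _ _ _ _ _ M) => [|w]; last exact: PhiM.
exact: (utrig_measurable (measurable_angles Z) uPhi).
Qed.

Lemma Qindependent_dot (alpha : 'I_m -> R) (h : 'I_m -> int) :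
  Qindependent alpha -> dot h alpha = 0 -> forall k, h k = 0.
Proof.
move=> ind h0 k; have := ind (fun k => (h k)%:~R).
have -> : \sum_(k < m) ratr (h k)%:~R * alpha k = dot h alpha.
  by apply: eq_bigr => i _; rewrite ratr_int.
by move=> /(_ h0 k) /eqP; rewrite intr_eq0 => /eqP.
Qed.

(** Kronecker-Weyl equidistribution, for uniform limits of trigonometric
    polynomials: it suffices to compare the means of the cosines. *)
Lemma kronecker_weyl (alpha : 'I_m -> R) (Phi : ('I_m -> R) -> R) :
  Qindependent alpha -> utrig Phi ->
  time_avg (fun t => Phi (fun k => alpha k * t)) X @[X --> +oo]
    --> \int[P]_w Phi (angles Z w).
Proof.
move=> ind uPhi.
have lint f : utrig f -> loc_integrable (fun t => f (fun k => alpha k * t)).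
  exact: utrig_line_loc_integrable.
pose L X f := time_avg (fun t => f (fun k => alpha k * t)) X.
pose L0 f := \int[P]_w f (angles Z w).
apply: (@utrig_functional_cvg _ _ L L0 1) => //.
- by move=> X f g eta X0 uf ug fg; rewrite mul1r; apply: time_avg_dist; auto.
- move=> f g eta uf ug fg; rewrite mul1r; apply: Rintegral_prob_dist => //.
  + exact: utrig_prob_integrable.
  + exact: utrig_prob_integrable.
- by move=> X f g uf ug; rewrite /L time_avgD; auto.
- by move=> f g uf ug; rewrite /L0 RintegralD//; exact: utrig_prob_integrable.
move=> q.
have [q0|q0] := eqVneq (dot q.2 alpha) 0.
  have h0 := Qindependent_dot ind q0.
  have cE x : cosmono q x = q.1.1 * cos q.1.2.
    by rewrite /cosmono [dot _ _]big1 ?add0r// => k _; rewrite h0 mul0r.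
  rewrite /L0 (_ : \int[P]_w _ = q.1.1 * cos q.1.2); last first.
    by rewrite -[RHS](Rintegral_prob_cst P); apply: eq_Rintegral => w _.
  apply: cvg_near_cst; near=> X; rewrite /L.
  under [fun t : R => _]eq_fun do rewrite cE.
  by rewrite time_avg_cst//; near: X; exact: nbhs_pinfty_gt.
have [k0 k00] : exists k0, q.2 k0 != 0.
  apply/existsP; apply: contraNT q0; rewrite negb_exists => /forallP h.
  by apply/eqP/big1 => k _; have /negPn/eqP -> := h k; rewrite mul0r.
rewrite (_ : L0 _ = 0).
  have := @time_avg_cosmono _ _ alpha (fun=> 0) q q0.
  rewrite /L (_ : (fun t => cosmono q _) = (fun t => cosmono q (fun k => alpha k * t)))//.
  by apply/funext => t; congr cosmono; apply/funext => k; rewrite addr0.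
rewrite /L0 /cosmono RintegralZl//; last first.
  by have := utrig_prob_integrable (utrig_cos q.2 q.1.2).
by rewrite (Rintegral_cos_angles uniZ indZ _ k00) mulr0.
Unshelve. all: by end_near. Qed.

End Equidistribution.

(** * Rational functions on the torus *)

Section RationalFunctionsOnTorus.
Context {R : realType}.
Local Open Scope complex_scope.

(** Two fractions representing [f] have cross products equal as polynomials,
    hence equal values wherever both denominators do not vanish. *)
Lemma ratfun_evalE (r : nat) (f : @ratfun R r) (P Q : mpoly r R[i]) z :
  f = tofrac P / tofrac Q -> meval z Q != 0 ->
  ratfun_eval f z = meval z P / meval z Q.
Proof.
move=> fE Qz; rewrite /ratfun_eval.
case: xgetP => [w _ [P' [Q' [fE' Qz' ->]]]|/(_ (meval z P / meval z Q))]; last first.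
  by case; exists P, Q.
have nz (q : mpoly r R[i]) : meval z q != 0 -> tofrac q != 0.
  rewrite tofrac_eq0; apply: contra_neq => ->; exact: meval0.
have : tofrac (P' * Q) = tofrac (P * Q').
  apply/eqP; rewrite !tofracM -eqr_div ?nz//; first by rewrite -fE -fE'.
move/eqP; rewrite tofrac_eq => /eqP PQ.
by apply/eqP; rewrite eqr_div// -!mevalM PQ.
Qed.

Variable n : nat.
Implicit Types g : ('I_n -> R) -> R[i].

(** Complex functions are handled through their two real coordinates, since the
    approximation theory above is real. *)
Definition ctrig g : Prop :=
  utrig (fun x => complex.Re (g x)) /\ utrig (fun x => complex.Im (g x)).

Let U := @utrig_algebra R n.

Lemma ctrig_cst (c : R[i]) : ctrig (fun=> c).
Proof. by split; exact: (ua_cst U). Qed.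

Lemma ctrigD g g' : ctrig g -> ctrig g' -> ctrig (fun x => g x + g' x).
Proof.
move=> [a b] [a' b']; split.
  rewrite (_ : (fun x => _) = fun x => complex.Re (g x) + complex.Re (g' x)).
    exact: (ua_add U).
  by apply/funext => x; case: (g x) (g' x) => [? ?] [].
rewrite (_ : (fun x => _) = fun x => complex.Im (g x) + complex.Im (g' x)).
  exact: (ua_add U).
by apply/funext => x; case: (g x) (g' x) => [? ?] [].
Qed.

Lemma ctrigM g g' : ctrig g -> ctrig g' -> ctrig (fun x => g x * g' x).
Proof.
move=> [a b] [a' b']; split.
  rewrite (_ : (fun x => _) = fun x => complex.Re (g x) * complex.Re (g' x)
    - complex.Im (g x) * complex.Im (g' x)).
    by apply: (ua_sub U); exact: (ua_mul U).
  by apply/funext => x; case: (g x) (g' x) => [? ?] [].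
rewrite (_ : (fun x => _) = fun x => complex.Re (g x) * complex.Im (g' x)
    + complex.Im (g x) * complex.Re (g' x)).
  by apply: (ua_add U); exact: (ua_mul U).
by apply/funext => x; case: (g x) (g' x) => [? ?] [].
Qed.

Lemma ctrig_sum (I : Type) (s : seq I) (F : I -> ('I_n -> R) -> R[i]) :
  (forall i, ctrig (F i)) -> ctrig (fun x => \sum_(i <- s) F i x).
Proof.
move=> cF; elim: s => [|i s IH].
  by under eq_fun do rewrite big_nil; exact: ctrig_cst.
by under eq_fun do rewrite big_cons; exact: ctrigD.
Qed.

Lemma ctrig_prod (I : Type) (s : seq I) (F : I -> ('I_n -> R) -> R[i]) :
  (forall i, ctrig (F i)) -> ctrig (fun x => \prod_(i <- s) F i x).
Proof.
move=> cF; elim: s => [|i s IH].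
  by under eq_fun do rewrite big_nil; exact: ctrig_cst.
by under eq_fun do rewrite big_cons; exact: ctrigM.
Qed.

Lemma ctrig_exp g k : ctrig g -> ctrig (fun x => g x ^+ k).
Proof.
move=> cg; elim: k => [|k IH].
  by under eq_fun do rewrite expr0; exact: ctrig_cst.
by under eq_fun do rewrite exprS; exact: ctrigM.
Qed.

Lemma ctrig_cexpi (h : 'I_n -> int) : ctrig (fun x => cexpi (dot h x)).
Proof.
split.
  have := utrig_cos h (0 : R).
  by under [X in utrig X]eq_fun do rewrite addr0.
have := utrig_cos h (- (pi / 2) : R).
by under [X in utrig X]eq_fun do rewrite cosBpihalf.
Qed.

Lemma ctrig_meval (r : nat) (H : 'I_r -> 'I_n -> int) (P : mpoly r R[i]) :
  ctrig (fun x => meval (fun i => cexpi (dot (H i) x)) P).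
Proof.
under eq_fun do rewrite mevalE; apply: ctrig_sum => m.
apply: ctrigM; first exact: ctrig_cst.
apply: ctrig_prod => i; apply: ctrig_exp; exact: ctrig_cexpi.
Qed.

Lemma ctrig_sqrnorm g : ctrig g ->
  utrig (fun x => complex.Re (g x) ^+ 2 + complex.Im (g x) ^+ 2).
Proof.
by move=> [a b]; under eq_fun do rewrite !expr2;
  apply: (ua_add U); exact: (ua_mul U).
Qed.

Lemma trig_continuous (Phi : ('I_n -> R) -> R) : utrig Phi ->
  continuous (fun v : 'rV[R]_n => Phi (v ord0)).
Proof.
move=> uPhi v; apply/(@cvgrPdist_le _ _ _ _ (@nbhs_filter 'rV[R]_n v)) => eps eps0.
have e3 : 0 < eps / 3 by rewrite divr_gt0.
have [p [s ->] Php] := uPhi _ e3.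
have sumc (I : Type) (r : seq I) (F : I -> 'rV[R]_n -> R) :
    (forall i, continuous (F i)) -> continuous (fun v => \sum_(i <- r) F i v).
  move=> cF; elim: r => [|i r IH] w.
    rewrite (_ : (fun v => _) = fun=> 0); first exact: cst_continuous.
    by apply/funext => v'; rewrite big_nil.
  rewrite (_ : (fun v => _) = fun v => F i v + \sum_(j <- r) F j v); last first.
    by apply/funext => v'; rewrite big_cons.
  by apply: continuousD; [exact: cF|exact: IH].
have cs : continuous (fun v : 'rV[R]_n => trigpoly s (v ord0)).
  apply: (sumc) => q w; rewrite /cosmono.
  apply: (@continuousM _ 'rV[R]_n); first exact: cst_continuous.
  apply: (@continuous_comp 'rV[R]_n _ _ _ (@cos R)); last exact: continuous_cos.
  apply: continuousD; last exact: cst_continuous.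
  apply: (sumc) => k {}w; apply: (@continuousM _ 'rV[R]_n).
    exact: cst_continuous.
  exact: coord_continuous.
move/(@cvgrPdist_le _ _ _ _ (@nbhs_filter 'rV[R]_n v)) : (cs v) => /(_ _ e3) H.
have := @nbhs_filter 'rV[R]_n v => FF; near=> w.
have Hw : `|trigpoly s (v ord0) - trigpoly s (w ord0)| <= eps / 3 by near: w.
have P1 := Php (v ord0); have := Php (w ord0); rewrite distrC => P2.
rewrite (_ : Phi (v ord0) - Phi (w ord0) = (Phi (v ord0) - trigpoly s (v ord0))
  + (trigpoly s (v ord0) - trigpoly s (w ord0))
  + (trigpoly s (w ord0) - Phi (w ord0))); last by ring.
rewrite (_ : eps = eps / 3 + eps / 3 + eps / 3); last by field.
apply: le_trans (ler_normD _ _) _; apply: lerD => //.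
by apply: le_trans (ler_normD _ _) _; apply: lerD.
Unshelve. all: by end_near. Qed.

End RationalFunctionsOnTorus.

Section Denominator.
Context {R : realType}.

Definition sqn (z : R[i]) : R := complex.Re z ^+ 2 + complex.Im z ^+ 2.

Lemma sqn_eq0 z : (sqn z == 0) = (z == 0).
Proof. by case: z => a b; rewrite /sqn/= paddr_eq0 ?sqr_ge0// !sqrf_eq0 eq_complex. Qed.

Lemma sqn_ge0 z : 0 <= sqn z.
Proof. by rewrite addr_ge0 ?sqr_ge0. Qed.

(** By compactness of the box $[0, 2\pi]^r$ of angles, which covers the torus. *)
Lemma torus_lower_bound (r : nat) (Q : mpoly r R[i]) :
  (forall z, torus z -> meval z Q != 0) ->
  exists2 a : R, 0 < a & forall z, torus z -> a <= sqn (meval z Q).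
Proof.
move=> Q0.
pose H (i k : 'I_r) : int := (i == k)%:Z.
have HE i (x : 'I_r -> R) : dot (H i) x = x i.
  rewrite /dot (bigD1 i)//= /H eqxx mul1r big1 ?addr0// => k ki.
  by rewrite eq_sym (negbTE ki) mul0r.
pose g (x : 'I_r -> R) := sqn (meval (fun i => cexpi (dot (H i) x)) Q).
have ug : utrig g by exact: (ctrig_sqrnorm (ctrig_meval H Q)).
have g0 x : 0 < g x.
  rewrite lt_neqAle sqn_ge0 eq_sym sqn_eq0 andbT.
  by apply: Q0 => i; exact: norm_cexpi.
have cg := trig_continuous ug.
pose box := [set v : 'rV[R]_r | forall i, `[0, (pi *+ 2 : R)]%classic (v ord0 i)].
have cbox : compact box.
  by apply: (@rV_compact _ _ (fun=> `[0, (pi *+ 2 : R)]%classic)) => i; exact: segment_compact.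
have cginv : continuous (fun v : 'rV[R]_r => (g (v ord0))^-1).
  move=> v; apply: (@continuous_comp 'rV[R]_r _ _ (fun v => g (v ord0)) (@GRing.inv R)).
    exact: cg.
  by apply: inv_continuous; rewrite gt_eqF.
have /compact_bounded [M [_ HM]] : compact ((fun v : 'rV[R]_r => (g (v ord0))^-1) @` box).
  by apply: continuous_compact => //; exact: continuous_subspaceT.
have M1 : M < `|M| + 1 by rewrite ltr_pwDr// ler_norm.
have {}HM v : box v -> (g (v ord0))^-1 <= `|M| + 1.
  by move=> bv; rewrite (le_trans (ler_norm _))//; apply: (HM _ M1); exists v.
have M0 : 0 < `|M| + 1 by rewrite ltr_wpDl.
exists (`|M| + 1)^-1; first by rewrite invr_gt0.
move=> z tz.
pose v : 'rV[R]_r := \row_i angle (z i).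
have bv : box v.
  move=> i; rewrite /= in_itv/= mxE.
  by have [_ /andP[-> /ltW]] := angle_circle (tz i).
have -> : meval z Q = meval (fun i => cexpi (dot (H i) (v ord0))) Q.
  apply: meval_eq => i; rewrite HE mxE.
  by have [-> _] := angle_circle (tz i).
by rewrite -[leRHS]invrK lef_pV2 ?posrE ?invr_gt0 ?g0//; exact: HM.
Qed.

(** $\Re(p/q) = \Re(p \bar q)/|q|^2$, where $|q|^2$ is bounded away from 0,
    so that its inverse is again a uniform limit of trigonometric polynomials. *)
Lemma ratfun_real_utrig (r n : nat) (f : @ratfun R r) (H : 'I_r -> 'I_n -> int) :
  no_pole_on_torus f ->
  utrig (fun x => ratfun_real f (fun i => cexpi (dot (H i) x))).
Proof.
move=> [P [Q [fE Q0]]]; have [a a0 aQ] := torus_lower_bound Q0.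
have tor (x : 'I_n -> R) : torus (fun i => cexpi (dot (H i) x)).
  by move=> i; exact: norm_cexpi.
pose p x := meval (fun i => cexpi (dot (H i) x)) P.
pose q x := meval (fun i => cexpi (dot (H i) x)) Q.
have [up1 up2] : ctrig p by exact: ctrig_meval.
have cq : ctrig q by exact: ctrig_meval.
have uq := ctrig_sqrnorm cq; case: cq => uq1 uq2.
have U := @utrig_algebra R n.
rewrite (_ : (fun x => _) = fun x =>
   (complex.Re (p x) * complex.Re (q x) + complex.Im (p x) * complex.Im (q x))
   * (complex.Re (q x) ^+ 2 + complex.Im (q x) ^+ 2)^-1).
  apply: (ua_mul U).
    by apply: (ua_add U); exact: (ua_mul U).
  by apply: (ua_inv U a0) => // x; exact: aQ.
apply/funext => x; rewrite /ratfun_real (ratfun_evalE fE (Q0 _ (tor x))).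
rewrite -/(p x) -/(q x); case: (p x) (q x) => [p1 p2] [q1 q2].
transitivity (p1 * (q1 / (q1 ^+ 2 + q2 ^+ 2)) - p2 * - (q2 / (q1 ^+ 2 + q2 ^+ 2))).
  by [].
by rewrite mulrN opprK mulrDl !mulrA.
Qed.

End Denominator.

(** * The integer parametrization of the frequencies *)

Section Parametrization.
Context {R : realType} (r m : nat) (theta : 'I_r -> R)
  (e : 'I_m -> 'I_r) (b : 'I_m -> 'I_r -> rat).
Hypothesis thetaP : Qbasis_coords theta e b.

Lemma common_denom_gt0 : (0 < common_denom e b)%N.
Proof.
rewrite /common_denom; elim/big_ind: _ => // [p q p0 q0|k _].
  by rewrite lcmn_gt0 p0.
elim/big_ind: _ => // [p q p0 q0|j _]; first by rewrite lcmn_gt0 p0.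
by rewrite absz_gt0 denq_neq0.
Qed.

Lemma denq_common_denom k j : j \notin codom e ->
  (`|denq (b k j)|%N %| common_denom e b)%N.
Proof.
move=> je; apply: dvdn_trans (biglcmn_sup k _ (dvdnn _)) => //.
exact: (biglcmn_sup j).
Qed.

Lemma hcoefE k j : j \notin codom e ->
  (hcoef e b k j)%:~R = (common_denom e b)%:R * b k j.
Proof.
move=> je; rewrite /hcoef; apply: numqK.
have /dvdnP[q ->] := denq_common_denom k je.
rewrite natrM -mulrA (_ : `|denq (b k j)|%N%:R * b k j = (numq (b k j))%:~R).
  by rewrite rpredM ?intr_int// natr_int.
by rewrite numqE mulrC -absz_denq.
Qed.

(** With $d$ the common denominator, $e^{i\theta_i t}$ is the monomial with these
    exponents in the variables $e^{i (\theta_{e(k)}/d) t}$, exactly as the [i]-th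
    coordinate of [Ztheta] is in the variables $Z_k$. *)
Definition Zexponents (i : 'I_r) (k : 'I_m) : int :=
  if [pick k' | e k' == i] is Some k' then
    if k == k' then (common_denom e b)%:Z else 0
  else hcoef e b k i.

Lemma Ztheta_cexpi (x : 'I_m -> R) i :
  Ztheta e b (fun k => cexpi (x k)) i = cexpi (dot (Zexponents i) x).
Proof.
rewrite /Ztheta /Zexponents /dot; case: pickP => [k _|_].
  rewrite (bigD1 k)//= eqxx big1 ?addr0; first by rewrite -cexpiMn.
  by move=> k' /negbTE ->; rewrite mul0r.
by rewrite cexpi_sum; apply: eq_bigr => k _; rewrite cexpiMz.
Qed.

Definition base_freqs (k : 'I_m) : R := theta (e k) / (common_denom e b)%:R.

Let dneq0 : (common_denom e b)%:R != 0 :> R.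
Proof. by rewrite pnatr_eq0 -lt0n common_denom_gt0. Qed.

Lemma base_freqs_Qindependent : Qindependent base_freqs.
Proof.
case: thetaP => ind _ c c0; apply: ind.
apply: (mulIf (invr_neq0 dneq0)); rewrite mul0r -[RHS]c0 mulr_suml.
by apply: eq_bigr => k _; rewrite mulrA.
Qed.

Lemma dot_Zexponents i : dot (Zexponents i) base_freqs = theta i.
Proof.
rewrite /dot /Zexponents /base_freqs; case: pickP => [k /eqP <-|enone].
  rewrite (bigD1 k)//= eqxx big1 ?addr0; first by rewrite mulrC divfK.
  by move=> k' /negbTE ->; rewrite mul0r.
have ie : i \notin codom e.
  by apply/negP => /codomP[k ik]; have := enone k; rewrite ik eqxx.
have [_ /(_ _ ie) ->] := thetaP; apply: eq_bigr => k _.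
rewrite mulrCA mulrA -(ratr_int R) hcoefE// rmorphM/= ratr_nat.
by rewrite mulrC mulrA mulrAC mulKf// mulrC.
Qed.

End Parametrization.

(** * From the gap to ordering densities *)

Section Gap.
Context {R : realType} {D : nat}.
Implicit Types x y : 'I_D -> R.

(** One number whose sign decides the ordering; the cap at 1 gives it a value for
    tuples of length at most 1 and keeps it bounded above. *)
Definition gap x : R :=
  \big[Num.min/1]_(p : 'I_D * 'I_D | p.2 == p.1.+1 :> nat) (x p.1 - x p.2).

Lemma decreasing_vec_gap x : decreasing_vec x <-> 0 < gap x.
Proof.
split=> [dx|/bigmin_gtP[_ gx] i j ij].
  apply/bigmin_gtP; split=> // -[i j] /= /eqP ij.
  by rewrite subr_gt0; exact: dx.
by have := gx (i, j); rewrite /= ij eqxx subr_gt0; exact.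
Qed.

Lemma nonincreasing_vec_gap x : nonincreasing_vec x <-> 0 <= gap x.
Proof.
split=> [dx|/bigmin_geP[_ gx] i j ij].
  apply/bigmin_geP; split=> // -[i j] /= /eqP ij.
  by rewrite subr_ge0; exact: dx.
by have := gx (i, j); rewrite /= ij eqxx subr_ge0; exact.
Qed.

Lemma gap_eq0 x : gap x = 0 -> exists j j' : 'I_D, j' = j.+1 :> nat /\ x j = x j'.
Proof.
move=> g0; have [h|h] := pselect (exists j j' : 'I_D, j' = j.+1 :> nat /\ x j = x j') => //.
have : 0 < gap x.
  apply/decreasing_vec_gap => i j ij; rewrite lt_neqAle.
  apply/andP; split.
    by apply/eqP => xij; apply: h; exists i, j.
  by apply: (proj2 (nonincreasing_vec_gap x)) => //; rewrite g0.
by rewrite g0 ltxx.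
Qed.

Lemma min_dist (a b c e eta : R) : `|a - c| <= eta -> `|b - e| <= eta ->
  `|Num.min a b - Num.min c e| <= eta.
Proof.
rewrite !ler_norml => /andP[h1 h2] /andP[h3 h4].
by rewrite /Num.min; case: ltP => ?; case: ltP => ?; apply/andP; split; lra.
Qed.

Lemma gap_dist x y (eta : R) : 0 <= eta -> (forall j, `|x j - y j| <= eta) ->
  `|gap x - gap y| <= eta *+ 2.
Proof.
move=> eta0 xy; rewrite /gap.
apply: (big_ind2 (fun a b : R => `|a - b| <= eta *+ 2)) => [|a c b e|p _].
- by rewrite subrr normr0 mulrn_wge0.
- exact: min_dist.
rewrite opprD addrACA mulr2n (le_trans (ler_normD _ _))// lerD//.
by rewrite -opprD normrN.
Qed.

End Gap.

Section Ramps.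
Context {R : realType}.

Definition clamp01 (y : R) : R := Num.max 0 (Num.min 1 y).

Lemma clamp01_ge0 y : 0 <= clamp01 y.
Proof. by rewrite le_max lexx. Qed.

Lemma clamp01_le1 y : clamp01 y <= 1.
Proof. by rewrite ge_max ler01 ge_min lexx. Qed.

Lemma clamp01_norm y : `|clamp01 y| <= 1.
Proof. by rewrite ger0_norm ?clamp01_ge0// clamp01_le1. Qed.

Lemma clamp01_eq0 y : y <= 0 -> clamp01 y = 0.
Proof. by move=> y0; rewrite /clamp01 max_l// ge_min y0 orbT. Qed.

Lemma clamp01_eq1 y : 1 <= y -> clamp01 y = 1.
Proof. by move=> y1; rewrite /clamp01 min_l// max_r. Qed.

Lemma clamp01_lip x y : `|clamp01 x - clamp01 y| <= `|x - y|.
Proof.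
wlog xy : x y / x <= y => [hw|].
  by have [xy|/ltW yx] := leP x y; [exact: hw|rewrite distrC (distrC x); exact: hw].
rewrite distrC (distrC x) (ger0_norm (_ : 0 <= y - x)) ?subr_ge0//.
have clampE z : [\/ z <= 0 /\ clamp01 z = 0, 1 <= z /\ clamp01 z = 1
    | 0 <= z /\ z <= 1 /\ clamp01 z = z].
  have [z0|/ltW z0] := leP z 0; first by constructor 1; rewrite clamp01_eq0.
  have [z1|/ltW z1] := leP 1 z; first by constructor 2; rewrite clamp01_eq1.
  by constructor 3; rewrite /clamp01 min_r// max_r.
by rewrite ler_norml; apply/andP; split;
  case: (clampE x) => [[? ->]|[? ->]|[? [? ->]]];
  case: (clampE y) => [[? ->]|[? ->]|[? [? ->]]]; lra.
Qed.

Lemma measurable_clamp01 : measurable_fun setT clamp01.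
Proof.
apply: continuous_measurable_fun => x; apply/cvgrPdist_le => e e0.
near=> y; apply: le_trans (clamp01_lip _ _) _; near: y.
apply: (@cvgr_dist_le _ _ _ _ _ id x) => //; exact: cvg_id.
Unshelve. all: by end_near. Qed.

End Ramps.

Section MeasurableComposites.
Context {R : realType} d (T : measurableType d) (A : set T).

Lemma measurable_gap (D : nat) (G : 'I_D -> T -> R) :
  (forall j, measurable_fun A (G j)) -> measurable_fun A (fun t => gap (G^~ t)).
Proof.
move=> mG; rewrite /gap; elim: (index_enum _) => [|p s IH].
  rewrite (_ : (fun t => _) = fun=> 1); first exact: measurable_cst.
  by apply/funext => t; rewrite big_nil.
case: (boolP (p.2 == p.1.+1 :> nat)) => [pp|/negbTE pp]; last first.
  rewrite (_ : (fun t => _) = fun t => \big[Num.min/1]_(p <- s | p.2 == p.1.+1 :> nat)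
    (G p.1 t - G p.2 t))//.
  by apply/funext => t; rewrite big_cons pp.
rewrite (_ : (fun t => _) = fun t => Num.min (G p.1 t - G p.2 t)
    (\big[Num.min/1]_(p <- s | p.2 == p.1.+1 :> nat) (G p.1 t - G p.2 t))).
  by apply: measurable_minr => //; exact: measurable_funB.
by apply/funext => t; rewrite big_cons pp.
Qed.

Lemma measurable_ramp (g : T -> R) (a b : R) : measurable_fun A g ->
  measurable_fun A (fun t => clamp01 (a * g t + b)).
Proof.
move=> mg; apply: (measurableT_comp measurable_clamp01).
by apply: measurable_funD => //; exact: measurable_funM.
Qed.

Lemma measurable_pos_indicator (g : T -> R) : measurable A -> measurable_fun A g ->
  measurable_fun A (fun t => ((0 < g t)%R)%:R : R).
Proof.
move=> mA mg.
rewrite (_ : (fun t => _) = fun t => if 0 < g t then 1 else 0); last first.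
  by apply/funext => t; case: (_ < _).
by apply: measurable_fun_if => //; exact: measurable_fun_ltr.
Qed.

End MeasurableComposites.

Section EventualComparison.
Context {R : realType}.
Notation cmu := (@completed_lebesgue_measure R).

(** Changing a bounded amount on a bounded range of times does not affect time
    averages in the limit. *)
Lemma time_avg_eventual_le (f g : R -> R) (T eps : R) : 0 < eps ->
  loc_integrable f -> loc_integrable g ->
  (forall t, 0 <= t -> f t <= g t + 1) -> (forall t, T <= t -> f t <= g t) ->
  \forall X \near +oo, time_avg f X <= time_avg g X + eps.
Proof.
move=> eps0 lf lg fg1 fg.
pose T' : R := `|T|; pose h (t : R) : R := \1_(`[0, T'] : set R) t.
have mh : measurable (`[0, T'] : set (lebesgueType R)) by exact: lebesgue_measurable_itv.
have lh : loc_integrable h.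
  apply: (@loc_integrable_bounded _ _ 1) => [X|t].
    apply: (@measurable_funTS _ _ (lebesgueType R)); exact: measurable_indic.
  by rewrite /h indicE; case: (_ \in _); rewrite ?normr1 ?normr0.
near=> X.
have X0 : 0 < X by near: X; exact: nbhs_pinfty_gt.
apply: (@le_trans _ _ (time_avg g X + time_avg h X)).
  rewrite -time_avgD//; apply: le_time_avg => //; first exact: loc_integrableD.
  move=> t t0; rewrite /h indicE; case: (boolP (_ \in _)) => [_|]; first exact: fg1.
  rewrite notin_setE/= in_itv/= t0/= => /negP; rewrite -ltNge => Tt.
  by rewrite /= mulr0n addr0 fg// (le_trans (ler_norm T))// ltW.
rewrite lerD2l /time_avg /h.
rewrite -[X in _ * X]/(fine (\int[cmu]_(y in `[0, X]) (\1_(`[0, T'] : set R) y)%:E)).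
rewrite integral_indic//; last exact: lebesgue_measurable_itv.
rewrite mulrC ler_pdivrMr//.
apply: (@le_trans _ _ T'); last first.
  by rewrite mulrC -ler_pdivrMr//; near: X; apply: nbhs_pinfty_ge; exact: num_real.
have T0 : 0 <= T' by rewrite normr_ge0.
have cT : cmu `[0, T'] = T'%:E := completed_lebesgue_itv T0.
have cI : (cmu (`[0%R, T']%classic `&` `[0%R, X]%classic) <= T'%:E)%E.
  by rewrite -cT; apply: le_measure; rewrite ?inE//; apply: measurableI => //;
    exact: lebesgue_measurable_itv.
rewrite -lee_fin fineK//.
by rewrite ge0_fin_numE ?measure_ge0// (le_lt_trans cI)// ltry.
Unshelve. all: by end_near. Qed.

(** These two bounds turn inequalities up to [eps] for large times into
    inequalities between limits inferior or superior. *)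
Lemma limf_einf_ge (f : R -> \bar R) (l : R) :
  (forall eps : R, 0 < eps -> \forall X \near +oo, ((l - eps)%:E <= f X)%E) ->
  (l%:E <= limf_einf f (pinfty_nbhs R))%E.
Proof.
move=> fl; apply/lee_addgt0Pr => eps eps0.
rewrite -leeBlDr// limf_einfE; apply: le_ereal_sup_tmp.
exists (ereal_inf [set f x | x in [set X | ((l - eps)%:E <= f X)%E]]).
  by exists [set X | ((l - eps)%:E <= f X)%E] => //; exact: fl.
by apply: le_ereal_inf_tmp => _ [X /= fX <-]; rewrite -EFinB.
Qed.

Lemma limf_esup_le (f : R -> \bar R) (l : R) :
  (forall eps : R, 0 < eps -> \forall X \near +oo, (f X <= (l + eps)%:E)%E) ->
  (limf_esup f (pinfty_nbhs R) <= l%:E)%E.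
Proof.
move=> fl; apply/lee_addgt0Pr => eps eps0.
rewrite limf_esupE; apply: (@le_trans _ _
    (ereal_sup [set f x | x in [set X | (f X <= (l + eps)%:E)%E]])).
  apply: ereal_inf_lbound.
  by exists [set X | (f X <= (l + eps)%:E)%E] => //; exact: fl.
by apply: ge_ereal_sup => _ [X /= fX <-]; rewrite -EFinD.
Qed.

Lemma limf_einf_le_esup (f : R -> \bar R) :
  (limf_einf f (pinfty_nbhs R) <= limf_esup f (pinfty_nbhs R))%E.
Proof.
rewrite limf_einfE limf_esupE; apply: ge_ereal_sup => _ [V FV <-].
apply: le_ereal_inf_tmp => _ [W FW <-].
have [x [Vx Wx]] : (V `&` W) !=set0 by exact: (filter_ex (filterI FV FW)).
apply: (@le_trans _ _ (f x)).
  by apply: ereal_inf_lbound; exists x.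
by apply: ereal_sup_ubound; exists x.
Qed.

End EventualComparison.

Section Portmanteau.
Context {R : realType} d (Omega : measurableType d) (P : probability Omega R).
Context {D : nat} (F G : 'I_D -> R -> R) (gam : Omega -> R).
Hypothesis mG : forall j, lebesgue_measurable (G j).
Hypothesis GF : equal_up_to_o1 G F.
Hypothesis mF : forall X,
  measurable_fun (`[0, X] : set (lebesgueType R)) (fun t => gap (F^~ t)).
Hypothesis mgam : measurable_fun setT gam.
Hypothesis ramps : forall a b : R,
  time_avg (fun t => clamp01 (a * gap (F^~ t) + b)) X @[X --> +oo]
    --> \int[P]_w clamp01 (a * gam w + b).

Let ind (t : R) : R := \1_(@decreasing_vec R D) (G^~ t).

Let indE t : ind t = ((0 < gap (G^~ t))%R)%:R.
Proof.
rewrite /ind indicE; congr (_%:R); congr nat_of_bool; apply/idP/idP.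
  by rewrite inE => /decreasing_vec_gap.
by move=> ?; rewrite inE; apply/decreasing_vec_gap.
Qed.

Let measurable_gapG X :
  measurable_fun (`[0, X] : set (lebesgueType R)) (fun t => gap (G^~ t)).
Proof.
have mGX j : measurable_fun (`[0, X] : set (lebesgueType R)) (G j).
  apply: measurable_funS (mG j).
    exact: (borel_lebesgue_measurable (measurable_itv `[0, +oo[)).
  by move=> t; rewrite /= !in_itv/= andbT => /andP[].
exact: measurable_gap.
Qed.

Let lind : loc_integrable ind.
Proof.
apply: (@loc_integrable_bounded _ _ 1) => [X|t]; last first.
  by rewrite indE; case: (_ < _); rewrite ?normr1 ?normr0.
rewrite (funext indE).
exact: (measurable_pos_indicator (lebesgue_measurable_itv 0 X) (@measurable_gapG X)).
Qed.

Let freqE X : ordering_freq G X = (time_avg ind X)%:E.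
Proof. by rewrite -average_time_avg. Qed.

Let lramp a b : loc_integrable (fun t => clamp01 (a * gap (F^~ t) + b)).
Proof.
apply: (@loc_integrable_bounded _ _ 1) => [X|t]; last exact: clamp01_norm.
exact: (measurable_ramp a b (@mF X)).
Qed.

Let iramp a b : P.-integrable setT (EFin \o (fun w => clamp01 (a * gam w + b))).
Proof.
apply: (@prob_integrable _ _ _ _ _ 1) => [|t]; last exact: clamp01_norm.
exact: (measurable_ramp a b mgam).
Qed.

Let gap_close (eta : R) : 0 < eta ->
  exists T : R, forall t, T <= t -> `|gap (G^~ t) - gap (F^~ t)| <= eta.
Proof.
move=> eta0; have e2 : 0 < eta / 2 by rewrite divr_gt0.
have : \forall t \near +oo, forall j, `|G j t - F j t| <= eta / 2.
  apply: filter_forall => j.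
  have /cvgr0Pnorm_le/(_ _ e2) := GF j; exact.
move=> [T [_ HT]]; exists (T + 1) => t Tt.
rewrite [eta](_ : _ = (eta / 2) *+ 2); last by rewrite -mulr_natr divfK.
apply: gap_dist => [|j]; first exact: ltW.
by apply: HT; rewrite (lt_le_trans _ Tt)// ltrDl.
Qed.

Let mgt (c : R) : measurable [set w | c < gam w].
Proof.
have := mgam measurableT (measurable_itv `]c, +oo[); rewrite setTI.
congr measurable.
by apply/seteqP; split => w /=; rewrite in_itv/= andbT.
Qed.

Let mge (c : R) : measurable [set w | c <= gam w].
Proof.
have := mgam measurableT (measurable_itv `[c, +oo[); rewrite setTI.
congr measurable.
by apply/seteqP; split => w /=; rewrite in_itv/= andbT.
Qed.

Let Pfin A : measurable A -> (fine (P A))%:E = P A.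
Proof. by move=> mA; rewrite fineK// fin_num_measure. Qed.

Let Pcvg (B : nat -> set Omega) (A : set Omega) (eps : R) : 0 < eps ->
  (forall n, measurable (B n)) -> measurable A -> P \o B @ \oo --> P A ->
  exists n, `|fine (P A) - fine (P (B n))| <= eps.
Proof.
move=> eps0 mB mA; rewrite -Pfin// => /fine_cvgP[_ /cvgrPdist_le/(_ _ eps0)].
by move=> [n _ Hn]; exists n; exact: (Hn n (leqnn n)).
Qed.

Let PgtE : exists2 A : nat -> set Omega, (forall n, measurable (A n)) &
  (forall n w, A n w <-> 2 / n.+1%:R <= gam w) /\
  P \o A @ \oo --> P [set w | 0 < gam w].
Proof.
exists (fun n => [set w | 2 / n.+1%:R <= gam w]) => //; split => //.
rewrite (_ : [set w | 0 < gam w] = \bigcup_n [set w | 2 / n.+1%:R <= gam w]).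
  apply: nondecreasing_cvg_mu => //; first exact: bigcupT_measurable.
  move=> n k nk; apply/subsetPset => w /=; apply: le_trans.
  by rewrite ler_pM2l// lef_pV2 ?posrE// ler_nat.
apply/seteqP; split => w /=.
  move=> w0; have [n hn] := archi_inv (divr_gt0 w0 (ltr0n R 2)).
  exists n => //=; rewrite ler_pdivrMr// mulrC; lra.
by move=> [n _]; apply: lt_le_trans; rewrite divr_gt0.
Qed.

Let PgeE : exists2 A : nat -> set Omega, (forall n, measurable (A n)) &
  (forall n w, A n w <-> - (2 / n.+1%:R) < gam w) /\
  P \o A @ \oo --> P [set w | 0 <= gam w].
Proof.
exists (fun n => [set w | - (2 / n.+1%:R) < gam w]) => //; split => //.
rewrite (_ : [set w | 0 <= gam w] = \bigcap_n [set w | - (2 / n.+1%:R) < gam w]).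
  apply: nonincreasing_cvg_mu => //.
  - by rewrite (le_lt_trans (probability_le1 _ _))// ltry.
  - exact: bigcapT_measurable.
  - move=> n k nk; apply/subsetPset => w /=; apply: le_lt_trans.
    by rewrite lerN2 ler_pM2l// lef_pV2 ?posrE// ler_nat.
apply/seteqP; split => w /=.
  by move=> w0 n _ /=; rewrite (lt_le_trans _ w0)// oppr_lt0 divr_gt0.
move=> hw; rewrite leNgt; apply/negP => w0.
have w0' : 0 < - gam w / 2 by rewrite divr_gt0// oppr_gt0.
have [n hn] := archi_inv w0'; have := hw n I => /=.
by apply/negP; rewrite -leNgt lerNr ler_pdivrMr// mulrC; lra.
Qed.

Let freq_ge (eps : R) : 0 < eps ->
  \forall X \near +oo, fine (P [set w | (0 < gam w)]) - eps <= time_avg ind X.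
Proof.
move=> eps0; have e3 : 0 < eps / 3 by rewrite divr_gt0.
have [A mA [AE PA]] := PgtE.
have [n] := Pcvg e3 mA (mgt 0) PA; rewrite ler_norml => /andP[_ hn].
set k : R := n.+1%:R in AE; have k0 : 0 < k by rewrite ltr0n.
have [T HT] := gap_close (divr_gt0 ltr01 k0).
have EP : fine (P (A n)) <= \int[P]_w clamp01 (k * gam w + -1).
  have -> : fine (P (A n)) = \int[P]_w \1_(A n) w.
    by rewrite /Rintegral integral_indic// setIT.
  apply: le_Rintegral => // [|w _].
    apply: (@prob_integrable _ _ _ _ _ 1) => [|w]; first exact: measurable_indic.
    by rewrite indicE; case: (_ \in _); rewrite ?normr1 ?normr0.
  rewrite indicE; case: (boolP (_ \in _)) => [|_]; last exact: clamp01_ge0.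
  rewrite inE => /AE; rewrite -/k ler_pdivrMr// mulrC => h.
  by rewrite clamp01_eq1//; lra.
have cmpT t : T <= t -> clamp01 (k * gap (F^~ t) + -1) <= ind t.
  move=> Tt; rewrite indE; have [g0|g0] := ltP 0 (gap (G^~ t)).
    exact: clamp01_le1.
  rewrite clamp01_eq0//; have := HT _ Tt.
  rewrite distrC => /(le_trans (ler_norm _)); rewrite lerBlDr => h.
  have : k * gap (F^~ t) <= k * (1 / k).
    by rewrite ler_pM2l// (le_trans h)// gerDl.
  by rewrite mulrCA mulfV ?gt_eqF//; lra.
have cmp0 t : 0 <= t -> clamp01 (k * gap (F^~ t) + -1) <= ind t + 1.
  move=> _; rewrite (le_trans (clamp01_le1 _))// lerDr indE; by case: (_ < _).
have near1 := time_avg_eventual_le e3 (@lramp k (-1)) lind cmp0 cmpT.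
have /cvgrPdist_le/(_ _ e3) near2 := @ramps k (-1).
near=> X.
have h1 : time_avg (fun t => clamp01 (k * gap (F^~ t) + -1)) X
    <= time_avg ind X + eps / 3 by near: X.
have : `|\int[P]_w clamp01 (k * gam w + -1)
    - time_avg (fun t => clamp01 (k * gap (F^~ t) + -1)) X| <= eps / 3 by near: X.
rewrite ler_norml => /andP[_ h2]; lra.
Unshelve. all: by end_near. Qed.

Let freq_le (eps : R) : 0 < eps ->
  \forall X \near +oo, time_avg ind X <= fine (P [set w | (0 <= gam w)]) + eps.
Proof.
move=> eps0; have e3 : 0 < eps / 3 by rewrite divr_gt0.
have [A mA [AE PA]] := PgeE.
have [n] := Pcvg e3 mA (mge 0) PA; rewrite ler_norml => /andP[hn _].
set k : R := n.+1%:R in AE; have k0 : 0 < k by rewrite ltr0n.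
have [T HT] := gap_close (divr_gt0 ltr01 k0).
have EP : \int[P]_w clamp01 (k * gam w + 2) <= fine (P (A n)).
  have -> : fine (P (A n)) = \int[P]_w \1_(A n) w.
    by rewrite /Rintegral integral_indic// setIT.
  apply: le_Rintegral => // [|w _].
    apply: (@prob_integrable _ _ _ _ _ 1) => [|w]; first exact: measurable_indic.
    by rewrite indicE; case: (_ \in _); rewrite ?normr1 ?normr0.
  rewrite indicE; case: (boolP (_ \in _)) => [_|]; first exact: clamp01_le1.
  rewrite notin_setE => /AE /negP; rewrite -leNgt -/k lerNr ler_pdivrMr// mulrC => h.
  by rewrite clamp01_eq0//; lra.
have cmpT t : T <= t -> ind t <= clamp01 (k * gap (F^~ t) + 2).
  move=> Tt; rewrite indE; have [g0|g0] := ltP 0 (gap (G^~ t)); last exact: clamp01_ge0.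
  rewrite clamp01_eq1//; have := HT _ Tt.
  move=> /(le_trans (ler_norm _)); rewrite lerBlDr => h.
  have : k * (- (1 / k)) <= k * gap (F^~ t).
    by rewrite ler_pM2l// -subr_ge0 opprK addrC (le_trans (ltW g0)).
  by rewrite mulrN mulrCA mulfV ?gt_eqF//; lra.
have cmp0 t : 0 <= t -> ind t <= clamp01 (k * gap (F^~ t) + 2) + 1.
  move=> _; rewrite indE (@le_trans _ _ 1) ?lerDr ?clamp01_ge0//; by case: (_ < _).
have near1 := time_avg_eventual_le e3 lind (@lramp k 2) cmp0 cmpT.
have /cvgrPdist_le/(_ _ e3) near2 := @ramps k 2.
near=> X.
have h1 : time_avg ind X <=
    time_avg (fun t => clamp01 (k * gap (F^~ t) + 2)) X + eps / 3 by near: X.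
have : `|\int[P]_w clamp01 (k * gam w + 2)
    - time_avg (fun t => clamp01 (k * gap (F^~ t) + 2)) X| <= eps / 3 by near: X.
rewrite ler_norml => /andP[h2 _]; lra.
Unshelve. all: by end_near. Qed.

(** Portmanteau argument: the indicator of a positive gap of [G] lies, for large
    times, between the ramps $\mathrm{clamp}(k g - 1)$ and
    $\mathrm{clamp}(k g + 2)$ of the gap [g] of [F], whose expectations tend to
    the probabilities of a positive and of a nonnegative gap as $k$ grows. *)
Lemma ordering_densities :
  [/\ (P [set w | (0 < gam w)%R] <= lower_density G)%E,
      (lower_density G <= upper_density G)%E,
      (upper_density G <= P [set w | (0 <= gam w)%R])%E
    & P [set w | gam w = 0] = 0%E ->
      has_density G (P [set w | (0 < gam w)%R])].
Proof.
split.
- rewrite -Pfin//; apply: limf_einf_ge => eps eps0.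
  by near=> X; rewrite freqE lee_fin; near: X; exact: freq_ge.
- exact: limf_einf_le_esup.
- rewrite -[leRHS]Pfin//; apply: limf_esup_le => eps eps0.
  by near=> X; rewrite freqE lee_fin; near: X; exact: freq_le.
move=> P0; rewrite /has_density -Pfin//.
have Pge : P [set w | 0 <= gam w] = P [set w | 0 < gam w].
  rewrite (_ : [set w | 0 <= gam w] = [set w | 0 < gam w] `|` [set w | gam w = 0]).
    rewrite measureU0//.
    rewrite (_ : [set w | gam w = 0] = [set w | 0 <= gam w] `\` [set w | 0 < gam w]).
      exact: measurableD.
    apply/seteqP; split => w /=; first by move=> ->; rewrite lexx ltxx.
    by move=> [w0 /negP]; rewrite -leNgt => w0'; apply/eqP; rewrite eq_le w0'.
  apply/seteqP; split => w /=.
    by rewrite le_eqVlt => /predU1P[<-|]; [right|left].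
  by move=> [/ltW//|->].
rewrite (_ : ordering_freq G = fun X => (time_avg ind X)%:E); last first.
  by apply/funext => X; exact: freqE.
apply: cvg_EFin; first by near=> X.
apply/cvgrPdist_le => eps eps0; near=> X.
have h1 : fine (P [set w | 0 < gam w]) - eps <= time_avg ind X.
  by near: X; exact: freq_ge.
have h2 : time_avg ind X <= fine (P [set w | 0 <= gam w]) + eps.
  by near: X; exact: freq_le.
by rewrite Pge in h2; rewrite /= ler_norml; apply/andP; split; lra.
Unshelve. all: by end_near. Qed.

End Portmanteau.

(** * Integer functionals separating frequencies *)

Section IntegerFunctional.
Context {R : realType} (r : nat) (theta : 'I_r -> R).
Local Open Scope ring_scope.

Let rel (u : 'rV[rat]_r) : Prop := \sum_(k < r) ratr (u 0 k) * theta k = 0.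

Let rel_mul n (w : 'rV[rat]_n) (A : 'M[rat]_(n, r)) :
  (forall i, rel (row i A)) -> rel (w *m A).
Proof.
move=> rA; rewrite /rel.
rewrite (eq_bigr (fun k => \sum_(i < n) ratr (w 0 i) * (ratr (A i k) * theta k))).
  rewrite exchange_big big1// => i _; rewrite -mulr_sumr.
  have := rA i; rewrite /rel; under eq_bigr do rewrite mxE.
  by move=> ->; rewrite mulr0.
move=> k _; rewrite mxE rmorph_sum mulr_suml; apply: eq_bigr => i _.
by rewrite rmorphM mulrA.
Qed.

Let relD u v : rel u -> rel v -> rel (u + v).
Proof.
rewrite /rel => u0 v0; under eq_bigr do rewrite mxE rmorphD mulrDl.
by rewrite big_split/= u0 v0 addr0.
Qed.

Let rel_max : exists A : 'M[rat]_r,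
  (forall i, rel (row i A)) /\ forall u, rel u -> (u <= A)%MS.
Proof.
pose p n := `[< exists A : 'M[rat]_r, (forall i, rel (row i A)) /\ \rank A = n >].
have p0 : exists n, p n.
  exists 0%N; apply/asboolP; exists 0; split; last exact: mxrank0.
  by move=> i; rewrite /rel big1// => k _; rewrite !mxE rmorph0 mul0r.
have pr n : p n -> (n <= r)%N by move=> /asboolP[A [_ <-]]; exact: rank_leq_row.
case: (ex_maxnP p0 pr) => n /asboolP[A [rA rkA]] nmax.
(* [A] has the largest rank among the matrices of relations, so adding the
   relation [u] to its row space does not enlarge it *)
exists A; split=> // u ru.
have AB : (A <= A + u)%MS by exact: addsmxSl.
have rB i : rel (row i (A + u)%MS).
  have /sub_addsmxP[w ->] : (row i (A + u)%MS <= A + u)%MS by exact: row_sub.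
  apply: relD; first exact: rel_mul.
  by apply: rel_mul => j; rewrite (_ : row j u = u)//; apply/rowP => k; rewrite mxE ord1.
have BA : (\rank (A + u)%MS <= \rank A)%N.
  by rewrite rkA; apply: nmax; apply/asboolP; exists (A + u)%MS.
apply: submx_trans (addsmxSr A u) _.
rewrite -(geq_leqif (mxrank_leqif_sup AB)); exact: BA.
Qed.

Lemma nat_nonroot (p : {poly rat}) : p != 0 -> exists n : nat, p.[n%:R] != 0.
Proof.
move=> p0; have [//|/forallNP h] := pselect (exists n : nat, p.[n%:R] != 0).
have := @max_poly_roots _ p [seq (n%:R : rat) | n <- iota 0 (size p)] p0.
rewrite size_map size_iota ltnn => H.
suff : false by []; apply: H.
  apply/allP => _ /mapP[n _ ->]; rewrite rootE.
  by have /negP/negPn := h n.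
by rewrite map_inj_uniq ?iota_uniq// => a b /eqP; rewrite eqr_nat => /eqP.
Qed.

(** The relations between the [theta k] form a rational subspace; each
    non-relation is a nonzero linear form on its orthogonal, hence a nonzero
    polynomial along a curve with coordinates $(1, x, x^2, \dots)$ in it, and
    some integer [x] avoids the roots of finitely many polynomials. *)
Lemma integer_functional (I : finType) (hs : I -> 'I_r -> int) :
  exists l : 'I_r -> int,
    (forall h, dot h theta = 0 -> \sum_k h k * l k = 0) /\
    (forall i, dot (hs i) theta != 0 -> \sum_k hs i k * l k != 0).
Proof.
have [A [rA Amax]] := rel_max.
pose row_of (h : 'I_r -> int) : 'rV[rat]_r := \row_k (h k)%:~R.
have relE h : rel (row_of h) <-> dot h theta = 0.
  by rewrite /rel /dot; under eq_bigr do rewrite mxE ratr_int.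
have coker h : row_of h *m cokermx A = 0 <-> dot h theta = 0.
  split=> [/eqP|/relE/Amax].
    by rewrite -submxE => /submxP[w wA]; apply/relE; rewrite wA; exact: rel_mul.
  by rewrite submxE => /eqP.
pose pol i : {poly rat} := rVpoly (row_of (hs i) *m cokermx A).
have pol0 i : dot (hs i) theta != 0 -> pol i != 0.
  apply: contra_neq => p0; apply/coker.
  by rewrite -[LHS]rVpolyK -/(pol i) p0 linear0.
have [x px] : exists x : nat,
    (\prod_(i | dot (hs i) theta != 0) pol i).[x%:R] != 0.
  by apply: nat_nonroot; apply/prodf_neq0 => i; exact: pol0.
pose v := cokermx A *m (\col_(j < r) (x%:R ^+ j : rat)).
have hv h : \sum_k (h k)%:~R * v k 0
    = (rVpoly (row_of h *m cokermx A)).[x%:R].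
  transitivity ((row_of h *m v) 0 0).
      by rewrite [RHS]mxE; apply: eq_bigr => k _; congr (_ * _); rewrite mxE.
  rewrite mulmxA [LHS]mxE horner_poly; apply: eq_bigr => k _.
  by rewrite valK; congr (_ * _); rewrite mxE.
(* [dd] clears the denominators of the rational solution [v] *)
pose dd : int := \prod_k denq (v k 0).
have dd0 : dd != 0 by apply/prodf_neq0 => k _; exact: denq_neq0.
pose l k : int := numq (dd%:~R * v k 0).
have lE k : (l k)%:~R = dd%:~R * v k 0 :> rat.
  rewrite /l numqK// /dd (bigD1 k)//= intrM mulrAC [_ * v k 0]mulrC -numqE -intrM.
  exact: intr_int.

exists l; split=> [h h0|i hi].
  apply/eqP; rewrite -(intr_eq0 rat) rmorph_sum/=.
  rewrite (eq_bigr (fun k => dd%:~R * ((h k)%:~R * v k 0))).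
    by rewrite -mulr_sumr hv (proj2 (coker h) h0) linear0 horner0 mulr0.
  by move=> k _; rewrite intrM lE mulrCA.
rewrite -(intr_eq0 rat) rmorph_sum/=.
rewrite (eq_bigr (fun k => dd%:~R * ((hs i k)%:~R * v k 0))).
  rewrite -mulr_sumr hv mulf_neq0 ?intr_eq0//.
  by move: px; rewrite horner_prod => /prodf_neq0; exact.
by move=> k _; rewrite intrM lE mulrCA.
Qed.

End IntegerFunctional.

(** * Small values of Laurent polynomials *)

Section SmallValues.
Context {R : realType}.
Implicit Types s : seq (R[i] * int).
Local Open Scope complex_scope.
Notation normc := Normc.normc.

Lemma normc_ge0 (z : R[i]) : 0 <= normc z.
Proof. by case: z => a b /=; rewrite sqrtr_ge0. Qed.

Lemma normc_sum (I : Type) (r : seq I) (P : pred I) (F : I -> R[i]) :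
  normc (\sum_(i <- r | P i) F i) <= \sum_(i <- r | P i) normc (F i).
Proof.
elim/big_rec2: _ => [|i y x _ yx]; first by rewrite Normc.normc0.
by rewrite (le_trans (le_normcD _ _))// lerD2l.
Qed.

Definition laurent s (w : R) : R[i] := \sum_(x <- s) x.1 * cexpi (x.2%:~R * w).

Definition root_angle (K : nat) (l : 'I_K) : R := l%:R * (pi *+ 2 / K%:R).

Lemma root_angle_inj K : injective (fun l : 'I_K => cexpi (root_angle l)).
Proof.
move=> l l'.
have K0 : 0 < K%:R :> R by rewrite ltr0n (leq_ltn_trans _ (ltn_ord l)).
have d0 : 0 < pi *+ 2 / K%:R :> R by rewrite divr_gt0// two_pi_gt0.
have b (i : 'I_K) : 0 <= root_angle i < pi *+ 2.
  rewrite /root_angle mulr_ge0 ?(ltW d0)//=.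
  rewrite -[ltRHS](divfK (lt0r_neq0 K0)) [ltRHS]mulrC ltr_pM2r//.
  by rewrite ltr_nat.
move=> /(cexpi_inj (b l) (b l')) /(mulIf (lt0r_neq0 d0)) /eqP.
by rewrite eqr_nat => /eqP /val_inj.
Qed.

(** Lagrange interpolation at [2 M + 1] of the [K] points recovers the
    coefficients from the values (by the inverse of a Vandermonde matrix), so that
    small values at that many points would make all the coefficients smaller than
    [c0]. *)
Lemma laurent_small_values (M K : nat) (c0 : R) (k0 : int) : 0 < c0 ->
  exists2 eps : R, 0 < eps & forall s,
    (forall x, x \in s -> (`|x.2| <= M)%N) ->
    c0 <= normc (\sum_(x <- s | x.2 == k0) x.1) ->
    (#|[pred l : 'I_K | (normc (laurent s (root_angle l)) < eps)%R]| <= 2 * M)%N.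
Proof.
move=> c00.
pose N := (2 * M)%N.
pose z (l : 'I_K) : R[i] := cexpi (root_angle l).
(* [eps] must not depend on the interpolation points: the constants of all the
   choices [f] of [N + 1] points are added up *)
pose V (f : {ffun 'I_N.+1 -> 'I_K}) : 'M[R[i]]_N.+1 :=
  Vandermonde N.+1 (\row_i z (f i)).
pose C f : R := \sum_i \sum_j normc (invmx (V f) i j).
have C0 f : 0 <= C f.
  by apply: sumr_ge0 => i _; apply: sumr_ge0 => j _; exact: normc_ge0.
pose B : R := 1 + \sum_f C f.
have B0 : 0 < B by rewrite ltr_pwDl// sumr_ge0.
have CB f : C f < B.
  by rewrite /B (bigD1 f)//= addrCA ltrDl ltr_pwDl// sumr_ge0.
exists (c0 / B); first by rewrite divr_gt0.
move=> s sM sc; rewrite leqNgt; apply/negP => cardN.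
set A := [pred l | _] in cardN.
pose f : {ffun 'I_N.+1 -> 'I_K} := [ffun i => enum_val (widen_ord cardN i)].
have finj : injective f.
  move=> i j; rewrite !ffunE => /enum_val_inj /(congr1 val) /= ij.
  exact: val_inj.
have fA i : normc (laurent s (root_angle (f i))) < c0 / B.
  by have := enum_valP (widen_ord cardN i); rewrite inE ffunE.
have Vunit : V f \in unitmx.
  rewrite unitmxE unitfE det_Vandermonde; apply/prodf_neq0 => i _.
  apply/prodf_neq0 => j ij; rewrite !mxE subr_eq0.
  apply/eqP => /root_angle_inj /finj ji.
  by rewrite ji ltnn in ij.
have k0M : (`|k0| <= M)%N.
  rewrite leqNgt; apply/negP => Mk.
  move: sc; rewrite big_seq_cond big1 ?Normc.normc0; first by rewrite leNgt c00.
  move=> x /andP[/sM xM /eqP xk]; move: xM; rewrite xk => kM.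
  by rewrite ltnNge kM in Mk.
have shift (k : int) : (`|k| <= M)%N -> exists2 n : nat, (n < N.+1)%N & k + M%:Z = n.
  move=> kM; have kM' : `|k| <= M%:Z by rewrite -abszE lez_nat.
  move: kM'; rewrite ler_norml => /andP[k1 k2].
  have k0' : 0 <= k + M%:Z by rewrite -lerBlDr sub0r.
  exists (absz (k + M%:Z)); last by rewrite abszE ger0_norm.
  rewrite ltnS -lez_nat abszE ger0_norm// /N mul2n -addnn PoszD.
  by rewrite lerD2r.
pose u : 'rV[R[i]]_N.+1 := \row_j \sum_(x <- s | x.2 + M%:Z == j%:Z) x.1.
have uV i : (u *m V f) 0 i = z (f i) ^+ M * laurent s (root_angle (f i)).
  rewrite mxE /laurent mulr_sumr.
  rewrite (eq_bigr (fun j : 'I_N.+1 => \sum_(x <- s | x.2 + M%:Z == j%:Z)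
     x.1 * z (f i) ^+ j)); last by move=> j _; rewrite !mxE mulr_suml.
  rewrite (exchange_big_dep xpredT)//= big_seq [RHS]big_seq.
  apply: eq_bigr => x /sM /shift[n nN xn].
  rewrite (big_pred1 (Ordinal nN)); last first.
    by move=> j; rewrite xn eqz_nat [LHS]eq_sym.
  rewrite mulrCA; congr (_ * _); rewrite /= /z -cexpiMn -cexpiMn -cexpiD.
  by rewrite -mulrDl -[n%:R]/(n%:Z%:~R) -xn intrD addrC.
have [n0 n0N k0n] := shift _ k0M.
have un0 : u 0 (Ordinal n0N) = \sum_(x <- s | x.2 == k0) x.1.
  rewrite mxE; apply: eq_bigl => x /=.
  by rewrite -k0n (inj_eq (addIr _)).
move: sc; rewrite -un0 -[u](mulmxK Vunit) mxE => sc.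
have : normc (\sum_j (u *m V f) 0 j * invmx (V f) j (Ordinal n0N))
    <= c0 / B * C f.
  apply: le_trans (normc_sum _ _ _) _; rewrite mulr_sumr.
  apply: ler_sum => j _; rewrite Normc.normcM uV Normc.normcM.
  rewrite /z -cexpiMn normc_cexpi mul1r.
  apply: ler_pM; rewrite ?normc_ge0 ?(ltW (fA j))//.
  rewrite (bigD1 (Ordinal n0N))//= lerDl.
  by apply: sumr_ge0 => i _; exact: normc_ge0.
move=> /(le_trans sc); apply/negP; rewrite -ltNge.
by rewrite mulrAC ltr_pdivrMr// ltr_pM2l.
Qed.

End SmallValues.

(** * Averages over twists of the phases *)

Section TwistedAverages.
Context {R : realType}.
Local Open Scope complex_scope.
Notation normc := Normc.normc.

Lemma sqn_normc (z : R[i]) : sqn z = normc z ^+ 2.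
Proof. by case: z => a b; rewrite /sqn /= sqr_sqrtr// addr_ge0 ?sqr_ge0. Qed.

(** A tent at 0, as a function of the square of a modulus. *)
Definition bump (eps y : R) : R := clamp01 (- (eps ^- 2) * y + 1).

Lemma bump0 eps : bump eps 0 = 1.
Proof. by rewrite /bump mulr0 add0r clamp01_eq1. Qed.

Lemma bump_small eps (z : R[i]) : 0 < eps ->
  bump eps (sqn z) <= (normc z < eps)%R%:R.
Proof.
move=> e0; rewrite /bump; case: ltP => [_|ez]; first exact: clamp01_le1.
rewrite clamp01_eq0// mulNr addrC subr_le0 mulrC ler_pdivlMr ?exprn_gt0//.
by rewrite mul1r sqn_normc ler_pXn2r ?nnegrE ?normc_ge0 ?(ltW e0).
Qed.

Lemma bump_lipschitz eps (x y : R) : 0 < eps ->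
  `|bump eps (x ^+ 2) - bump eps (y ^+ 2)| <= 2 / eps * `|x - y|.
Proof.
move=> e0.
have bE u : bump eps (u ^+ 2) = 1 - (Num.min `|u| eps / eps) ^+ 2.
  rewrite /bump -(real_normK (num_real u)); have u0 := normr_ge0 u.
  move: (`|u|) u0 => v v0; rewrite exprMn exprVn mulNr mulrC addrC.
  have e20 : 0 < eps ^+ 2 by rewrite exprn_gt0.
  have [ve|ev] := leP v eps; last first.
    rewrite mulfV ?gt_eqF// subrr clamp01_eq0// subr_le0 ler_pdivlMr// mul1r.
    by rewrite ler_pXn2r ?nnegrE ?(ltW e0)// ltW.
  have v1 : v ^+ 2 / eps ^+ 2 <= 1.
    by rewrite ler_pdivrMr// mul1r ler_pXn2r ?nnegrE ?(ltW e0).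
  have v2 : 0 <= v ^+ 2 / eps ^+ 2 by rewrite divr_ge0 ?sqr_ge0 ?(ltW e20).
  by rewrite /clamp01 min_r ?max_r//; lra.
rewrite !bE; set a := Num.min `|x| eps; set b := Num.min `|y| eps.
have ab : `|a - b| <= `|x - y|.
  apply: le_trans (ler_dist_dist x y).
  by apply: min_dist; rewrite ?subrr ?normr0.
have a0 : 0 <= a by rewrite le_min normr_ge0 ltW.
have b0 : 0 <= b by rewrite le_min normr_ge0 ltW.
have ae : a <= eps by rewrite ge_min lexx orbT.
have be : b <= eps by rewrite ge_min lexx orbT.
have -> : 1 - (a / eps) ^+ 2 - (1 - (b / eps) ^+ 2)
    = (b - a) * ((a + b) / eps ^+ 2).
  by field; rewrite gt_eqF.
rewrite normrM distrC mulrC; apply: ler_pM => //.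
have e20 : 0 < eps ^+ 2 by rewrite exprn_gt0.
rewrite ger0_norm; last by rewrite divr_ge0 ?addr_ge0// ltW.
rewrite ler_pdivrMr// expr2 mulrA divfK ?gt_eqF// mulr_natl mulr2n.
exact: lerD.
Qed.

Lemma utrig_clamp01 n (Phi : ('I_n -> R) -> R) (a b : R) : utrig Phi ->
  utrig (fun x => clamp01 (a * Phi x + b)).
Proof.
move=> uPhi; have U := @utrig_algebra R n; rewrite /clamp01.
apply: (ua_max U); first exact: (ua_cst U).
apply: (ua_min U); first exact: (ua_cst U).
apply: (ua_add U); last exact: (ua_cst U).
exact: (ua_scale U).
Qed.

Lemma utrig_bump n eps (V : ('I_n -> R) -> R[i]) : ctrig V ->
  utrig (fun x => bump eps (sqn (V x))).
Proof. by move=> cV; apply: utrig_clamp01; exact: (ctrig_sqrnorm cV). Qed.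

(** Group the terms with equal exponents. *)
Lemma laurent_coef (s : seq (R[i] * int)) w : laurent s w != 0 ->
  exists2 k, \sum_(x <- s | x.2 == k) x.1 != 0 & exists2 x, x \in s & x.2 = k.
Proof.
move=> sw; apply: contrapT => h; move/eqP: sw; apply.
pose E := undup [seq x.2 | x <- s].
transitivity (\sum_(k <- E)
    (\sum_(x <- s | x.2 == k) x.1) * cexpi (k%:~R * w)).
  rewrite /laurent.
  rewrite [RHS](eq_bigr (fun k => \sum_(x <- s | x.2 == k) x.1 * cexpi (x.2%:~R * w))).
    rewrite (exchange_big_dep xpredT)//= big_seq [RHS]big_seq.
    apply: eq_bigr => x xs.
    rewrite big_mkcond (bigD1_seq x.2) ?undup_uniq ?mem_undup ?map_f//= eqxx.
    by rewrite big1 ?addr0// => k; rewrite eq_sym => /negbTE ->.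
  by move=> k _; rewrite mulr_suml; apply: eq_bigr => x /eqP ->.
rewrite big_seq big1// => k; rewrite mem_undup => /mapP[x xs xk].
apply/eqP; rewrite mulf_eq0; apply/orP; left; apply/negPn/negP => k0.
by apply: h; exists k => //; exists x.
Qed.

(** Twisting the phases by an integer vector orthogonal to the relations between
    the frequencies does not change time averages, while along the twists the
    function is a Laurent polynomial, which is rarely small.  Hence a bound for
    the average of a tent at 0, uniform in the function. *)
Lemma twisted_average_small (M K : nat) (c0 : R) (k0 : int) :
  (0 < K)%N -> 0 < c0 ->
  exists2 eps : R, 0 < eps &
  forall n (lam : 'I_n -> R) (l : 'I_n -> int) (V : ('I_n -> R) -> R[i])
    (s : R -> seq (R[i] * int)),
  ctrig V ->
  (forall h, dot h lam = 0 -> \sum_k h k * l k = 0) ->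
  (forall t w, V (fun k => lam k * t + (l k)%:~R * w) = laurent (s t) w) ->
  (forall t x, x \in s t -> (`|x.2| <= M)%N) ->
  (forall t, c0 <= normc (\sum_(x <- s t | x.2 == k0) x.1)) ->
  forall del, 0 < del -> \forall X \near +oo,
    time_avg (fun t => bump eps (sqn (V (fun k => lam k * t)))) X
      <= (2 * M)%:R / K%:R + del.
Proof.
move=> K0 c00; have [eps eps0 small] := @laurent_small_values R M K _ k0 c00.
exists eps => // n lam l V s cV lrel Vs sM sc del del0.
pose Phi x := bump eps (sqn (V x)).
have uPhi : utrig Phi by exact: utrig_bump.
(* the [K] twists are by the [K]-th roots of unity *)
pose beta (i : 'I_K) k : R := (l k)%:~R * root_angle i.
have KR : 0 < K%:R :> R by rewrite ltr0n.
have li i : loc_integrable (fun t => Phi (fun k => lam k * t + beta i k)).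
  exact: utrig_flow_loc_integrable.
have l0 : loc_integrable (fun t => Phi (fun k => lam k * t)).
  exact: utrig_line_loc_integrable.
have brel i h : dot h lam = 0 -> dot h (beta i) = 0.
  move=> /lrel hl; rewrite /dot /beta.
  rewrite (eq_bigr (fun k => (h k * l k)%:~R * root_angle i)); last first.
    by move=> k _; rewrite intrM mulrA.
  by rewrite -mulr_suml -[X in X * _](rmorph_sum intr)/= hl mul0r.
have : \forall X \near +oo, forall i,
   `|time_avg (fun t => Phi (fun k => lam k * t + beta i k)
       - Phi (fun k => lam k * t)) X| <= del.
  apply: filter_forall => i.
  by have /cvgr0Pnorm_le/(_ _ del0) := time_avg_phase_shift (brel i) uPhi.
move=> nearH; near=> X.
have X0 : 0 < X by near: X; exact: nbhs_pinfty_gt.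
have H : forall i, `|time_avg (fun t => Phi (fun k => lam k * t + beta i k)
    - Phi (fun k => lam k * t)) X| <= del by near: X.
set A := time_avg _ X.
have AE i : A <= time_avg (fun t => Phi (fun k => lam k * t + beta i k)) X + del.
  have := H i; rewrite time_avgB// distrC => /(le_trans (ler_norm _)).
  by rewrite lerBlDl.
have : \sum_(i < K) A <= \sum_(i < K)
    (time_avg (fun t => Phi (fun k => lam k * t + beta i k)) X + del).
  by apply: ler_sum => i _; exact: AE.
rewrite sumr_const big_split/= sumr_const !card_ord -time_avg_sum// => AK.
have S2M : time_avg (fun t => \sum_(i < K) Phi (fun k => lam k * t + beta i k)) X
    <= (2 * M)%:R.
  rewrite -[leRHS](time_avg_cst _ X0); apply: le_time_avg => //.
  - exact: loc_integrable_sum.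
  - exact: loc_integrable_cst.
  move=> t _; apply: le_trans (_ : #|[pred i : 'I_K |
      (normc (laurent (s t) (root_angle i)) < eps)%R]|%:R <= _).
    rewrite -sum1_card natr_sum [leRHS]big_mkcond/=; apply: ler_sum => i _.
    rewrite /Phi /beta Vs; apply: le_trans (bump_small _ eps0) _.
    by rewrite inE; case: ifP.
  by rewrite ler_nat; exact: (small _ (@sM t) (sc t)).
rewrite -lerBlDr ler_pdivlMr// mulrBl lerBlDr !mulr_natr.
by apply: le_trans AK _; rewrite lerD2r.
Unshelve. all: by end_near. Qed.

End TwistedAverages.

(** * Ties have probability zero *)

Section NullSets.
Context {R : realType} d (Omega : measurableType d) (P : probability Omega R).

(** The tents dominate the indicator of [Y = 0]. *)
Lemma null_of_bump (Y : Omega -> R) : measurable_fun setT Y ->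
  (forall del : R, 0 < del -> exists2 eps : R, 0 < eps &
     \int[P]_w bump eps (Y w) <= del) ->
  P [set w | Y w = 0] = 0%E.
Proof.
move=> mY small.
have mA : measurable [set w | Y w = 0].
  by have := mY measurableT _ (measurable_set1 0); rewrite setTI.
have Pfin : P [set w | Y w = 0] \is a fin_num by rewrite fin_num_measure.
suff : fine (P [set w | Y w = 0]) <= 0.
  move=> h; apply/eqP; rewrite eq_le measure_ge0 andbT -(fineK Pfin).
  by rewrite lee_fin.
apply/ler_addgt0Pr => del del0; rewrite add0r; have [eps eps0] := small _ del0.
apply: le_trans.
have -> : fine (P [set w | Y w = 0]) = \int[P]_w \1_[set w | Y w = 0] w.
  by rewrite /Rintegral integral_indic// setIT.
apply: le_Rintegral => // [||w _].
- apply: (@prob_integrable _ _ _ _ _ 1) => [|w]; first exact: measurable_indic.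
  by rewrite indicE; case: (_ \in _); rewrite ?normr1 ?normr0.
- apply: (@prob_integrable _ _ _ _ _ 1) => [|w]; last exact: clamp01_norm.
  exact: measurable_ramp.
rewrite indicE; case: (boolP (_ \in _)) => [|_]; last exact: clamp01_ge0.
by rewrite inE => ->; rewrite bump0.
Qed.

Lemma null_gap D (Y : 'I_D -> Omega -> R) :
  (forall j, measurable_fun setT (Y j)) ->
  (forall j j' : 'I_D, j' = j.+1 :> nat -> P [set w | Y j w = Y j' w] = 0%E) ->
  P [set w | gap (Y^~ w) = 0] = 0%E.
Proof.
move=> mY Y0.
have mE (f : Omega -> R) : measurable_fun setT f -> measurable [set w | f w = 0].
  by move=> mf; have := mf measurableT _ (measurable_set1 0); rewrite setTI.
have mYE j j' : measurable [set w | Y j w = Y j' w].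
  rewrite (_ : [set w | _] = [set w | Y j w - Y j' w = 0]).
    by apply: mE; exact: measurable_funB.
  apply/seteqP; split => w /=; first by move=> ->; rewrite subrr.
  by move/eqP; rewrite subr_eq0 => /eqP.
have mg : measurable [set w | gap (Y^~ w) = 0].
  by apply: mE; exact: measurable_gap.
apply/(negligibleP _ mg).
have sub : [set w | gap (Y^~ w) = 0] `<=` \big[setU/set0]_(p : 'I_D * 'I_D |
    p.2 == p.1.+1 :> nat) [set w | Y p.1 w = Y p.2 w].
  move=> w /= /gap_eq0[j [j' [jj' e]]].
  by rewrite (bigD1 (j, j'))/= ?jj'//; left.
apply: (negligibleS sub); apply: big_ind => [|A B|p /eqP pp].
- exact: negligible_set0.
- exact: negligibleU.
- by apply/negligibleP => //; exact: Y0.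
Qed.

End NullSets.

Section PolynomialsOnLines.
Context {R : realType} (r : nat) (theta : 'I_r -> R) (W : mpoly r R[i]).
Notation normc := Normc.normc.

Let mz (m : multinom r) (k : 'I_r) : int := (m k)%:Z.

Lemma meval_cexpi (x : 'I_r -> R) : meval (fun i => cexpi (x i)) W
  = \sum_(m <- msupp W) mcoeff m W * cexpi (dot (mz m) x).
Proof.
rewrite mevalE; apply: eq_bigr => m _; congr (_ * _).
by rewrite /dot cexpi_sum; apply: eq_bigr => i _; rewrite -cexpiMn.
Qed.

Lemma ctrig_meval_cexpi : ctrig (fun x : 'I_r -> R => meval (fun i => cexpi (x i)) W).
Proof.
under eq_fun do rewrite meval_cexpi; apply: ctrig_sum => m.
by apply: ctrigM; [exact: ctrig_cst|exact: ctrig_cexpi].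
Qed.

(** Monomials with the same frequency along the line are grouped; as [W] does not
    vanish at the time [y0], some group has a nonzero sum, and the twist turns this
    sum into a coefficient of a Laurent polynomial. *)
Lemma polynomial_average_small (y0 : R) :
  meval (fun i => cexpi (theta i * y0)) W != 0 ->
  forall del : R, 0 < del -> exists2 eps : R, 0 < eps &
    \forall X \near +oo, time_avg (fun t =>
      bump eps (sqn (meval (fun i => cexpi (theta i * t)) W))) X <= del.
Proof.
move=> Wy0 del del0.
pose I := seq_sub (msupp W).
(* [l] must separate the exponents of the monomials that have distinct
   frequencies along the line *)
pose hs (p : I * I) k : int := mz (ssval p.1) k - mz (ssval p.2) k.
have [l [lrel lsep]] := integer_functional theta hs.
pose ex (m : multinom r) : int := \sum_k mz m k * l k.
have exP m m' : m \in msupp W -> m' \in msupp W -> ex m = ex m' ->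
    dot (mz m) theta = dot (mz m') theta.
  move=> mW mW' e; apply/eqP; rewrite -subr_eq0 -dotNl -dotDl.
  apply/negPn/negP => /(lsep (SeqSub mW, SeqSub mW')); apply/negP/negPn.
  rewrite /hs/=; under eq_bigr do rewrite mulrBl.
  by rewrite sumrB subr_eq0; apply/eqP.
pose s t : seq (R[i] * int) :=
  [seq (mcoeff m W * cexpi (dot (mz m) theta * t), ex m) | m <- msupp W].
have Vs t w : meval (fun k => cexpi (theta k * t + (l k)%:~R * w)) W
    = laurent (s t) w.
  rewrite meval_cexpi /laurent [RHS]big_map; apply: eq_bigr => m _ /=.
  rewrite -mulrA -cexpiD; congr (_ * cexpi _).
  rewrite dotDr !dotZr; congr (_ + _ * _).
  by rewrite /ex [RHS](rmorph_sum intr)/=; apply: eq_bigr => k _; rewrite intrM.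
have Wy0' : laurent (s y0) 0 != 0.
  rewrite -Vs; move: Wy0; congr (_ != _); apply: meval_eq => i.
  by rewrite mulr0 addr0.
have [k0 sk0 [_ /mapP[m0 m0W ->] /= m0k]] := laurent_coef Wy0'.
have sumE t : \sum_(x <- s t | x.2 == k0) x.1
   = cexpi (dot (mz m0) theta * t) * \sum_(m <- msupp W | ex m == k0) mcoeff m W.
  rewrite [LHS]big_map/= mulr_sumr big_seq_cond [RHS]big_seq_cond.
  apply: eq_bigr => m /andP[mW /eqP mk].
  have -> : dot (mz m) theta = dot (mz m0) theta.
    by apply: (exP _ _ mW m0W); exact: etrans mk (esym m0k).
  exact: mulrC.
(* all the terms of exponent [k0] have the same frequency, so that the modulus
   of their sum does not depend on [t] *)
pose c0 := normc (\sum_(m <- msupp W | ex m == k0) mcoeff m W).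
have c00 : 0 < c0.
  rewrite lt_neqAle normc_ge0 andbT eq_sym; apply: contra sk0.
  by move=> /eqP/Normc.eq0_normc e; rewrite sumE e mulr0.
pose M := \max_(m <- msupp W) `|ex m|%N.
have d1 : 0 < del / 2 / ((2 * M)%:R + 1).
  by rewrite !divr_gt0// ltr_wpDl.
have [k hk] := archi_inv d1.
have [eps eps0 small] := twisted_average_small M k0 (ltn0Sn k) c00.
exists eps => //.
have del20 : 0 < del / 2 by rewrite divr_gt0.
have sM t x : x \in s t -> (`|x.2| <= M)%N.
  move=> /mapP[m mW ->] /=.
  exact: (@leq_bigmax_seq _ (msupp W) xpredT (fun m => absz (ex m)) m mW isT).
have sc t : c0 <= normc (\sum_(x <- s t | x.2 == k0) x.1).
  by rewrite sumE Normc.normcM normc_cexpi mul1r.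
have := small _ theta l _ s ctrig_meval_cexpi lrel Vs sM sc _ del20.
apply: filterS => X; move/le_trans; apply.
rewrite [leRHS](splitr del) lerD2r ler_pdivrMr//.
have M1 : 0 < (2 * M)%:R + 1 :> R by rewrite ltr_wpDl.
move: hk; rewrite mulrA ler_pdivlMr// mul1r mulrC; apply: le_trans.
by rewrite lerDl.
Qed.

End PolynomialsOnLines.

(** * Partial sums of almost periodic expansions *)

Section Expansions.
Context {R : realType}.
Local Open Scope complex_scope.
Notation normc := Normc.normc.

Section PartialSums.
Variable theta : nat -> R.

(** The phases are separate variables so that each can be twisted on its own. *)
Definition psum (c : R) (b : R -> R[i]) (N : nat) (x : 'I_N -> R) : R[i] :=
  c%:C + \sum_(n < N) (b (theta n) * cexpi (x n)
                       + (b (theta n))^* * cexpi (- x n)).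

Lemma psum_real c b N x : @psum c b N x = (complex.Re (psum c b x))%:C.
Proof.
rewrite {1}/psum; set s := \sum_(_ < _) _.
have [u su] : exists u : R, s = u%:C.
  rewrite /s; elim/big_ind: _ => [|_ _ [u ->] [v ->]|n _]; first by exists 0.
    by exists (u + v); rewrite rmorphD.
  exists (2 * complex.Re (b (theta n) * cexpi (x n))).
  by rewrite cexpiN -(rmorphM (@conjc R)) addcJ rmorphM/= rmorph_nat.
by rewrite su -rmorphD /psum -/s su -rmorphD.
Qed.

Lemma ctrig_psum c b N : ctrig (@psum c b N).
Proof.
have cX (k : 'I_N) : ctrig (fun x : 'I_N -> R => cexpi (x k)).
  have := @ctrig_cexpi R N (fun i => (i == k)%:Z).
  rewrite [X in ctrig X](_ : _ = (fun x : 'I_N -> R => cexpi (x k)))//.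
  apply/funext => x; congr cexpi.
  rewrite /dot (bigD1 k)//= eqxx mul1r big1 ?addr0// => i /negbTE ->.
  by rewrite mul0r.
have cXN (k : 'I_N) : ctrig (fun x : 'I_N -> R => cexpi (- x k)).
  have := @ctrig_cexpi R N (fun i => - (i == k)%:Z).
  rewrite [X in ctrig X](_ : _ = (fun x : 'I_N -> R => cexpi (- x k)))//.
  apply/funext => x; congr cexpi.
  rewrite /dot (bigD1 k)//= eqxx mulN1r big1 ?addr0// => i /negbTE ->.
  by rewrite oppr0 mul0r.
apply: ctrigD; first exact: ctrig_cst.
apply: ctrig_sum => k; apply: ctrigD; apply: ctrigM => //; exact: ctrig_cst.
Qed.

Lemma psumB c b c' b' N x :
  @psum c b N x - psum c' b' x = psum (c - c') (fun u => b u - b' u) x.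
Proof.
rewrite /psum rmorphB/= opprD addrACA -sumrB; congr (_ + _).
by apply: eq_bigr => n _; rewrite rmorphB/= !mulrBl opprD addrACA.
Qed.

Definition rsum c b N (t : R) : R :=
  complex.Re (@psum c b N (fun n => theta n * t)).

Lemma loc_integrable_rsum c b N : loc_integrable (rsum c b N).
Proof.
have [uRe _] := ctrig_psum c b N.
exact: (utrig_line_loc_integrable (fun n : 'I_N => theta n) uRe).
Qed.

(** The partial sums are real, so that the modulus in the semi-norm is an
    absolute value. *)
Lemma B1_expansion_average (F : R -> R) c b : loc_integrable F ->
  B1_expansion F theta c b -> forall eta : R, 0 < eta ->
  \forall N \near \oo, \forall X \near +oo,
    time_avg (fun t => `|F t - rsum c b N t|) X <= eta.
Proof.
move=> lF eF eta eta0.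
have : \forall N \near \oo, (B1norm (fun t => (F t)%:C - (c%:C + \sum_(n < N)
      (b (theta n) * cexpi (theta n * t)
       + (b (theta n))^* * cexpi (- (theta n * t)))))%R < eta%:E)%E.
  have nb : ereal_nbhs 0%E (fun u : \bar R => (u < eta%:E)%E).
    by apply: open_ereal_lt'; rewrite lte_fin.
  exact: (eF _ nb).
apply: filterS => N; rewrite /B1norm limf_esupE => /ereal_inf_lt[_ [V FV <-] supV].
apply: filterS FV => X VX.
have h : (average (fun y => (normc ((F y)%:C - psum c b (fun n : 'I_N => theta n * y))%R)%:E) X
    < eta%:E)%E.
  apply: le_lt_trans supV; apply: ereal_sup_ubound.
  by exists X.
rewrite -lee_fin -average_time_avg; last first.
  by apply: loc_integrable_norm; apply: loc_integrableB => //; exact: loc_integrable_rsum.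
apply: le_trans (ltW h); rewrite le_eqVlt; apply/orP; left; apply/eqP.
congr (average _ X); apply/funext => t /=.
rewrite psum_real -rmorphB/=.
by rewrite expr0n addr0 sqrtr_sqr.
Qed.

End PartialSums.

(** Twisting only the phases of the frequencies in [T], which are independent of
    the other ones, moves the partial sums of the difference of the two
    expansions along Laurent polynomials with a fixed nonzero coefficient, so
    that this difference is rarely small, uniformly in the partial sum. *)
Lemma expansion_average_small (theta : nat -> R) (F F' : R -> R) (c c' : R)
    (b b' : R -> R[i]) (T : set R) (x0 : R) :
  injective theta -> (forall n, 0 < theta n) ->
  loc_integrable F -> loc_integrable F' ->
  B1_expansion F theta c b -> B1_expansion F' theta c' b' ->
  finite_set T -> T `<=` range theta ->
  is_direct_sum (Qspan (range theta)) (Qspan T) (Qspan (range theta `\` T)) ->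
  T x0 -> b x0 <> b' x0 ->
  forall del : R, 0 < del -> exists2 eps : R, 0 < eps &
    \forall X \near +oo, time_avg (fun t => bump eps ((F t - F' t) ^+ 2)) X <= del.
Proof.
move=> thinj thpos lF lF' eF eF' finT TT [_ TI] Tx0 bb' del del0.
have [N0 hN0] : exists N0, forall x, T x -> exists2 n, (n < N0)%N & theta n = x.
  have /finite_seqP[s sT] := finT.
  have : forall x, x \in s -> exists n, theta n = x.
    by move=> x xs; have [n _ <-] : range theta x; [apply: TT; rewrite sT|exists n].
  move=> hs; suff [N0 hN] : exists N0, forall x, x \in s -> exists2 n, (n < N0)%N & theta n = x.
    by exists N0 => x; rewrite sT; exact: hN.
  elim: s {sT} hs => [|x s IH] hs; first by exists 0%N.
  have [y ys|N1 hN1] := IH; first by apply: hs; rewrite inE ys orbT.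
  have [n nx] := hs x (mem_head _ _).
  exists (maxn n.+1 N1) => y; rewrite inE => /predU1P[->|/hN1[k kN ky]].
    by exists n => //; rewrite leq_max ltnSn.
  by exists k => //; rewrite leq_max kN orbT.
have [n0 n0N n0x] := hN0 _ Tx0.
(* Setting the frequencies outside [T] to 0 makes the basis vectors of these
   indices relations, which forces the twist [l] to vanish there.  The forms
   [hs] keep [l n0] apart from every other [l n] and from every [- l n], so that
   one coefficient of the Laurent polynomial is isolated. *)
pose inT n := `[< T (theta n) >].
pose lam (n : 'I_N0) : R := if inT n then theta n else 0.
pose e (n : nat) (i : 'I_N0) : int := ((i : nat) == n)%:Z.
pose hs (p : 'I_N0 * bool) (i : 'I_N0) : int :=
  e n0 i + (if p.2 then - e p.1 i else e p.1 i).
have edot (n : 'I_N0) (x : 'I_N0 -> R) : dot (e n) x = x n.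
  rewrite /dot (bigD1 n)//= /e eqxx mul1r big1 ?addr0// => i.
  by rewrite -val_eqE => /negbTE ->; rewrite mul0r.
have esum (n : 'I_N0) (l : 'I_N0 -> int) : \sum_k e n k * l k = l n.
  rewrite (bigD1 n)//= /e eqxx mul1r big1 ?addr0// => i.
  by rewrite -val_eqE => /negbTE ->; rewrite mul0r.
have [l [lrel lsep]] := integer_functional lam hs.
pose o0 := Ordinal n0N.
have lam0 : lam o0 = theta n0 by rewrite /lam /inT /= asboolT ?n0x.
have lam_ge0 n : 0 <= lam n by rewrite /lam; case: ifP => // _; exact/ltW/thpos.
have sep_neg (n : 'I_N0) : - l n != l o0.
  have := lsep (n, false); rewrite /hs/= dotDl !(edot o0) edot lam0.
  rewrite gt_eqF; last by rewrite ltr_pwDl ?thpos.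
  under eq_bigr do rewrite mulrDl.
  rewrite big_split/= (esum o0) esum => /(_ isT).
  by apply: contra => /eqP <-; rewrite addNr.
have sep_pos (n : 'I_N0) : n != o0 -> l n != l o0.
  move=> nn0; have := lsep (n, true); rewrite /hs/= dotDl dotNl (edot o0) edot lam0.
  rewrite subr_eq0 (_ : theta n0 == lam n = false).
    under eq_bigr do rewrite mulrDl mulNr.
    rewrite big_split/= (esum o0) sumrN esum => /(_ isT).
    by apply: contra => /eqP <-; rewrite subrr.
  apply/negbTE; rewrite /lam; case: ifP => _; last by rewrite gt_eqF ?thpos.
  by apply: contra nn0 => /eqP/thinj/esym h; exact/eqP/val_inj.
have l0n0 : l o0 != 0.
  apply/eqP => l0; have := sep_neg o0; by rewrite l0 oppr0 eqxx.
(* extension by 0 beyond [N0], which keeps the degree independent of [N] *)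
pose l' (n : nat) : int := if insub n is Some o then l o else 0.
have l'E (o : 'I_N0) : l' o = l o by rewrite /l' valK.
have l'big n : (N0 <= n)%N -> l' n = 0.
  by move=> h; rewrite /l' insubF// ltnNge h.
have l'0 (n : nat) : l' n = l o0 -> n = n0.
  have [nN|Nn] := ltnP n N0; last by rewrite l'big// => /esym/eqP; rewrite (negbTE l0n0).
  rewrite -[n]/(nat_of_ord (Ordinal nN)) l'E => h.
  apply/eqP; rewrite -[_ == _]/(Ordinal nN == o0).
  by apply: contraT => /sep_pos; rewrite h eqxx.
have l'N (n : nat) : - l' n != l o0.
  have [nN|Nn] := ltnP n N0; last by rewrite l'big// oppr0 eq_sym.
  by rewrite -[n]/(nat_of_ord (Ordinal nN)) l'E.
pose M := \max_(n < N0) `|l n|%N.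
have l'M n : (`|l' n| <= M)%N.
  have [nN|Nn] := ltnP n N0; last by rewrite l'big.
  rewrite -[n]/(nat_of_ord (Ordinal nN)) l'E.
  exact: (@leq_bigmax _ (fun n => absz (l n)) (Ordinal nN)).
have l'rel N (h : 'I_N -> int) : (N0 <= N)%N ->
    dot h (fun n : 'I_N => theta n) = 0 -> \sum_k h k * l' k = 0.
  (* the part over [T] of a relation lies in both spans, hence is a relation *)
  move=> NN0 h0.
  pose A := \sum_(n < N | inT n) (h n)%:~R * theta n.
  have AB : A + \sum_(n < N | ~~ inT n) (h n)%:~R * theta n = 0.
    by rewrite -[RHS]h0 /dot [RHS](bigID (fun n : 'I_N => inT n)).
  have AT : Qspan T A.
    exists N, (fun n : 'I_N => if inT n then (h n)%:~R else 0 : rat),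
      (fun n : 'I_N => if inT n then theta n else x0); split.
      by move=> k; case: ifP => // /asboolP.
    rewrite /A big_mkcond; apply: eq_bigr => n _; case: ifP => _.
      by rewrite ratr_int.
    by rewrite rmorph0 mul0r.
  have A0 : A = 0.
    have [/existsP[k1 k1T]|/existsPn allT] := boolP [exists n : 'I_N, ~~ inT n].
      have AT' : Qspan (range theta `\` T) A.
        exists N, (fun n : 'I_N => if inT n then 0 else - (h n)%:~R : rat),
          (fun n : 'I_N => if inT n then theta k1 else theta n); split.
          move=> k; case: ifPn => [_|kT]; split; do ?[by exists k1|by exists k].
            by move/asboolP: k1T.
          by move/asboolP: kT.
        move/eqP: AB; rewrite addr_eq0 => /eqP ->.
        rewrite -sumrN [LHS]big_mkcond; apply: eq_bigr => n _; case: (inT n) => /=.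
          by rewrite rmorph0 mul0r.
        by rewrite rmorphN/= ratr_int mulNr.
      have : (Qspan T `&` Qspan (range theta `\` T)) A by split.
      by rewrite TI.
    by move: AB; rewrite [X in _ + X]big1 ?addr0// => n nT; have := allT n; rewrite nT.
  have inTN (n : 'I_N) : inT n -> (n < N0)%N.
    by move=> /asboolP/hN0[n' n'N /thinj <-].
  have narrow (V : zmodType) (G : 'I_N -> V) : (forall n : 'I_N, (N0 <= n)%N -> G n = 0) ->
      \sum_(n < N) G n = \sum_(o < N0) G (widen_ord NN0 o).
    move=> G0; rewrite -big_ord_narrow (bigID (fun n : 'I_N => (n < N0)%N))/=.
    by rewrite [X in _ + X]big1 ?addr0// => n; rewrite -leqNgt; exact: G0.
  rewrite (narrow int (fun k : 'I_N => h k * l' k)); last first.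
    by move=> n /l'big ->; rewrite mulr0.
  rewrite (eq_bigr (fun o : 'I_N0 => h (widen_ord NN0 o) * l o)); last first.
    by move=> o _; rewrite /= l'E.
  apply: lrel; rewrite /dot -[RHS]A0 /A [RHS]big_mkcond
    (narrow R (fun n : 'I_N => if inT n then (h n)%:~R * theta n else 0)).
    by apply: eq_bigr => o _; rewrite /lam /=; case: ifP; rewrite ?mulr0.
  by move=> n Nn; case: ifP => // /inTN; rewrite ltnNge Nn.
pose bd u := b u - b' u.
pose c0 := normc (bd x0).
have c00 : 0 < c0.
  rewrite lt_neqAle normc_ge0 andbT eq_sym; apply/eqP => /Normc.eq0_normc /eqP.
  by rewrite subr_eq0 => /eqP.
have d1 : 0 < del / 3 / ((2 * M)%:R + 1).
  by rewrite !divr_gt0// ltr_wpDl.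
have [K hK] := archi_inv d1.
have [eps eps0 small] := twisted_average_small M (l o0) (ltn0Sn K) c00.
exists eps => //.
have del3 : 0 < del / 3 by rewrite divr_gt0.
have eta0 : 0 < eps / 2 * (del / 3 / 2) by rewrite !mulr_gt0// invr_gt0.
have [N [NN0 [hF hF']]] : exists N, (N0 <= N)%N /\
   (\forall X \near +oo, time_avg (fun t => `|F t - rsum theta c b N t|) X
       <= eps / 2 * (del / 3 / 2)) /\
   (\forall X \near +oo, time_avg (fun t => `|F' t - rsum theta c' b' N t|) X
       <= eps / 2 * (del / 3 / 2)).
  have H1 := B1_expansion_average lF eF eta0.
  have H2 := B1_expansion_average lF' eF' eta0.
  near \oo => N; exists N; split; first by near: N; exact: nbhs_infty_ge.
  by split; near: N.
pose V := @psum theta (c - c') bd N.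
pose s t : seq (R[i] * int) := ((c - c')%:C, 0) :: flatten
  [seq [:: (bd (theta n) * cexpi (theta n * t), l' n);
           ((bd (theta n))^* * cexpi (- (theta n * t)), - l' n)]
     | n : 'I_N <- index_enum _].
have Vs t w : V (fun n : 'I_N => theta n * t + (l' n)%:~R * w) = laurent (s t) w.
  rewrite /V /psum /laurent /s big_cons/= mul0r cexpi0 mulr1; congr (_ + _).
  rewrite big_flatten/= big_map; apply: eq_bigr => n _.
  rewrite !big_cons big_nil addr0/= -!mulrA -!cexpiD opprD; congr (_ + _ * cexpi (_ + _)).
  by rewrite mulrNz mulNr.
have sM t x : x \in s t -> (`|x.2| <= M)%N.
  rewrite inE => /predU1P[->//|/flattenP[_ /mapP[n _ ->]]].
  by rewrite !inE => /orP[]/eqP -> /=; rewrite ?abszN l'M.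
have sc t : c0 <= normc (\sum_(x <- s t | x.2 == l o0) x.1).
  rewrite /s big_cons/= eq_sym (negbTE l0n0) big_flatten/= big_map.
  have n0N' : (n0 < N)%N by exact: leq_trans n0N NN0.
  rewrite (bigD1 (Ordinal n0N'))//= [X in _ + X]big1 => [|n nn0].
    rewrite !big_cons big_nil/= (negbTE (l'N _)) addr0.
    rewrite -[n0]/(nat_of_ord o0) l'E eqxx addr0 /= n0x.
    by rewrite Normc.normcM normc_cexpi mulr1.
  rewrite !big_cons big_nil/= (negbTE (l'N _)).
  case: eqP => // /l'0 e0; move: nn0; rewrite -val_eqE /= e0 eqxx//.
have nearV := small _ (fun n : 'I_N => theta n) (fun n : 'I_N => l' n) V s
  (ctrig_psum _ _ _ _) (fun h => @l'rel N h NN0) Vs sM sc _ del3.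
pose U t : R := rsum theta c b N t - rsum theta c' b' N t.
have VU t : sqn (V (fun n : 'I_N => theta n * t)) = U t ^+ 2.
  rewrite /V -psumB psum_real (psum_real _ c') -rmorphB /sqn/=.
  by rewrite expr0n addr0.
have lr := loc_integrable_rsum.
have lbump (g : R -> R) : loc_integrable g -> loc_integrable (fun t => bump eps (g t ^+ 2)).
  move=> lg; apply: (@loc_integrable_bounded _ _ 1) => [X|t]; last exact: clamp01_norm.
  apply: measurable_ramp; apply: measurable_funX; exact: loc_integrable_measurable.
have lU : loc_integrable U by apply: loc_integrableB; exact: lr.
have lFF : loc_integrable (fun t => F t - F' t) by exact: loc_integrableB.
near=> X.
have X0 : 0 < X by near: X; exact: nbhs_pinfty_gt.
have h1 : time_avg (fun t => `|F t - rsum theta c b N t|) X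
    <= eps / 2 * (del / 3 / 2) by near: X.
have h2 : time_avg (fun t => `|F' t - rsum theta c' b' N t|) X
    <= eps / 2 * (del / 3 / 2) by near: X.
have h3 : time_avg (fun t => bump eps (sqn (V (fun n : 'I_N => theta n * t)))) X
    <= (2 * M)%:R / K.+1%:R + del / 3 by near: X.
have h3' : time_avg (fun t => bump eps (U t ^+ 2)) X
    <= (2 * M)%:R / K.+1%:R + del / 3.
  apply: le_trans h3; rewrite le_eqVlt; apply/orP; left; apply/eqP.
  by congr (time_avg _ X); apply/funext => t; rewrite VU.
have h4 : (2 * M)%:R / K.+1%:R <= del / 3.
  have M1 : 0 < (2 * M)%:R + 1 :> R by rewrite ltr_wpDl.
  rewrite ler_pdivrMr//; move: hK; rewrite mulrA ler_pdivlMr// mul1r mulrC.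
  by apply: le_trans; rewrite lerDl.
have lA : loc_integrable (fun t => `|F t - rsum theta c b N t|).
  by apply: loc_integrable_norm; apply: loc_integrableB => //; exact: lr.
have lA' : loc_integrable (fun t => `|F' t - rsum theta c' b' N t|).
  by apply: loc_integrable_norm; apply: loc_integrableB => //; exact: lr.
have : time_avg (fun t => bump eps ((F t - F' t) ^+ 2)) X <=
  time_avg (fun t => bump eps (U t ^+ 2) + 2 / eps *
   (`|F t - rsum theta c b N t| + `|F' t - rsum theta c' b' N t|)) X.
  apply: le_time_avg => //; first exact: lbump.
    apply: loc_integrableD; first exact: lbump.
    by apply: loc_integrableZ; exact: loc_integrableD.
  move=> t _; rewrite -lerBlDl.
  apply: le_trans (ler_norm _) _; apply: le_trans (bump_lipschitz _ _ eps0) _.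
  rewrite ler_wpM2l ?divr_ge0 ?(ltW eps0)//.
  rewrite /U opprB addrACA [- F' t + _]addrC.
  rewrite [X in `|X|](_ : _ = (F t - rsum theta c b N t) - (F' t - rsum theta c' b' N t)).
    exact: ler_normB.
  by ring.
rewrite time_avgD; [|exact: lbump|by apply: loc_integrableZ; exact: loc_integrableD].
rewrite time_avgZ; last exact: loc_integrableD.
rewrite time_avgD// => h5.
have h6 : 2 / eps * (time_avg (fun t => `|F t - rsum theta c b N t|) X
   + time_avg (fun t => `|F' t - rsum theta c' b' N t|) X) <= del / 3.
  rewrite [leRHS](_ : _ = 2 / eps * (eps / 2 * (del / 3 / 2) + eps / 2 * (del / 3 / 2))).
    by rewrite ler_wpM2l ?divr_ge0 ?(ltW eps0)// lerD.
  by field; rewrite gt_eqF.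
apply: (le_trans h5); rewrite [leRHS](_ : del = del / 3 + del / 3 + del / 3).
  by apply: lerD => //; apply: (le_trans h3'); exact: lerD.
by field.
Unshelve. all: by end_near. Qed.

End Expansions.

(** * Ordering densities of the two families *)

Section RationalOrdering.
Context {R : realType}.

(** Cross-multiplication: the denominators do not vanish on the torus, and the
    values there, being real, are determined by their real parts. *)
Lemma ratfun_eval_eq_meval (r : nat) (f f' : @ratfun R r) :
  no_pole_on_torus f -> no_pole_on_torus f' ->
  real_valued_on_torus f -> real_valued_on_torus f' ->
  exists W : mpoly r R[i], forall z, torus z ->
    (ratfun_real f z = ratfun_real f' z <-> meval z W = 0).
Proof.
move=> [A [B [fE B0]]] [A' [B' [fE' B'0]]] rf rf'.
exists (A * B' - A' * B) => z tz.
have Bz := B0 _ tz; have Bz' := B'0 _ tz.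
have reE : ratfun_real f z = ratfun_real f' z <-> ratfun_eval f z = ratfun_eval f' z.
  rewrite /ratfun_real; split; last by move=> ->.
  have := rf _ tz; have := rf' _ tz.
  by case: (ratfun_eval f z) (ratfun_eval f' z) => [? ?] [? ?] /= -> -> ->.
apply: (iff_trans reE).
rewrite (ratfun_evalE fE Bz) (ratfun_evalE fE' Bz') mevalB !mevalM.
split=> [/eqP|/eqP]; first by rewrite eqr_div// => /eqP ->; rewrite subrr.
by rewrite subr_eq0 => e; apply/eqP; rewrite eqr_div.
Qed.

Lemma utrig_gap (n D : nat) (Phi : 'I_D -> ('I_n -> R) -> R) :
  (forall j, utrig (Phi j)) -> utrig (fun x => gap (Phi^~ x)).
Proof.
move=> uPhi; have U := @utrig_algebra R n.
by apply: (ua_bigmin U) => p _; exact: (ua_sub U).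
Qed.

Variables (d : measure_display) (Omega : measurableType d) (P : probability Omega R).

Lemma ordering_densities_utrig (D m : nat) (Z : 'I_m -> {RV P >-> borelC R})
    (alpha : 'I_m -> R) (Phi : 'I_D -> ('I_m -> R) -> R) (F G : 'I_D -> R -> R)
    (Y : Omega -> 'I_D -> R) :
  (forall k, uniform_on_circle (Z k)) -> independent_RVs Z ->
  Qindependent alpha -> (forall j, utrig (Phi j)) ->
  (forall j t, F j t = Phi j (fun k => alpha k * t)) ->
  (forall w j, Y w j = Phi j (angles Z w)) ->
  (forall j, lebesgue_measurable (G j)) -> equal_up_to_o1 G F ->
  [/\ (P [set w | (0 < gap (Y w))%R] <= lower_density G)%E,
      (lower_density G <= upper_density G)%E,
      (upper_density G <= P [set w | (0 <= gap (Y w))%R])%E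
    & (forall j j' : 'I_D, j' = j.+1 :> nat -> P [set w | Y w j = Y w j'] = 0%E) ->
      has_density G (P [set w | (0 < gap (Y w))%R])].
Proof.
move=> uniZ indZ ind uPhi FE YE mG.
have -> : F = fun j t => Phi j (fun k => alpha k * t).
  by apply/funext => j; apply/funext => t; exact: FE.
have -> : Y = fun w j => Phi j (angles Z w).
  by apply/funext => w; apply/funext => j; exact: YE.
move=> GF.
have mY j := utrig_measurable (measurable_angles Z) (uPhi j).
have ug := utrig_gap uPhi.
have mF X := loc_integrable_measurable (X := X) (utrig_line_loc_integrable alpha ug).
have ramps a c := kronecker_weyl uniZ indZ ind (utrig_clamp01 a c ug).
have [h1 h2 h3 h4] := ordering_densities mG GF mF (measurable_gap mY) ramps.
by split=> // YY; apply: h4; exact: (null_gap mY).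
Qed.

Variables (D r m : nat) (theta : 'I_r -> R) (e : 'I_m -> 'I_r) (b : 'I_m -> 'I_r -> rat).
Variables (Z : 'I_m -> {RV P >-> borelC R}) (f : 'I_D -> @ratfun R r) (G : 'I_D -> R -> R).
Hypothesis thetaP : Qbasis_coords theta e b.
Hypothesis uniZ : forall k, uniform_on_circle (Z k).
Hypothesis indZ : independent_RVs Z.
Hypothesis polef : forall j, no_pole_on_torus (f j).
Hypothesis realf : forall j, real_valued_on_torus (f j).

Let y (x : 'I_m -> R) : 'I_r -> R[i] := Ztheta e b (fun k => cexpi (x k)).
Let Phi j x := ratfun_real (f j) (y x).

Let yE x : y x = fun i => cexpi (dot (Zexponents e b i) x).
Proof. by apply/funext => i; exact: Ztheta_cexpi. Qed.

Let ytorus x : torus (y x).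
Proof. by rewrite yE => i; exact: norm_cexpi. Qed.

Let y_line t : y (fun k => base_freqs theta e b k * t) = fun i => cexpi (theta i * t).
Proof.
rewrite yE; apply/funext => i; congr cexpi.
by rewrite dotZr (dot_Zexponents thetaP).
Qed.

Let y_angles w : y (angles Z w) = Ztheta e b (fun k => Z k w).
Proof. by rewrite /y; congr Ztheta; apply/funext => k; rewrite (cexpi_angles uniZ). Qed.

Let uPhi j : utrig (Phi j).
Proof.
have E : Phi j = fun x => ratfun_real (f j) (fun i => cexpi (dot (Zexponents e b i) x)).
  by apply/funext => x; rewrite /Phi yE.
by rewrite E; exact: ratfun_real_utrig.
Qed.

(** The gap of the rational functions is a uniform limit of trigonometric
    polynomials in the angles, to which equidistribution applies; the numerator
    of a difference that does not vanish identically on the line is rarely small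
    there, hence almost surely nonzero at [Ztheta]. *)
Lemma ordering_densities_rational :
  let F j t := ratfun_real (f j) (fun i => cexpi (theta i * t)) in
  let fZ w j := ratfun_real (f j) (Ztheta e b (fun k => Z k w)) in
  (forall j, lebesgue_measurable (G j)) ->
  equal_up_to_o1 G F ->
  [/\ (P [set w | (0 < gap (fZ w))%R] <= lower_density G)%E,
      (lower_density G <= upper_density G)%E,
      (upper_density G <= P [set w | (0 <= gap (fZ w))%R])%E
    & (forall j j' : 'I_D, j' = j.+1 :> nat -> exists t : R, F j t <> F j' t) ->
      has_density G (P [set w | (0 < gap (fZ w))%R])].
Proof.
move=> F fZ mG GF.
have FE j t : F j t = Phi j (fun k => base_freqs theta e b k * t).
  by rewrite /F /Phi y_line.
have fZE w j : fZ w j = Phi j (angles Z w) by rewrite /fZ /Phi y_angles.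
have [h1 h2 h3 h4] := ordering_densities_utrig uniZ indZ
  (base_freqs_Qindependent thetaP) uPhi FE fZE mG GF.
split=> // FF; apply: h4 => j j' jj'.
have [t0 Ft0] := FF _ _ jj'.
have [W WE] := ratfun_eval_eq_meval (polef j) (polef j') (@realf j) (@realf j').
have cW : ctrig (fun x => meval (y x) W).
  rewrite (_ : (fun x => _) = fun x =>
      meval (fun i => cexpi (dot (Zexponents e b i) x)) W); first exact: ctrig_meval.
  by apply/funext => x; rewrite yE.
pose Y w := sqn (meval (y (angles Z w)) W).
have -> : [set w | fZ w j = fZ w j'] = [set w | Y w = 0].
  apply/seteqP; split => w.
    by rewrite /= !fZE => /WE h; apply/eqP; rewrite sqn_eq0 h.
  by rewrite /= => /eqP; rewrite sqn_eq0 => /eqP/WE; rewrite !fZE; exact.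
apply: null_of_bump => [|del del0].
  exact: (utrig_measurable (measurable_angles Z) (ctrig_sqrnorm cW)).
have Wt0 : meval (fun i => cexpi (theta i * t0)) W != 0.
  rewrite -y_line; apply/eqP => /(proj2 (WE _ (ytorus _))).
  by rewrite y_line.
have [eps eps0 small] := polynomial_average_small Wt0 del0.
exists eps; first exact: eps0.
have := kronecker_weyl uniZ indZ (base_freqs_Qindependent thetaP) (utrig_bump eps cW).
rewrite [X in X @ _](_ : _ = fun X => time_avg (fun t =>
    bump eps (sqn (meval (fun i => cexpi (theta i * t)) W))) X).
  by move=> h; exact: (cvgr_to_le h).
by apply/funext => X; congr (time_avg _ X); apply/funext => t; rewrite y_line.
Qed.

End RationalOrdering.

Section AlmostPeriodicOrdering.
Context {R : realType}.
Variables (D : nat) (theta : nat -> R) (F : 'I_D -> R -> R)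
  (c : 'I_D -> R) (a : R -> 'I_D -> R[i]) (G : 'I_D -> R -> R).
Variables (d : measure_display) (Omega : measurableType d) (P : probability Omega R).
Variable S : {RV P >-> borelRn R D}.
Hypothesis thinj : injective theta.
Hypothesis thpos : forall n, 0 < theta n.
Hypothesis lF : forall j, loc_integrable (F j).
Hypothesis limS : limiting_distribution (fun t => \row_j F j t) (distribution P S).

Let Sv (w : Omega) : 'rV[R]_D := S w.

(** Real form of the convergence defining a limiting distribution. *)
Lemma limiting_time_avg (g : 'rV[R]_D -> R) : continuous g ->
  (forall x, `|g x| <= 1) -> loc_integrable (fun t => g (\row_j F j t)) ->
  time_avg (fun t => g (\row_j F j t)) X @[X --> +oo] --> \int[P]_w g (Sv w).
Proof.
move=> cg g1 lg.
have gb : exists M : R, forall x, `|g x| <= M by exists 1.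
have mg : measurable_fun setT (g : borelRn R D -> R) by exact: continuous_borel_measurable.
have mS : measurable_fun setT (S : Omega -> borelRn R D) by exact: measurable_funPT.
have igS : P.-integrable setT (EFin \o (fun w => g (Sv w))).
  by apply: (@prob_integrable _ _ _ _ _ 1) => //; exact: (measurableT_comp mg mS).
have E : (\int[distribution P S]_x (g x)%:E = (\int[P]_w g (Sv w))%:E)%E.
  rewrite /Rintegral fineK; last exact: integrable_fin_num igS.
  rewrite /distribution.
  apply: (@integral_pushforward _ _ _ _ _ _ mS P setT (EFin \o g)) => //.
  exact/measurable_EFinP.
have := limS cg gb; rewrite E.
rewrite (_ : average _ = fun X => (time_avg (fun t => g (\row_j F j t)) X)%:E).
  by move=> /fine_cvgP[_].
by apply/funext => X; rewrite -average_time_avg.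
Qed.

Let gap_row_continuous : continuous (fun v : 'rV[R]_D => gap (v ord0)).
Proof.
move=> v; apply/(@cvgrPdist_le _ _ _ _ (@nbhs_filter 'rV[R]_D v)) => eps eps0.
have e2 : 0 < eps / 2 by rewrite divr_gt0.
have := @nbhs_filter 'rV[R]_D v => FF.
have H : \forall w \near v, forall j, `|v ord0 j - (w : 'rV[R]_D) ord0 j| <= eps / 2.
  apply: (@filter_forall 'rV[R]_D 'I_D
    (fun j w => `|v ord0 j - w ord0 j| <= eps / 2) (nbhs v) FF).
  move=> j; have cj := @coord_continuous R 1 D ord0 j v.
  exact: ((@cvgrPdist_le _ _ _ _ FF _ _).1 cj _ e2).
apply: (@filterS _ _ FF _ _ _ H) => w vw.
rewrite [eps](_ : _ = (eps / 2) *+ 2); last by rewrite -mulr_natr divfK.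
by apply: gap_dist => //; exact: ltW.
Qed.

Let clamp_continuous (g : 'rV[R]_D -> R) (u v : R) : continuous g ->
  continuous (fun x => clamp01 (u * g x + v)).
Proof.
move=> cg x; apply: (@continuous_comp 'rV[R]_D _ _ (fun x => u * g x + v) clamp01).
  apply: continuousD; last exact: cst_continuous.
  by apply: (@continuousM _ 'rV[R]_D); [exact: cst_continuous|exact: cg].
apply/cvgrPdist_le => e e0; near=> z.
apply: le_trans (clamp01_lip _ _) _; near: z.
apply: (@cvgr_dist_le _ _ _ _ _ id) => //; exact: cvg_id.
Unshelve. all: by end_near. Qed.

Let clamp_loc_integrable (g : R -> R) (u v : R) :
  (forall X, measurable_fun (`[0, X] : set (lebesgueType R)) g) ->
  loc_integrable (fun t => clamp01 (u * g t + v)).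
Proof.
move=> mg; apply: (@loc_integrable_bounded _ _ 1) => [X|t]; last exact: clamp01_norm.
exact: (measurable_ramp u v (@mg X)).
Qed.

Lemma ordering_densities_almost_periodic :
  let Svec w j := (S w : 'rV[R]_D) 0 j in
  (forall j, lebesgue_measurable (G j)) ->
  equal_up_to_o1 G F ->
  [/\ (P [set w | (0 < gap (Svec w))%R] <= lower_density G)%E,
      (lower_density G <= upper_density G)%E,
      (upper_density G <= P [set w | (0 <= gap (Svec w))%R])%E
    & (forall j, B1_expansion (F j) theta (c j) (a ^~ j)) ->
      forall T : set R, finite_set T -> T `<=` range theta ->
      is_direct_sum (Qspan (range theta)) (Qspan T) (Qspan (range theta `\` T)) ->
      (forall j j' : 'I_D, j' = j.+1 :> nat -> exists2 x, T x & a x j <> a x j') ->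
      has_density G (P [set w | (0 < gap (Svec w))%R])].
Proof.
move=> Svec mG GF.
have mS : measurable_fun setT (S : Omega -> borelRn R D) by exact: measurable_funPT.
have mSv j : measurable_fun setT (Svec^~ j).
  have mc : measurable_fun setT ((fun v : 'rV[R]_D => v 0 j) : borelRn R D -> R).
    by apply: continuous_borel_measurable; exact: coord_continuous.
  exact: (measurableT_comp mc mS).
have mg : measurable_fun setT (fun w => gap (Svec w)) by exact: measurable_gap.
have mF X : measurable_fun (`[0, X] : set (lebesgueType R)) (fun t => gap (F^~ t)).
  by apply: measurable_gap => j; exact: loc_integrable_measurable.
have rowE t : (\row_j F j t) ord0 = F^~ t by apply/funext => j; rewrite mxE.
have ramps u v : time_avg (fun t => clamp01 (u * gap (F^~ t) + v)) X @[X --> +oo]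
    --> \int[P]_w clamp01 (u * gap (Svec w) + v).
  have rE : (fun t => clamp01 (u * gap (F^~ t) + v)) =
      fun t => clamp01 (u * gap ((\row_j F j t) ord0) + v).
    by apply/funext => t; rewrite rowE.
  rewrite rE; apply: (limiting_time_avg (g := fun x => clamp01 (u * gap (x ord0) + v))).
  - exact: (@clamp_continuous _ u v gap_row_continuous).
  - by move=> x; exact: clamp01_norm.
  - by rewrite -rE; exact: clamp_loc_integrable.
have [h1 h2 h3 h4] := ordering_densities mG GF mF mg ramps.
split=> // eF T finT TT dirT aT; apply: h4.
apply: (@null_gap _ _ _ _ _ (fun j w => Svec w j)) => // j j' jj'.
have [x0 Tx0 ax0] := aT _ _ jj'.
have -> : [set w | Svec w j = Svec w j'] = [set w | (Svec w j - Svec w j') ^+ 2 = 0].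
  apply/seteqP; split => w /=; first by move=> ->; rewrite subrr expr0n.
  by move/eqP; rewrite sqrf_eq0 subr_eq0 => /eqP.
apply: null_of_bump => [|del del0].
  by apply: measurable_funX; exact: measurable_funB.
have [eps eps0 small] := expansion_average_small thinj thpos (@lF j) (@lF j')
  (eF j) (eF j') finT TT dirT Tx0 ax0 del0.
exists eps; first exact: eps0.
have rE : (fun t => bump eps ((F j t - F j' t) ^+ 2)) = fun t =>
    bump eps (((\row_i F i t) ord0 j - (\row_i F i t) ord0 j') ^+ 2).
  by apply/funext => t; rewrite !mxE.
have := @limiting_time_avg (fun x => bump eps ((x ord0 j - x ord0 j') ^+ 2)).
rewrite -rE => H.
have cj (i : 'I_D) : continuous (fun x : 'rV[R]_D => x ord0 i) by exact: coord_continuous.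
have cB : continuous (fun x : 'rV[R]_D => x ord0 j - x ord0 j').
  by move=> x; apply: continuousB; exact: cj.
have {}H : time_avg (fun t => bump eps ((F j t - F j' t) ^+ 2)) X @[X --> +oo]
    --> \int[P]_w bump eps ((Svec w j - Svec w j') ^+ 2).
  apply: H.
  - apply: clamp_continuous; under eq_fun do rewrite expr2.
    by move=> x; apply: (@continuousM _ 'rV[R]_D); exact: cB.
  - by move=> x; exact: clamp01_norm.
  - apply: clamp_loc_integrable => X.
    apply: measurable_funX; apply: measurable_funB; exact: loc_integrable_measurable.
exact: (cvgr_to_le H).
Qed.

End AlmostPeriodicOrdering.

Theorem theorem3p2 (R : realType) :
  (forall (D r m : nat) (theta : 'I_r -> R)
      (e : 'I_m -> 'I_r) (b : 'I_m -> 'I_r -> rat)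
      (d : measure_display) (Omega : measurableType d)
      (P : probability Omega R) (Z : 'I_m -> {RV P >-> borelC R})
      (f : 'I_D -> @ratfun R r) (G : 'I_D -> R -> R),
    let F j t := ratfun_real (f j) (fun i => cexpi (theta i * t)) in
    let fZ w j := ratfun_real (f j) (Ztheta e b (fun k => Z k w)) in
    Qbasis_coords theta e b ->
    (forall k, uniform_on_circle (Z k)) ->
    independent_RVs Z ->
    injective f ->
    (forall j, no_pole_on_torus (f j)) ->
    (forall j, real_valued_on_torus (f j)) ->
    (forall j, lebesgue_measurable (G j)) ->
    equal_up_to_o1 G F ->
    [/\ (P [set w | decreasing_vec (fZ w)] <= lower_density G)%E,
        (lower_density G <= upper_density G)%E,
        (upper_density G <= P [set w | nonincreasing_vec (fZ w)])%E
      & (forall j j' : 'I_D, j' = j.+1 :> nat ->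
           exists y : R, F j y <> F j' y) ->
        has_density G (P [set w | decreasing_vec (fZ w)])])
  /\
  (forall (D : nat) (theta : nat -> R) (F : 'I_D -> R -> R)
      (c : 'I_D -> R) (a : R -> 'I_D -> R[i]) (G : 'I_D -> R -> R)
      (d : measure_display) (Omega : measurableType d)
      (P : probability Omega R) (S : {RV P >-> borelRn R D}),
    let Theta := range theta in
    let Svec w j := (S w : 'rV[R]_D) 0 j in
    injective theta ->
    (forall n, 0 < theta n) ->
    (forall j, B1_almost_periodic (F j)) ->
    (forall j, B1_expansion (F j) theta (c j) (a ^~ j)) ->
    (forall j, lebesgue_measurable (G j)) ->
    equal_up_to_o1 G F ->
    limiting_distribution (fun y => \row_j F j y) (distribution P S) ->
    [/\ (P [set w | decreasing_vec (Svec w)] <= lower_density G)%E,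
        (lower_density G <= upper_density G)%E,
        (upper_density G <= P [set w | nonincreasing_vec (Svec w)])%E
      & forall T : set R, finite_set T -> T !=set0 -> T `<=` Theta ->
        is_direct_sum (Qspan Theta) (Qspan T) (Qspan (Theta `\` T)) ->
        (forall j j' : 'I_D, j' = j.+1 :> nat ->
           exists2 x, T x & a x j <> a x j') ->
        has_density G (P [set w | decreasing_vec (Svec w)])]).
Proof.
have decE D (Omega : Type) (Y : Omega -> 'I_D -> R) :
    [set w | decreasing_vec (Y w)] = [set w | (0 < gap (Y w))%R].
  by apply/seteqP; split => w /decreasing_vec_gap.
have nincE D (Omega : Type) (Y : Omega -> 'I_D -> R) :
    [set w | nonincreasing_vec (Y w)] = [set w | (0 <= gap (Y w))%R].
  by apply/seteqP; split => w /nonincreasing_vec_gap.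
split.
- move=> D r m theta e b d Omega P Z f G F fZ thetaP uniZ indZ _ polef realf mG GF.
  rewrite decE nincE.
  exact: (ordering_densities_rational thetaP uniZ indZ polef realf mG GF).
move=> D theta F c a G d Omega P S Theta Svec thinj thpos apF eF mG GF limS.
rewrite decE nincE.
have lF j : loc_integrable (F j) by have [] := apF j.
have [h1 h2 h3 h4] := ordering_densities_almost_periodic c a thinj thpos lF limS mG GF.
by split=> // T finT _; exact: h4.
Qed.
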